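(* Let $\varphi$ be any sentence of second-order arithmetic such that $\mathsf{WKL}_0+\mathsf{RT}^2_2+\mathsf{PA}\vdash\varphi$ and $\mathsf{RCA}_0\nvDash_\omega\varphi$. Then for every computable dilator $D$, $\mathsf{RCA}_0+\mathsf{PA}\nvdash\varphi\leftrightarrow\text{``$D$ is a dilator''}$.
   Context: $\mathsf{RT}^2_2$ is Ramsey's theorem for pairs and two colours; $\mathsf{PA}$, in the context of second-order arithmetic, denotes the schema of induction for all arithmetical formulas with set parameters. $\mathsf T\vDash_\omega\varphi$ (for a sentence $\varphi$) means there is $Y\subseteq\mathbb N$ such that every $\omega$-model $\mathcal M\vDash\mathsf T$ with $Y\in\mathcal M$ satisfies $\varphi$. Linear orders have underlying set a subset of $\mathbb N$. $\mathsf{Nat}$ is the category of finite orders $n=\{0,\ldots,n-1\}$ with order embeddings, $\mathsf{LO}$ that of all linear orders. A (coded) predilator is a functor $D:\mathsf{Nat}\to\mathsf{LO}$ that is monotone ($f\le g$ pointwise implies $D(f)\le D(g)$) together with a natural transformation $\mathrm{supp}:D\Rightarrow[\cdot]^{<\omega}$ to the finite-powerset functor such that for every $f:m\to n$, every $\tau\in D(n)$ with $\mathrm{supp}_n(\tau)\subseteq\mathrm{rng}(f)$ lies in $\mathrm{rng}(D(f))$; it is coded by a subset of $\mathbb N$ and is computable if that set is (then it is given to the theories via a program index). For a finite order $a$ let $\mathrm{en}_a:|a|\to a$ be its increasing enumeration and, for embeddings $f:a\to b$ of finite orders, $|f|$ the morphism with $\mathrm{en}_b\circ|f|=f\circ\mathrm{en}_a$.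 For a linear order $\alpha$, $\overline D(\alpha)$ is the set of pairs $(\sigma,a)$ with $a$ a finite subset of $\alpha$, $\sigma\in D(|a|)$, $\mathrm{supp}_{|a|}(\sigma)=\{0,\ldots,|a|-1\}$, with $(\sigma,a)\le(\tau,b)$ iff $D(|\iota_a|)(\sigma)\le D(|\iota_b|)(\tau)$ for the inclusions of $a,b$ into $a\cup b$. $D$ is a dilator if $\overline D(\alpha)$ is well-founded whenever $\alpha$ is a well order; ``$D$ is a dilator'' denotes this second-order statement. *)

(* Defs.v *)
From Stdlib Require List.
From mathcomp Require Import all_boot.
From mathcomp Require Import finmap.

Set Implicit Arguments.
Unset Strict Implicit.
Unset Printing Implicit Defensive.

(* Second-order arithmetic as a two-sorted first-order language, with de
   Bruijn indices counted separately for the two sorts. The only set terms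
   are set variables. *)

Inductive term : Type :=
| TVar (i : nat)
| TZero
| TOne
| TAdd (t u : term)
| TMul (t u : term).

Inductive formula : Type :=
| FEq (t u : term)
| FLt (t u : term)
| FIn (t : term) (X : nat)
| FBot
| FImp (A B : formula)
| FAnd (A B : formula)
| FOr (A B : formula)
| FAll (A : formula)
| FEx (A : formula)
| FAll2 (A : formula)
| FEx2 (A : formula).

Definition FNot A := FImp A FBot.
Definition FIff A B := FAnd (FImp A B) (FImp B A).

Fixpoint tsubst (s : nat -> term) (t : term) : term :=
  match t with
  | TVar i => s i
  | TZero => TZero
  | TOne => TOne
  | TAdd t u => TAdd (tsubst s t) (tsubst s u)
  | TMul t u => TMul (tsubst s t) (tsubst s u)
  end.

Definition tshift : term -> term := tsubst (fun i => TVar i.+1).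

Definition up (s : nat -> term) (i : nat) : term :=
  if i is j.+1 then tshift (s j) else TVar 0.

Definition up2 (r : nat -> nat) (i : nat) : nat :=
  if i is j.+1 then (r j).+1 else 0.

(* [s] acts on number variables, [r] renames set variables. *)
Fixpoint fsubst (s : nat -> term) (r : nat -> nat) (A : formula) : formula :=
  match A with
  | FEq t u => FEq (tsubst s t) (tsubst s u)
  | FLt t u => FLt (tsubst s t) (tsubst s u)
  | FIn t X => FIn (tsubst s t) (r X)
  | FBot => FBot
  | FImp A B => FImp (fsubst s r A) (fsubst s r B)
  | FAnd A B => FAnd (fsubst s r A) (fsubst s r B)
  | FOr A B => FOr (fsubst s r A) (fsubst s r B)
  | FAll A => FAll (fsubst (up s) r A)
  | FEx A => FEx (fsubst (up s) r A)
  | FAll2 A => FAll2 (fsubst s (up2 r) A)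
  | FEx2 A => FEx2 (fsubst s (up2 r) A)
  end.

Definition shift1 : formula -> formula := fsubst (fun i => TVar i.+1) id.
Definition shift2 : formula -> formula := fsubst TVar succn.

Definition inst1 (A : formula) (t : term) : formula :=
  fsubst (fun i => if i is j.+1 then TVar j else t) id A.
Definition inst2 (A : formula) (X : nat) : formula :=
  fsubst TVar (fun i => if i is j.+1 then j else X) A.

Fixpoint tclosed (d : nat) (t : term) : bool :=
  match t with
  | TVar i => i < d
  | TZero | TOne => true
  | TAdd t u | TMul t u => tclosed d t && tclosed d u
  end.

Fixpoint fclosed (d e : nat) (A : formula) : bool :=
  match A with
  | FEq t u | FLt t u => tclosed d t && tclosed d u
  | FIn t X => tclosed d t && (X < e)
  | FBot => true
  | FImp A B | FAnd A B | FOr A B => fclosed d e A && fclosed d e B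
  | FAll A | FEx A => fclosed d.+1 e A
  | FAll2 A | FEx2 A => fclosed d e.+1 A
  end.

Definition sentence (A : formula) : bool := fclosed 0 0 A.

(* Members of the theory, unlike the hypotheses in the context, are not
   shifted by the introduction rules for the universal quantifiers, so that
   open formulas in a theory stand for their universal closures. *)

Definition theory := formula -> Prop.

Inductive nd (T : theory) : seq formula -> formula -> Prop :=
| nd_theory G A : T A -> nd T G A
| nd_hyp G A : List.In A G -> nd T G A
| nd_impI G A B : nd T (A :: G) B -> nd T G (FImp A B)
| nd_impE G A B : nd T G (FImp A B) -> nd T G A -> nd T G B
| nd_andI G A B : nd T G A -> nd T G B -> nd T G (FAnd A B)
| nd_andE1 G A B : nd T G (FAnd A B) -> nd T G A
| nd_andE2 G A B : nd T G (FAnd A B) -> nd T G B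
| nd_orI1 G A B : nd T G A -> nd T G (FOr A B)
| nd_orI2 G A B : nd T G B -> nd T G (FOr A B)
| nd_orE G A B C :
    nd T G (FOr A B) -> nd T (A :: G) C -> nd T (B :: G) C -> nd T G C
| nd_raa G A : nd T (FNot A :: G) FBot -> nd T G A
| nd_allI G A : nd T (map shift1 G) A -> nd T G (FAll A)
| nd_allE G A t : nd T G (FAll A) -> nd T G (inst1 A t)
| nd_exI G A t : nd T G (inst1 A t) -> nd T G (FEx A)
| nd_exE G A C :
    nd T G (FEx A) -> nd T (A :: map shift1 G) (shift1 C) -> nd T G C
| nd_all2I G A : nd T (map shift2 G) A -> nd T G (FAll2 A)
| nd_all2E G A X : nd T G (FAll2 A) -> nd T G (inst2 A X)
| nd_ex2I G A X : nd T G (inst2 A X) -> nd T G (FEx2 A)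
| nd_ex2E G A C :
    nd T G (FEx2 A) -> nd T (A :: map shift2 G) (shift2 C) -> nd T G C
| nd_refl G t : nd T G (FEq t t)
| nd_leibniz G A t u :
    nd T G (FEq t u) -> nd T G (inst1 A t) -> nd T G (inst1 A u).

Definition proves (T : theory) (A : formula) : Prop := nd T [::] A.

Definition tplus (S T : theory) : theory := fun A => S A \/ T A.

Fixpoint teval (v : nat -> nat) (t : term) : nat :=
  match t with
  | TVar i => v i
  | TZero => 0
  | TOne => 1
  | TAdd t u => teval v t + teval v u
  | TMul t u => teval v t * teval v u
  end.

Definition scons (T : Type) (x : T) (v : nat -> T) (i : nat) : T :=
  if i is j.+1 then v j else x.

(* An omega-model is identified with its collection [M] of sets. *)
Fixpoint sat (M : (nat -> Prop) -> Prop) (v : nat -> nat)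
    (V : nat -> nat -> Prop) (A : formula) : Prop :=
  match A with
  | FEq t u => teval v t = teval v u
  | FLt t u => teval v t < teval v u
  | FIn t X => V X (teval v t)
  | FBot => False
  | FImp A B => sat M v V A -> sat M v V B
  | FAnd A B => sat M v V A /\ sat M v V B
  | FOr A B => sat M v V A \/ sat M v V B
  | FAll A => forall n, sat M (scons n v) V A
  | FEx A => exists n, sat M (scons n v) V A
  | FAll2 A => forall X, M X -> sat M v (scons X V) A
  | FEx2 A => exists2 X, M X & sat M v (scons X V) A
  end.

Definition models (M : (nat -> Prop) -> Prop) (A : formula) : Prop :=
  forall v V, (forall i, M (V i)) -> sat M v V A.

Definition models_theory (M : (nat -> Prop) -> Prop) (T : theory) : Prop :=
  forall A, T A -> models M A.

Definition omega_entails (T : theory) (A : formula) : Prop :=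
  exists Y : nat -> Prop, forall M : (nat -> Prop) -> Prop,
    models_theory M T -> M Y -> models M A.

(* [tm], [sv] and [fm] are terms, set variables and formulas that are still
   to be told under how many number (and set) quantifiers they are placed.
   A bound variable is a de Bruijn level, turned into an index at its
   occurrence. A closed [A : fm] denotes the sentence [A 0 0]. *)

Definition tm := nat -> term.
Definition sv := nat -> nat.
Definition fm := nat -> nat -> formula.

Declare Scope tm_scope.
Declare Scope fm_scope.
Delimit Scope tm_scope with tm.
Delimit Scope fm_scope with fm.

Definition m_zero : tm := fun _ => TZero.
Definition m_one : tm := fun _ => TOne.
Definition m_add (x y : tm) : tm := fun d => TAdd (x d) (y d).
Definition m_mul (x y : tm) : tm := fun d => TMul (x d) (y d).

Definition m_eq (x y : tm) : fm := fun d _ => FEq (x d) (y d).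
Definition m_lt (x y : tm) : fm := fun d _ => FLt (x d) (y d).
Definition m_in (x : tm) (X : sv) : fm := fun d e => FIn (x d) (X e).
Definition m_not (A : fm) : fm := fun d e => FNot (A d e).
Definition m_imp (A B : fm) : fm := fun d e => FImp (A d e) (B d e).
Definition m_and (A B : fm) : fm := fun d e => FAnd (A d e) (B d e).
Definition m_or (A B : fm) : fm := fun d e => FOr (A d e) (B d e).
Definition m_iff (A B : fm) : fm := fun d e => FIff (A d e) (B d e).
Definition m_all (A : tm -> fm) : fm :=
  fun d e => FAll (A (fun d' => TVar (d' - d.+1)) d.+1 e).
Definition m_ex (A : tm -> fm) : fm :=
  fun d e => FEx (A (fun d' => TVar (d' - d.+1)) d.+1 e).
Definition m_all2 (A : sv -> fm) : fm :=
  fun d e => FAll2 (A (fun e' => e' - e.+1) d e.+1).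
Definition m_ex2 (A : sv -> fm) : fm :=
  fun d e => FEx2 (A (fun e' => e' - e.+1) d e.+1).

Arguments m_add (x y)%_tm.
Arguments m_mul (x y)%_tm.
Arguments m_eq (x y)%_tm.
Arguments m_lt (x y)%_tm.
Arguments m_in x%_tm X.
Arguments m_not A%_fm.
Arguments m_imp (A B)%_fm.
Arguments m_and (A B)%_fm.
Arguments m_or (A B)%_fm.
Arguments m_iff (A B)%_fm.
Arguments m_all A%_fm.
Arguments m_ex A%_fm.
Arguments m_all2 A%_fm.
Arguments m_ex2 A%_fm.

Notation "0" := m_zero : tm_scope.
Notation "1" := m_one : tm_scope.
Notation "x + y" := (m_add x y) : tm_scope.
Notation "x * y" := (m_mul x y) : tm_scope.
Notation "x = y" := (m_eq x y) : fm_scope.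
Notation "x < y" := (m_lt x y) : fm_scope.
Notation "x <= y" := (m_or (m_lt x y) (m_eq x y)) : fm_scope.
Notation "x ∈ X" := (m_in x X) (at level 70) : fm_scope.
Notation "~ A" := (m_not A) : fm_scope.
Notation "A -> B" := (m_imp A B) : fm_scope.
Notation "A /\ B" := (m_and A B) : fm_scope.
Notation "A \/ B" := (m_or A B) : fm_scope.
Notation "A <-> B" := (m_iff A B) : fm_scope.
Notation "∀₁ x .. y , A" := (m_all (fun x => .. (m_all (fun y => A%fm)) ..))
  (at level 200, x binder, y binder, right associativity) : fm_scope.
Notation "∃₁ x .. y , A" := (m_ex (fun x => .. (m_ex (fun y => A%fm)) ..))
  (at level 200, x binder, y binder, right associativity) : fm_scope.
Notation "∀₂ X .. Y , A" := (m_all2 (fun X => .. (m_all2 (fun Y => A%fm)) ..))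
  (at level 200, X binder, Y binder, right associativity) : fm_scope.
Notation "∃₂ X .. Y , A" := (m_ex2 (fun X => .. (m_ex2 (fun Y => A%fm)) ..))
  (at level 200, X binder, Y binder, right associativity) : fm_scope.

(* Pairs are coded by [(x + y)^2 + x], which is a term of the language;
   sequences by Goedel's beta function; and a finite set [a] of numbers by
   the number whose binary digits equal to one are those in the positions
   [i \in a]. Finite functions are identified with their graphs. *)

Definition m_pair (x y : tm) : tm := ((x + y) * (x + y) + x)%tm.
Arguments m_pair (x y)%_tm.
Notation "⟨ x , y ⟩" := (m_pair x y) : tm_scope.

(* [x] is the remainder of [c] modulo [d * (i + 1) + 1]. *)
Definition m_beta (c d i x : tm) : fm :=
  (x < d * (i + 1) + 1 /\ ∃₁ q, c = q * (d * (i + 1) + 1) + x)%fm.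
Arguments m_beta (c d i x)%_tm.

Definition m_pow2 (i x : tm) : fm :=
  (∃₁ c d, m_beta c d 0 1
    /\ (∀₁ j, j < i -> ∀₁ y, m_beta c d j y -> m_beta c d (j + 1) (y + y))
    /\ m_beta c d i x)%fm.

Definition m_mem (i a : tm) : fm :=
  (∃₁ p q r, m_pow2 i p /\ a = (q + q + 1) * p + r /\ r < p)%fm.
Arguments m_mem (i a)%_tm.
Notation "i ∊ a" := (m_mem i a) (at level 70) : fm_scope.

Definition basic_axioms : seq fm :=
  [:: ∀₁ n, ~ (n + 1 = 0);
      ∀₁ m n, m + 1 = n + 1 -> m = n;
      ∀₁ m, m + 0 = m;
      ∀₁ m n, m + (n + 1) = (m + n) + 1;
      ∀₁ m, m * 0 = 0;
      ∀₁ m n, m * (n + 1) = m * n + m;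
      ∀₁ m, ~ (m < 0);
      ∀₁ m n, m < n + 1 <-> (m < n \/ m = n)]%fm.

Inductive delta00 : formula -> Prop :=
| delta00_eq t u : delta00 (FEq t u)
| delta00_lt t u : delta00 (FLt t u)
| delta00_in t X : delta00 (FIn t X)
| delta00_bot : delta00 FBot
| delta00_imp A B : delta00 A -> delta00 B -> delta00 (FImp A B)
| delta00_and A B : delta00 A -> delta00 B -> delta00 (FAnd A B)
| delta00_or A B : delta00 A -> delta00 B -> delta00 (FOr A B)
| delta00_all t A :
    delta00 A -> delta00 (FAll (FImp (FLt (TVar 0) (tshift t)) A))
| delta00_ex t A :
    delta00 A -> delta00 (FEx (FAnd (FLt (TVar 0) (tshift t)) A)).

Definition sigma01 (A : formula) : Prop := exists2 B, delta00 B & A = FEx B.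
Definition pi01 (A : formula) : Prop := exists2 B, delta00 B & A = FAll B.

Fixpoint arithmetical (A : formula) : bool :=
  match A with
  | FEq _ _ | FLt _ _ | FIn _ _ | FBot => true
  | FImp A B | FAnd A B | FOr A B => arithmetical A && arithmetical B
  | FAll A | FEx A => arithmetical A
  | FAll2 _ | FEx2 _ => false
  end.

(* In the axioms below the variable with index 0 of [A] and [B] is the
   distinguished one; the other free variables are parameters. *)
Definition induction_axiom (A : formula) : formula :=
  let A_succ :=
    fsubst (fun i => if i is 0 then TAdd (TVar 0) TOne else TVar i) id A in
  FImp (FAnd (inst1 A TZero) (FAll (FImp A A_succ))) (FAll A).

Definition comprehension_axiom (A B : formula) : formula :=
  FImp (FAll (FIff A B)) (FEx2 (FAll (FIff (FIn (TVar 0) 0) (shift2 A)))).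

Inductive RCA0 : theory :=
| RCA0_basic A : List.In A basic_axioms -> RCA0 (A 0 0)
| RCA0_induction A : sigma01 A -> RCA0 (induction_axiom A)
| RCA0_comprehension A B :
    sigma01 A -> pi01 B -> RCA0 (comprehension_axiom A B).

Inductive PA : theory :=
| PA_induction A : arithmetical A -> PA (induction_axiom A).

Definition m_infinite (X : sv) : fm := (∀₁ k, ∃₁ x, k < x /\ x ∈ X)%fm.

(* A binary string is coded by the pair of its length [n] and of the finite
   set [a] of the positions, all below [n], at which it takes the value 1. *)
Definition m_string (n a : tm) : fm := (∀₁ i, i ∊ a -> i < n)%fm.

Definition m_binary_tree (T : sv) : fm :=
  ((∀₁ c, c ∈ T -> ∃₁ n a, c = ⟨n, a⟩ /\ m_string n a)
   /\ (∀₁ n a m b, ⟨n, a⟩ ∈ T -> m <= n -> m_string m b ->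
         (∀₁ i, i < m -> (i ∊ b <-> i ∊ a)) -> ⟨m, b⟩ ∈ T))%fm.

Definition m_path (T X : sv) : fm :=
  (∀₁ n, ∃₁ a, m_string n a /\ (∀₁ i, i < n -> (i ∊ a <-> i ∈ X))
     /\ ⟨n, a⟩ ∈ T)%fm.

Definition weak_konig : formula :=
  (∀₂ T, m_binary_tree T -> m_infinite T -> ∃₂ X, m_path T X)%fm 0 0.

(* A colouring of pairs [x < y] is the set of all [⟨⟨x, y⟩, i⟩] such that
   the pair has colour [i]. *)
Definition m_colouring (C : sv) : fm :=
  (∀₁ x y, x < y -> ∃₁ i, i <= 1 /\ ⟨⟨x, y⟩, i⟩ ∈ C
     /\ ∀₁ j, ⟨⟨x, y⟩, j⟩ ∈ C -> j = i)%fm.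

Definition ramsey22 : formula :=
  (∀₂ C, m_colouring C -> ∃₂ H, m_infinite H
     /\ ∃₁ i, ∀₁ x y, x ∈ H -> y ∈ H -> x < y -> ⟨⟨x, y⟩, i⟩ ∈ C)%fm 0 0.

Definition WKL0 : theory := tplus RCA0 (eq weak_konig).
Definition RT22 : theory := eq ramsey22.

(* Partial recursive functions, written as expressions over an environment of
   arguments: [PLet p q] binds the value of [p] as the new first argument of
   [q], [PRec p b s] is primitive recursion with bound [p], base case [b] and
   step [s] (whose first two arguments are the previous value and the stage),
   and [PMu p] is minimization over the first argument of [p]. *)

Inductive prog : Type :=
| PVar (i : nat)
| PZero
| PSucc (p : prog)
| PLet (p q : prog)
| PRec (p b s : prog)
| PMu (p : prog).

Fixpoint peval (p : prog) (xs : seq nat) (y : nat) : Prop :=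
  match p with
  | PVar i => y = nth 0 xs i
  | PZero => y = 0
  | PSucc p => exists2 z, peval p xs z & y = z.+1
  | PLet p q => exists2 z, peval p xs z & peval q (z :: xs) y
  | PRec p b s =>
      exists n, peval p xs n /\ exists h : nat -> nat,
        [/\ peval b xs (h 0),
            forall k, k < n -> peval s [:: h k, k & xs] (h k.+1)
          & h n = y]
  | PMu p =>
      peval p (y :: xs) 0
      /\ forall k, k < y -> exists z, peval p (k :: xs) z.+1
  end.

Fixpoint m_peval (p : prog) (xs : seq tm) (y : tm) : fm :=
  match p with
  | PVar i => (y = nth m_zero xs i)%fm
  | PZero => (y = 0)%fm
  | PSucc p => (∃₁ z, m_peval p xs z /\ y = z + 1)%fm
  | PLet p q => (∃₁ z, m_peval p xs z /\ m_peval q (z :: xs) y)%fm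
  | PRec p b s =>
      (∃₁ n, m_peval p xs n /\ ∃₁ c d,
         (∃₁ z, m_beta c d 0 z /\ m_peval b xs z)
         /\ (∀₁ k, k < n -> ∃₁ z w, m_beta c d k z /\ m_beta c d (k + 1) w
               /\ m_peval s [:: z, k & xs] w)
         /\ m_beta c d n y)%fm
  | PMu p =>
      (m_peval p (y :: xs) m_zero
       /\ ∀₁ k, k < y -> ∃₁ z, m_peval p (k :: xs) (m_add z m_one))%fm
  end.

Definition computes (p : prog) (D : nat -> Prop) : Prop :=
  forall x, D x /\ peval p [:: x] 1 \/ ~ D x /\ peval p [:: x] 0.

Definition m_computes (p : prog) (D : sv) : fm :=
  (∀₁ x, x ∈ D /\ m_peval p [:: x] m_one
      \/ ~ (x ∈ D) /\ m_peval p [:: x] m_zero)%fm.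

(* The underlying set of a linear order consists of the [x] with
   [le x x]. *)
Record linorder := Linorder {
  le : nat -> nat -> Prop;
  le_dom : forall x y, le x y -> le x x /\ le y y;
  le_anti : forall x y, le x y -> le y x -> x = y;
  le_trans : forall x y z, le x y -> le y z -> le x z;
  le_total : forall x y, le x x -> le y y -> le x y \/ le y x }.

Definition dom (L : linorder) (x : nat) : Prop := le L x x.
Definition lt (L : linorder) (x y : nat) : Prop := le L x y /\ x <> y.

Definition wf_rel (T : Type) (r : T -> T -> Prop) : Prop :=
  ~ exists u : nat -> T, forall n, r (u n.+1) (u n) /\ ~ r (u n) (u n.+1).

Definition well_order (L : linorder) : Prop := wf_rel (le L).

Definition m_linear (r : tm -> tm -> fm) : fm :=
  (∀₁ x y, (r x y -> r x x /\ r y y)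
     /\ (r x y -> r y x -> x = y)
     /\ (∀₁ z, r x y -> r y z -> r x z)
     /\ (r x x -> r y y -> r x y \/ r y x))%fm.

Definition m_function (F : sv) : fm :=
  (∀₁ n, ∃₁ x, ⟨n, x⟩ ∈ F /\ ∀₁ y, ⟨n, y⟩ ∈ F -> y = x)%fm.

Definition m_wf_rel (r : tm -> tm -> fm) : fm :=
  (~ ∃₂ F, m_function F /\ ∀₁ n x y,
     ⟨n, x⟩ ∈ F -> ⟨n + 1, y⟩ ∈ F -> r y x /\ ~ r x y)%fm.

Definition m_le (X : sv) (x y : tm) : fm := (⟨x, y⟩ ∈ X)%fm.
Definition m_lt_ord (X : sv) (x y : tm) : fm := (⟨x, y⟩ ∈ X /\ ~ (x = y))%fm.

Definition m_well_order (X : sv) : fm :=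
  (m_linear (m_le X) /\ m_wf_rel (m_le X))%fm.

Definition increasing m n (f : {ffun 'I_m -> 'I_n}) : bool :=
  [forall i : 'I_m, forall j : 'I_m, (i < j) ==> (f i < f j)].

Record emb (m n : nat) := Emb {
  emb_fun :> {ffun 'I_m -> 'I_n};
  emb_incr : increasing emb_fun }.

Lemma emb_id_incr n : increasing [ffun i : 'I_n => i].
Proof.
by apply/forallP => i; apply/forallP => j; rewrite !ffunE; apply/implyP.
Qed.

Definition emb_id n : emb n n := Emb (emb_id_incr n).

Lemma emb_comp_incr l m n (g : emb m n) (f : emb l m) :
  increasing [ffun i : 'I_l => g (f i)].
Proof.
apply/forallP => i; apply/forallP => j; rewrite !ffunE; apply/implyP => ij.
have /forallP/(_ i)/forallP/(_ j)/implyP/(_ ij) fij := emb_incr f.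
by have /forallP/(_ (f i))/forallP/(_ (f j))/implyP/(_ fij) := emb_incr g.
Qed.

Definition emb_comp l m n (g : emb m n) (f : emb l m) : emb l n :=
  Emb (emb_comp_incr g f).

(* Values of [mor] and [supp] outside of the underlying sets of the orders
   [ob n] are irrelevant. *)
Record predilator := Predilator {
  ob : nat -> linorder;
  mor : forall m n, emb m n -> nat -> nat;
  supp : forall n, nat -> {set 'I_n};
  mor_dom : forall m n (f : emb m n) s,
    dom (ob m) s -> dom (ob n) (mor f s);
  mor_le : forall m n (f : emb m n) s t,
    dom (ob m) s -> dom (ob m) t ->
    (le (ob m) s t <-> le (ob n) (mor f s) (mor f t));
  mor_id : forall n s, dom (ob n) s -> mor (emb_id n) s = s;
  mor_comp : forall l m n (g : emb m n) (f : emb l m) s,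
    dom (ob l) s -> mor (emb_comp g f) s = mor g (mor f s);
  mor_mono : forall m n (f g : emb m n), (forall i, f i <= g i) ->
    forall s, dom (ob m) s -> le (ob n) (mor f s) (mor g s);
  supp_natural : forall m n (f : emb m n) s,
    dom (ob m) s -> supp n (mor f s) = f @: supp m s;
  supp_range : forall m n (f : emb m n) t,
    dom (ob n) t -> supp n t \subset codom f ->
    exists2 s, dom (ob m) s & mor f s = t }.

Definition pair_code (x y : nat) : nat := (x + y) * (x + y) + x.

Definition set_code n (a : {set 'I_n}) : nat := \sum_(i in a) 2 ^ i.
Definition emb_code m n (f : emb m n) : nat :=
  \sum_(i < m) 2 ^ pair_code i (f i).

Inductive code (D : predilator) : nat -> Prop :=
| code_le n s t : le (ob D n) s t ->
    code D (pair_code 0 (pair_code n (pair_code s t)))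
| code_mor m n (f : emb m n) s : dom (ob D m) s ->
    code D (pair_code 1 (pair_code
      (pair_code m (pair_code n (emb_code f))) (pair_code s (mor D f s))))
| code_supp n s : dom (ob D n) s ->
    code D (pair_code 2 (pair_code n (pair_code s (set_code (supp D n s))))).

Section CodedPredilators.

Variable D : sv.

Definition m_dle (n s t : tm) : fm := (⟨0, ⟨n, ⟨s, t⟩⟩⟩ ∈ D)%fm.
Definition m_ddom (n s : tm) : fm := m_dle n s s.
Definition m_dmor (m n f s t : tm) : fm :=
  (⟨1, ⟨⟨m, ⟨n, f⟩⟩, ⟨s, t⟩⟩⟩ ∈ D)%fm.
Definition m_dsupp (n s a : tm) : fm := (⟨1 + 1, ⟨n, ⟨s, a⟩⟩⟩ ∈ D)%fm.

Definition m_emb (m n f : tm) : fm :=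
  ((∀₁ c, c ∊ f -> ∃₁ i j, c = ⟨i, j⟩ /\ i < m /\ j < n)
   /\ (∀₁ i, i < m -> ∃₁ j, ⟨i, j⟩ ∊ f)
   /\ (∀₁ i j k, ⟨i, j⟩ ∊ f -> ⟨i, k⟩ ∊ f -> j = k)
   /\ (∀₁ i i' j j', ⟨i, j⟩ ∊ f -> ⟨i', j'⟩ ∊ f -> i < i' -> j < j'))%fm.

Definition m_predilator : fm :=
  ((∀₁ n, m_linear (m_dle n))
   /\ (∀₁ m n f s t, m_dmor m n f s t ->
         m_emb m n f /\ m_ddom m s /\ m_ddom n t)
   /\ (∀₁ m n f s, m_emb m n f -> m_ddom m s ->
         ∃₁ t, m_dmor m n f s t /\ ∀₁ u, m_dmor m n f s u -> u = t)
   /\ (∀₁ m n f s s' t t', m_dmor m n f s t -> m_dmor m n f s' t' ->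
         (m_dle m s s' <-> m_dle n t t'))
   /\ (∀₁ n f s, m_emb n n f -> (∀₁ i, i < n -> ⟨i, i⟩ ∊ f) ->
         m_ddom n s -> m_dmor n n f s s)
   /\ (∀₁ l m n f g h, m_emb l m f -> m_emb m n g -> m_emb l n h ->
         (∀₁ i j k, ⟨i, j⟩ ∊ f -> ⟨j, k⟩ ∊ g -> ⟨i, k⟩ ∊ h) ->
         ∀₁ s t u, m_dmor l m f s t -> m_dmor m n g t u -> m_dmor l n h s u)
   /\ (∀₁ m n f g, m_emb m n f -> m_emb m n g ->
         (∀₁ i j k, ⟨i, j⟩ ∊ f -> ⟨i, k⟩ ∊ g -> j <= k) ->
         ∀₁ s t u, m_dmor m n f s t -> m_dmor m n g s u -> m_dle n t u)
   /\ (∀₁ n s a, m_dsupp n s a -> m_ddom n s /\ ∀₁ i, i ∊ a -> i < n)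
   /\ (∀₁ n s, m_ddom n s ->
         ∃₁ a, m_dsupp n s a /\ ∀₁ b, m_dsupp n s b -> b = a)
   /\ (∀₁ m n f s t a b, m_dmor m n f s t -> m_dsupp m s a ->
         m_dsupp n t b -> ∀₁ j, j ∊ b <-> ∃₁ i, i ∊ a /\ ⟨i, j⟩ ∊ f)
   /\ (∀₁ m n f t b, m_emb m n f -> m_dsupp n t b ->
         (∀₁ j, j ∊ b -> ∃₁ i, ⟨i, j⟩ ∊ f) -> ∃₁ s, m_dmor m n f s t))%fm.

End CodedPredilators.

Local Open Scope fset_scope.

Section Extension.

Variables (D : predilator) (L : linorder).

Definition enumerates (a : {fset nat}) (e : 'I_#|` a| -> nat) : Prop :=
  (forall i j : 'I_#|` a|, i < j -> lt L (e i) (e j))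
  /\ (forall x, x \in a <-> exists i, x = e i).

(* [f] is the morphism |iota| for the inclusion iota of [a] into [b]. *)
Definition inclusion_morphism (a b : {fset nat}) (f : emb #|` a| #|` b|) :
    Prop :=
  exists ea eb, [/\ enumerates ea, enumerates eb & forall i, eb (f i) = ea i].

Definition bar_dom (x : nat * {fset nat}) : Prop :=
  let: (s, a) := x in
  [/\ forall y, y \in a -> dom L y, dom (ob D #|` a|) s
    & supp D #|` a| s = [set: 'I_#|` a|]%SET].

Definition bar_le (x y : nat * {fset nat}) : Prop :=
  let: (s, a) := x in
  let: (t, b) := y in
  [/\ bar_dom x, bar_dom y
    & exists (f : emb #|` a| #|` a `|` b|) (g : emb #|` b| #|` a `|` b|),
        [/\ inclusion_morphism f, inclusion_morphism g
          & le (ob D #|` a `|` b|) (mor D f s) (mor D g t)]].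

End Extension.

Definition dilator (D : predilator) : Prop :=
  forall L : linorder, well_order L -> wf_rel (bar_le D L).

Section CodedExtension.

Variables D X : sv.

(* [e] is the enumeration of the [k] elements of [a] that is increasing with
   respect to the order [X]. *)
Definition m_enumerates (k e a : tm) : fm :=
  ((∀₁ c, c ∊ e -> ∃₁ i x, c = ⟨i, x⟩ /\ i < k /\ x ∊ a)
   /\ (∀₁ i, i < k -> ∃₁ x, ⟨i, x⟩ ∊ e)
   /\ (∀₁ x, x ∊ a -> ∃₁ i, ⟨i, x⟩ ∊ e)
   /\ (∀₁ i x y, ⟨i, x⟩ ∊ e -> ⟨i, y⟩ ∊ e -> x = y)
   /\ (∀₁ i j x y, ⟨i, x⟩ ∊ e -> ⟨j, y⟩ ∊ e -> i < j -> m_lt_ord X x y))%fm.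

Definition m_inclusion_morphism (a b k l f : tm) : fm :=
  (m_emb k l f /\ ∃₁ ea eb, m_enumerates k ea a /\ m_enumerates l eb b
     /\ ∀₁ i j x, ⟨i, j⟩ ∊ f -> ⟨i, x⟩ ∊ ea -> ⟨j, x⟩ ∊ eb)%fm.

Definition m_bar_dom (s a : tm) : fm :=
  ((∀₁ y, y ∊ a -> m_le X y y)
   /\ ∃₁ k e, m_enumerates k e a /\ m_ddom D k s
        /\ ∃₁ b, m_dsupp D k s b /\ ∀₁ i, i ∊ b <-> i < k)%fm.

Definition m_bar_le (x y : tm) : fm :=
  (∃₁ s a t b, x = ⟨s, a⟩ /\ y = ⟨t, b⟩ /\ m_bar_dom s a /\ m_bar_dom t b
     /\ ∃₁ c, (∀₁ z, z ∊ c <-> z ∊ a \/ z ∊ b)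
     /\ ∃₁ k l n f g u v,
          m_inclusion_morphism a c k n f /\ m_inclusion_morphism b c l n g
          /\ m_dmor D k n f s u /\ m_dmor D l n g t v /\ m_dle D n u v)%fm.

End CodedExtension.

Definition m_dilator (D : sv) : fm :=
  (m_predilator D /\ ∀₂ X, m_well_order X -> m_wf_rel (m_bar_le D X))%fm.

(* The program [p] decides a set, and this set codes a dilator. *)
Definition dilator_sentence (p : prog) : formula :=
  (∃₂ D, m_computes p D /\ m_dilator D)%fm 0 0.

(* Main.v *)
From mathcomp Require Import all_boot boolp zify.
Require Import Defs.

(** Suppose that phi and "D is a dilator" were equivalent over RCA0 + PA.

    Every real lies in an omega-model of WKL0 + RT22 + PA; such a model satisfies
    phi, hence sees that D is a dilator, so D(alpha) is truly well-founded for
    truly well-founded alpha. On the other hand, phi fails in some omega-model M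
    of RCA0 that contains any prescribed real. So M contains a linear order X
    without descending sequences in M and a sequence e_0 > e_1 > ... in D(X). An
    element of D(X) outside of the coordinates in a set P has a coordinate that
    dominates all others outside of P (a small increase of it outweighs all
    changes of the others). Comparing the dominating coordinates of the e_n, and
    using that they settle because X is well-founded in M, one obtains points
    p_0, p_1, ... of X and a subsequence of (e_n) on which e_{t+1} < e_t already
    follows if p_j has a smaller value in e_{t+1} than in e_t, where j <= t + 1
    is arbitrary and p_i has the same value for all i < j.

    Each rho : nat -> nat now yields a linear order X_rho and a descending
    sequence of D(X_rho), both continuous in rho: at stage t + 1 the point p_j
    with j = min (rho (t + 1)) (t + 1) is replaced by a new, smaller copy, and
    so are all points other than p_0, ..., p_{j-1}. If rho does not tend to
    infinity, then the members of a descending sequence in X_rho are eventually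
    copies of a single p_i; if rho tends to infinity, this cannot happen. Call a
    descending sequence good if it does not happen: the existence of a good
    sequence then forces rho to tend to infinity.

    It remains to find rho tending to infinity and an omega-model of WKL0 + RT22
    + PA that contains rho but no good sequence. It satisfies phi but not "D is
    a dilator". Reals are compared by a countable family of open facts that is
    closed under sufficiently many operations. The steps that build the model
    (avoiding a fact, and adding a homogeneous set by the method of
    Cholak-Jockusch-Slaman, on both sides at once) commute with limits of
    sequences along which each fact is eventually constant. Hence, if some
    assignment of defects (a bounded homogeneous set or a good sequence) to the
    nodes of the tree of outcomes is realised along such a sequence, it is
    realised in the limit, where rho must then tend to infinity. A diagonal
    construction thus produces a rho tending to infinity for which no such
    assignment is realised, and Koenig's lemma gives the model. *)

Set Implicit Arguments.
Unset Strict Implicit.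
Unset Printing Implicit Defensive.

(** * Reals and compactness *)

(** Pointwise limits of reals would not do. That a homogeneous set is infinite, or that a sequence
    is good, is a statement of the form: for every [m] something happens beyond [m]. Such statements
    are lost in pointwise limits. Each instance for a fixed [m] is open, however, so it can be made
    a fact, and a limit that respects all facts preserves the whole statement. Which side of a
    Ramsey step yields an infinite set is known only at the end of the step and may differ between a
    sequence and its limit. This is why both sides are kept as branches of a tree and only one
    branch has to converge. A level of the tree is finite, so there are only countably many
    assignments of defects, and a diagonal construction can meet them all. The diagonal construction
    fixes a lower bound [j] for the later values of [rho]. If an assignment could not be avoided
    above [j], deciding all facts while using the value [j] again and again would give a limit that
    must tend to infinity and cannot. Since the model in which [phi] fails may contain any
    prescribed real, it is given a whole table of comparisons in [D]. With it, the model itself can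
    follow the dominating coordinates. *)

Definition real := nat -> bool.

Definition agree (n : nat) (A B : real) := forall i, i < n -> A i = B i.

Definition openp (O : real -> Prop) :=
  forall A, O A -> exists n, forall B, agree n A B -> O B.

Definition inf (S : nat -> Prop) := forall m, exists2 n, m <= n & S n.

(** Limits are taken along infinite index sets instead of all indices, since pigeonhole and
    compactness arguments keep thinning out the sequence. *)
Definition ev (S P : nat -> Prop) := exists m, forall n, m <= n -> S n -> P n.

Lemma agreeW m n A B : m <= n -> agree n A B -> agree m A B.
Proof. by move=> mn h i im; apply: h; lia. Qed.

Lemma agreeC n A B : agree n A B -> agree n B A.
Proof. by move=> h i im; rewrite h. Qed.

Lemma agree_trans n A B C : agree n A B -> agree n B C -> agree n A C.
Proof. by move=> h k i im; rewrite h // k. Qed.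

Lemma ev_imp S (P Q : nat -> Prop) :
  (forall n, S n -> P n -> Q n) -> ev S P -> ev S Q.
Proof. by move=> h [m hm]; exists m => n mn Sn; apply: h => //; apply: hm. Qed.

Lemma ev_and S P Q : ev S P -> ev S Q -> ev S (fun n => P n /\ Q n).
Proof.
move=> [m hm] [k hk]; exists (maxn m k) => n mn Sn; split.
  by apply: hm => //; lia.
by apply: hk => //; lia.
Qed.

Lemma ev_sub (S S' P : nat -> Prop) :
  (forall n, S' n -> S n) -> ev S P -> ev S' P.
Proof. by move=> sub [m hm]; exists m => n mn /sub; apply: hm. Qed.

Lemma inf_ev S P : inf S -> ev S P -> exists n, S n /\ P n.
Proof. by move=> iS [m hm]; have [n mn Sn] := iS m; exists n; split=> //; apply: hm. Qed.

Lemma ev_inf S P : inf S -> ev S P -> inf (fun n => S n /\ P n).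
Proof.
move=> iS [m hm] k; have [n mn Sn] := iS (maxn m k).
by exists n; [lia|split=> //; apply: hm => //; lia].
Qed.

Lemma ev_bounded S (P : nat -> nat -> Prop) b :
  (forall x, x < b -> ev S (P x)) -> ev S (fun n => forall x, x < b -> P x n).
Proof.
elim: b => [|b IH] h; first by exists 0.
have /IH h1 : forall x, x < b -> ev S (P x) by move=> x xb; apply: h; lia.
apply: ev_imp (ev_and h1 (h b (ltnSn _))) => n _ [h2 h3] x xb.
have [->//|xb'] := eqVneq x b; apply: h2; lia.
Qed.

Lemma inf_pigeonhole (T : finType) (f : nat -> T) S :
  inf S -> exists t, inf (fun n => S n /\ f n = t).
Proof.
move=> iS; apply: contrapT => /forallNP h.
have h1 t : exists m, forall n, m <= n -> S n -> f n <> t.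
  apply: contrapT => /forallNP h1; apply: (h t) => m.
  have /existsNP [n /not_implyP [mn /not_implyP [Sn /contrapT e]]] := h1 m.
  by exists n.
have [g hg] := choice h1.
have [n mn Sn] := iS (\max_t g t).
apply: (hg (f n) n) => //; apply: leq_trans mn.
exact: (leq_bigmax (F := g)).
Qed.

Lemma inf_diagonal (S : nat -> nat -> Prop) :
  (forall k, inf (S k)) -> (forall k n, S k.+1 n -> S k n) ->
  exists S', [/\ inf S', forall n, S' n -> S 0 n & forall k, ev S' (S k)].
Proof.
move=> iS dS.
have mono k k' n : k <= k' -> S k' n -> S k n.
  elim: k' => [|k' IH] kk'; first by have -> : k = 0 by lia.
  have [->//|ne] := eqVneq k k'.+1.
  by move/dS; apply: IH; lia.
have /choice [d hd] : forall k, exists n, k <= n /\ S k n.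
  by move=> k; have [n ? ?] := iS k k; exists n.
(* Only the finitely many [d j] with [j < k] can lie outside of [S k]. *)
exists (fun n => exists k, n = d k); split.
- by move=> m; exists (d m); [case: (hd m)|exists m].
- by move=> n [k ->]; apply: (mono 0 k) => //; case: (hd k).
move=> k; exists (\max_(j < k) d j).+1 => n nk [j e].
have [jk|kj] := ltnP j k; last by subst n; apply: (mono k j) => //; case: (hd j).
have h : d j <= \max_(i < k) d i := leq_bigmax (Ordinal jk) (F := fun i : 'I_k => d i).
by rewrite e ltnNge h in nk.
Qed.

Lemma real_compact (An : nat -> real) S : inf S ->
  exists A S', [/\ inf S', forall n, S' n -> S n
                 & forall k, ev S' (fun n => agree k (An n) A)].
Proof.
move=> iS.
pose bit (T : nat -> Prop) k := `[< inf (fun n => T n /\ An n k = true) >].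
pose nx (T : nat -> Prop) k := fun n => T n /\ An n k = bit T k.
pose T := fix T k := if k is k'.+1 then nx (T k') k' else S.
have iT k : inf (T k).
  elim: k => [//|k IH] /=; rewrite /nx /bit; case: asboolP => // h.
  have [[] //] := inf_pigeonhole (fun n => An n k) IH.
have [S' [iS' S'S evS']] := inf_diagonal iT (fun k n => @proj1 _ _).
exists (fun k => bit (T k) k), S'; split=> // k.
apply: ev_bounded => x xk.
by apply: ev_imp (evS' x.+1) => n _ [].
Qed.

(** Otherwise there is for each [b] a real without any good [n <= b]. An accumulation point of these
    reals has some [n] that works on a neighbourhood, and the neighbourhood contains such reals with
    [b >= n]. *)
Lemma fan (Q : nat -> real -> Prop) :
  (forall B, exists n, forall B', agree n B B' -> Q n B') ->
  exists b, forall B, exists2 n, n <= b & Q n B.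
Proof.
move=> h; apply: contrapT => /forallNP h1.
have /choice [Bn hB] : forall b, exists B, forall n, n <= b -> ~ Q n B.
  move=> b; have /existsNP [B hB] := h1 b; exists B => n nb q.
  by apply: hB; exists n.
have iT : inf xpredT by move=> m; exists m.
have [B [S' [iS' _ hS']]] := real_compact Bn iT.
have [n hn] := h B.
have := ev_inf iS' (hS' n) => /(_ n) [b nb [_ ag]].
by apply: (hB b n nb); apply: hn; apply: agreeC.
Qed.

(** * Halves of an oracle and transformations of oracles *)

Definition join (Z P : real) : real := fun n => if odd n then P n./2 else Z n./2.
Definition lh (Z : real) : real := fun n => Z n.*2.
Definition rh (Z : real) : real := fun n => Z n.*2.+1.

Lemma lh_join Z P : lh (join Z P) = Z.
Proof. by apply: funext => n; rewrite /lh /join odd_double doubleK. Qed.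

Lemma rh_join Z P : rh (join Z P) = P.
Proof. by apply: funext => n; rewrite /rh /join /= odd_double /= uphalf_double. Qed.

Lemma join_lr W : join (lh W) (rh W) = W.
Proof.
apply: funext => n; rewrite /join /lh /rh -{4}(odd_double_half n).
by case: (odd n); rewrite ?add0n ?add1n.
Qed.

Lemma agree_join n Z P Z' P' :
  agree n.*2 (join Z P) (join Z' P') <-> agree n Z Z' /\ agree n P P'.
Proof.
split=> [h|[h1 h2] i ni].
  split=> i ni.
    have := h i.*2; rewrite /join odd_double doubleK; apply; lia.
  have := h i.*2.+1; rewrite /join /= odd_double /= uphalf_double; apply; lia.
by rewrite /join; case: ifP => _; [apply: h2|apply: h1]; lia.
Qed.

(** Every oracle of the construction carries the earlier ones as left halves, so a path of left and
    right turns names a set of the final model independently of its contents. *)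
Fixpoint proj (p : seq bool) (Z : real) : real :=
  if p is b :: p' then proj p' (if b then rh Z else lh Z) else Z.

Fixpoint pidx (p : seq bool) (k : nat) : nat :=
  if p is b :: p' then (if b then (pidx p' k).*2.+1 else (pidx p' k).*2) else k.

Lemma projE p Z k : proj p Z k = Z (pidx p k).
Proof. by elim: p Z k => [//|b p IH] Z k /=; rewrite IH; case: b. Qed.

Definition contin (f : real -> real) :=
  forall A n, exists m, forall B, agree m A B -> agree n (f A) (f B).

Lemma openp_comp O f : openp O -> contin f -> openp (fun Z => O (f Z)).
Proof.
move=> oO cf A /oO [n hn]; have [m hm] := cf A n.
by exists m => B /hm; apply: hn.
Qed.

Lemma contin_pointwise f :
  (forall A x, exists m, forall B, agree m A B -> f A x = f B x) -> contin f.
Proof.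
move=> h A; elim=> [|n [m IH]]; first by exists 0.
have [k hk] := h A n; exists (maxn m k) => B ag i.
rewrite ltnS leq_eqVlt => /orP [/eqP ->|ni].
  by apply: hk; apply: agreeW ag; lia.
by apply: IH => //; apply: agreeW ag; lia.
Qed.

(** The oracle of a stage is the join of a real and a reservoir. [TPos] thins the reservoir to
    points whose colours with earlier reservoir points follow a pattern; [TNeg] removes a colouring
    from the outermost right half and keeps one of its classes. The transformations are data so that
    the family of facts can be closed under preimages along them. *)
Inductive trans :=
| TInit
| TPos (p : seq bool) (b : nat) (a : seq bool)
| TNeg (i : bool)
| TDrop (k : nat).

Definition col (p : seq bool) (Z : real) (x y : nat) : bool :=
  proj p Z (pair_code (pair_code x y) 1).

Definition tr (d : trans) (W : real) : real :=
  match d with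
  | TInit => join W xpredT
  | TPos p b a => join (lh W) (fun y => [&& rh W y, b <= y &
      all (fun x => rh W x ==> (col p (lh W) x y == nth false a x)) (iota 0 b)])
  | TNeg i => join (lh (lh W)) (fun y => rh (lh W) y && (rh W y == i))
  | TDrop k => join (iter k lh (lh W)) (rh W)
  end.

Definition pick_side (T : Type) (i : bool) (F : T * T) : T := if i then F.2 else F.1.

(** * Convergence with respect to a family of facts *)

Section Facts.

Variable fam : nat -> real -> Prop.

(** Growth facts are open but not closed; requiring them to become constant is what makes
    unboundedness pass to the limit. *)
Definition conv (S : nat -> Prop) (Zn : nat -> real) (Z : real) : Prop :=
  forall e, ev S (fun n => fam e (Zn n) <-> fam e Z).

Definition hom (c : nat -> nat -> bool) (i : bool) (s : seq nat) : Prop :=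
  forall x y, x \in s -> y \in s -> x < y -> c x y = i.

(** The first [n] bits of both halves of a join occupy its first [n.*2] positions. *)
Definition secured (e n : nat) (Z : real) (s : seq nat) : Prop :=
  forall V, agree n.*2 (join Z (mem s)) V -> fam e V.

(** Here [U] is [join (join Z R) B], where [R] is the reservoir and [B] guesses the limit colours of
    its points. Asked for all [B] at once, this is the disjunctive question of Seetapun and of
    Cholak, Jockusch and Slaman: does every guess admit a finite homogeneous extension on one side
    that forces the fact meant for this side? *)
Definition question (p : seq bool) (F : seq nat * seq nat) (e : nat * nat)
    (U : real) : Prop :=
  let W := lh U in
  exists i s n,
    [/\ forall x, x \in s -> [/\ x < n, rh W x & rh U x = i],
        hom (col p (lh W)) i s
      & secured (pick_side i e) n (lh W) (pick_side i F ++ s)].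

(** The index functions turn what the construction asks about an oracle into facts about this
    oracle, so that its decisions commute with limits. The quantifier over all reals behind [cf] is
    compatible with openness by compactness. *)
Record closed_family (bitf grf : nat -> nat) (cf : seq nat -> nat)
    (subf : trans -> nat -> nat)
    (qf : seq bool -> seq nat * seq nat -> nat * nat -> nat) : Prop :=
  ClosedFamily {
    fam_open : forall e, openp (fam e);
    fam_bit : forall k Z, fam (bitf k) Z <-> Z k;
    fam_growth : forall m Z, fam (grf m) Z <-> exists2 x, m <= x & rh Z x;
    fam_all : forall l Z,
      fam (cf l) Z <-> forall P, exists2 e, e \in l & fam e (join Z P);
    fam_tr : forall d e Z, fam (subf d e) Z <-> fam e (tr d Z);
    fam_question : forall p F e U, fam (qf p F e) U <-> question p F e U }.

Variables (bitf grf : nat -> nat) (cf : seq nat -> nat).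
Variables (subf : trans -> nat -> nat).
Variable (qf : seq bool -> seq nat * seq nat -> nat * nat -> nat).
Hypothesis clf : closed_family bitf grf cf subf qf.

Lemma conv_sub (S S' : nat -> Prop) Zn Z :
  (forall n, S' n -> S n) -> conv S Zn Z -> conv S' Zn Z.
Proof. by move=> sub h e; apply: ev_sub (h e). Qed.

Lemma conv_agree S Zn Z n : conv S Zn Z -> ev S (fun k => agree n (Zn k) Z).
Proof.
move=> h; apply: ev_bounded => x _.
apply: ev_imp (h (bitf x)) => k _; rewrite !(fam_bit clf) => e.
by apply/idP/idP => /e.
Qed.

Lemma conv_tr S Zn Z d : conv S Zn Z -> conv S (fun n => tr d (Zn n)) (tr d Z).
Proof.
move=> h e; apply: ev_imp (h (subf d e)) => n _.
by rewrite !(fam_tr clf).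
Qed.

Definition unbounded (H : real) := forall m, exists2 x, m <= x & H x.

Lemma conv_unbounded S Wn W : inf S -> conv S Wn W ->
  (forall n, S n -> unbounded (rh (Wn n))) -> unbounded (rh W).
Proof.
move=> iS cW h m; apply/(fam_growth clf).
have [n [Sn hn]] := inf_ev iS (cW (grf m)).
by apply/hn/(fam_growth clf); apply: h.
Qed.

(** * A basis theorem *)

(** The fact [e0] comes before all others, so it is avoided whenever this is possible at all. *)
Fixpoint forced (e0 : nat) (Z : real) (e : nat) : seq nat :=
  if e is e'.+1 then
    let l := forced e0 Z e' in if `[< fam (cf (e' :: l)) Z >] then l else e' :: l
  else if `[< fam (cf [:: e0]) Z >] then [::] else [:: e0].

(* The facts are made false one after the other whenever this is possible, so
   that those true of [join Z P] can be read off from the facts about [Z]. *)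
Definition basis_step (e0 : nat) (Z W : real) : Prop :=
  exists2 P, W = join Z P & forall e, fam e W <-> e \notin forced e0 Z e.+1.

Lemma forced_consistent e0 Z e : ~ fam (cf (forced e0 Z e)) Z.
Proof.
elim: e => [|e IH] /=; case: asboolP => //.
by move=> _ /(fam_all clf) /(_ Z) [].
Qed.

Lemma forced_mono e0 Z e e' f : e <= e' -> f \in forced e0 Z e -> f \in forced e0 Z e'.
Proof.
elim: e' => [|e' IH]; first by case: e.
rewrite leq_eqVlt => /orP [/eqP ->//|/IH h /h] /=.
by case: asboolP => // _ h'; rewrite in_cons h' orbT.
Qed.

(** Each finite list of forced facts can be refuted simultaneously; as facts are open, an
    accumulation point of the refuting reals refutes all of them. *)
Lemma basis_step_total e0 Z : exists W, basis_step e0 Z W.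
Proof.
have /choice [Pn hP] : forall n, exists P,
    forall f, f \in forced e0 Z n -> ~ fam f (join Z P).
  move=> n; have h := @forced_consistent e0 Z n.
  apply: contrapT => /forallNP h1; apply: h; apply/(fam_all clf) => P.
  have /existsNP [f /not_implyP [fl /contrapT hf]] := h1 P.
  by exists f.
have iT : inf xpredT by move=> m; exists m.
have [P [S [iS _ hS]]] := real_compact Pn iT.
have Pl n f : f \in forced e0 Z n -> ~ fam f (join Z P).
  move=> fl /(fam_open clf) [k hk].
  have := ev_inf iS (hS k) => /(_ n) [m nm [_ ag]].
  apply: (hP m f); first exact: forced_mono fl.
  apply: hk; apply: (@agreeW _ k.*2); first by lia.
  by apply/agree_join; split=> //; apply: agreeC.
exists (join Z P); exists P => // e; split=> [h|].
  by apply/negP => /Pl.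
rewrite /=; case: asboolP => [/(fam_all clf) h _|_]; last by rewrite mem_head.
have [f] := h P; rewrite in_cons => /orP [/eqP -> //|fl].
by move/(Pl _ _ fl).
Qed.

Lemma basis_step_avoids e0 Z W :
  ~ fam (cf [:: e0]) Z -> basis_step e0 Z W -> ~ fam e0 W.
Proof.
move=> h [P _ hW] /hW /negP; apply; apply: (@forced_mono _ _ 0) => //=.
by case: asboolP => //; rewrite mem_head.
Qed.

(** The list of forced facts up to a given index is computed from finitely many facts about [Z], and
    the facts about the result are read off from this list. *)
Lemma basis_step_conv e0 S Zn Z Wn W : conv S Zn Z ->
  (forall n, S n -> basis_step e0 (Zn n) (Wn n)) -> basis_step e0 Z W ->
  conv S Wn W.
Proof.
move=> cZ hn [P _ hW] e.
have h k : ev S (fun n => forced e0 (Zn n) k = forced e0 Z k).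
  elim: k => [|k IH].
    apply: ev_imp (cZ (cf [:: e0])) => n _ /= h.
    by rewrite (asbool_equiv_eq h).
  have c := cZ (cf (k :: forced e0 Z k)).
  apply: ev_imp (ev_and IH c) => n _ [h1 h2] /=; rewrite h1.
  by rewrite (asbool_equiv_eq h2).
apply: ev_imp (h e.+1) => n Sn en.
by have [Q _ ->] := hn n Sn; rewrite hW en.
Qed.

(** * Homogeneous sets with control of the facts *)

Section Runs.

Variable p : seq bool.

(** The field [decision] records which side was served by the latest step and whether the fact of
    this side was made true or false. *)
Record stage := Stage {
  oracle : real;
  finite_part : seq nat * seq nat;
  decision : bool * bool }.

Section Step.

Variable e : nat * nat.

Definition part_of b (c : b.-tuple bool) := [seq x <- iota 0 b | nth false c x].

(** The finite set [c] and its use [n] are taken from finite types, so that the pigeonhole principle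
    can make them constant along a sequence of runs. The tuple [a] is a guess of the limit colours
    below [b]. *)
Definition witness (W : real) (F : seq nat * seq nat) b
    (a c : b.-tuple bool) (i : bool) (n : 'I_b.+1) : Prop :=
  [/\ forall x, x \in part_of c -> [/\ x < n, rh W x & nth false a x = i],
      hom (col p (lh W)) i (part_of c)
    & secured (pick_side i e) n (lh W) (pick_side i F ++ part_of c)].

Definition bound W F b := forall a : b.-tuple bool, exists c i n, @witness W F b a c i n.

Definition extend (F : seq nat * seq nat) (i : bool) (s : seq nat) :=
  if i then (F.1, F.2 ++ s) else (F.1 ++ s, F.2).

(** If every guess has a forcing extension, then by compactness one [b] serves all guesses, and the
    actual colours of infinitely many reservoir points provide the guess [a]. Otherwise the basis
    step supplies a guess without such an extension, and the reservoir is confined to one of its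
    classes. Taking [b] least ties it to finitely many bits of the oracle, as limits require. *)
Inductive step (st st' : stage) : Prop :=
| step_pos b (a c : b.-tuple bool) i n :
    fam (cf [:: qf p (finite_part st) e]) (oracle st) ->
    bound (oracle st) (finite_part st) b ->
    (forall b', b' < b -> ~ bound (oracle st) (finite_part st) b') ->
    witness (oracle st) (finite_part st) a c i n ->
    unbounded (rh (tr (TPos p b a) (oracle st))) ->
    st' = Stage (tr (TPos p b a) (oracle st))
            (extend (finite_part st) i (part_of c)) (i, true) ->
    step st st'
| step_neg V i :
    ~ fam (cf [:: qf p (finite_part st) e]) (oracle st) ->
    basis_step (qf p (finite_part st) e) (oracle st) V ->
    unbounded (rh (tr (TNeg i) V)) ->
    st' = Stage (tr (TNeg i) V) (finite_part st) (i, false) ->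
    step st st'.

Lemma mem_part_of b (c : b.-tuple bool) x :
  (x \in part_of c) = nth false c x.
Proof.
rewrite mem_filter mem_iota leq0n add0n /=; case: (ltnP x b) => h; first by rewrite andbT.
by rewrite andbF nth_default // size_tuple.
Qed.

Lemma witness_local b : exists m, forall W W', agree m W W' ->
  forall F a c i n, @witness W F b a c i n -> @witness W' F b a c i n.
Proof.
pose q x y := (pidx p (pair_code (pair_code x y) 1)).*2.
exists (maxn b.*2 (\max_(x < b) \max_(y < b) q x y).+1).
move=> W W' ag F a c i n [h1 h2 h3].
have ag1 : agree b (lh W) (lh W') /\ agree b (rh W) (rh W').
  by apply/agree_join; rewrite !join_lr; apply: agreeW ag; lia.
have lt_b x : x \in part_of c -> x < b by rewrite mem_filter mem_iota => /andP [_] /andP [].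
have cE x y : x < b -> y < b -> col p (lh W) x y = col p (lh W') x y.
  move=> xb yb; rewrite /col !projE /lh -/(q x y); apply: ag.
  have h := leq_bigmax (F := fun y : 'I_b => q x y) (Ordinal yb).
  have h' := leq_bigmax (F := fun x : 'I_b => \max_(y < b) q x y) (Ordinal xb).
  by rewrite leq_max ltnS (leq_trans h h') orbT.
split.
- move=> x xs; have [xn Wx ax] := h1 x xs; split=> //.
  by rewrite -(proj2 ag1) // lt_b.
- by move=> x y xs ys xy; rewrite -cE ?lt_b //; apply: h2.
move=> V agV; apply: h3; apply: agree_trans agV.
by apply/agree_join; split=> //; apply: agreeW (proj1 ag1); have := ltn_ord n; lia.
Qed.

Lemma bound_exists W F : fam (cf [:: qf p F e]) W -> exists b, bound W F b.
Proof.
move/(fam_all clf) => h.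
pose Q n B := exists i s,
    [/\ forall x, x \in s -> [/\ x < n, rh W x & B x = i],
        hom (col p (lh W)) i s
      & secured (pick_side i e) n (lh W) (pick_side i F ++ s)].
have [b hb] : exists b, forall B, exists2 n, n <= b & Q n B.
  apply: fan => B; have [f] := h B; rewrite inE => /eqP ->.
  move=> /(fam_question clf); rewrite /question lh_join rh_join.
  move=> [i [s [n [h1 h2 h3]]]]; exists n => B' ag; exists i, s; split=> // x xs.
  by have [? ? ?] := h1 x xs; split=> //; rewrite -ag.
exists b => a; have [n nb [i [s [h1 h2 h3]]]] := hb (fun x => nth false a x).
pose c := [tuple of mkseq (mem s) b].
have cE x : (x \in part_of c) = (x \in s).
  rewrite mem_part_of; case: (ltnP x b) => xb; first by rewrite nth_mkseq.
  rewrite nth_default ?size_mkseq //; apply/esym/negP => /h1 [xn _ _].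
  by have := leq_trans xn nb; lia.
exists c, i, (Ordinal (nb : n < b.+1)); split.
- by move=> x; rewrite cE => /h1.
- by move=> x y; rewrite !cE; apply: h2.
move=> V; have -> : (mem (pick_side i F ++ part_of c) : real) = mem (pick_side i F ++ s).
  by apply: funext => x; rewrite /= !mem_cat cE.
exact: h3.
Qed.

Lemma step_total st : unbounded (rh (oracle st)) ->
  exists2 st', step st st' & unbounded (rh (oracle st')).
Proof.
case: st => W F d /= uW.
have [h|h] := pselect (fam (cf [:: qf p F e]) W).
  have exb := bound_exists h.
  have exb' : exists b, `[< bound W F b >] by case: exb => b ?; exists b; apply/asboolP.
  case: (ex_minnP exb') => b /asboolP bb minb.
  have [a ua] : exists a : b.-tuple bool, unbounded (rh (tr (TPos p b a) W)).
    have iI : inf (fun y => rh W y) by move=> m; have [x ? ?] := uW m; exists x.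
    have [a ha] := inf_pigeonhole
      (fun y => [tuple of mkseq (fun x => col p (lh W) x y) b]) iI.
    exists a => m; have [y my [Wy ay]] := ha (maxn m b).
    exists y; first by lia.
    rewrite /= rh_join Wy /=; apply/andP; split; first by lia.
    apply/allP => x; rewrite mem_iota /= add0n => xb; apply/implyP => _.
    by rewrite -ay /= nth_mkseq.
  have [c [i [n w]]] := bb a.
  exists (Stage (tr (TPos p b a) W) (extend F i (part_of c)) (i, true)) => //.
  have nb b' : b' < b -> ~ bound W F b' by move=> b'b /asboolP /minb; lia.
  exact: (@step_pos (Stage W F d) _ b a c i n).
have [V hV] := basis_step_total (qf p F e) W.
have VW : lh V = W by case: hV => P -> _; rewrite lh_join.
have iI : inf (fun y => rh W y) by move=> m; have [x ? ?] := uW m; exists x.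
have [i hi] := inf_pigeonhole (rh V) iI.
have u : unbounded (rh (tr (TNeg i) V)).
  move=> m; have [y my [Wy Vy]] := hi m; exists y => //.
  by rewrite /= rh_join VW Wy Vy eqxx.
by exists (Stage (tr (TNeg i) V) F (i, false)) => //; exact: (@step_neg (Stage W F d) _ V i).
Qed.

(** In the positive case the least bound of the limit is eventually that of the sequence, and the
    remaining choices are finite in number. In the negative case only the side is a free choice. The
    new reservoir stays infinite because growth is a fact. *)
Lemma step_limit S st (stn stn' : nat -> stage) : inf S ->
  (forall n, S n -> finite_part (stn n) = finite_part st) ->
  conv S (fun n => oracle (stn n)) (oracle st) ->
  (forall n, S n -> step (stn n) (stn' n)) ->
  exists st' S', [/\ inf S', forall n, S' n -> S n, step st st',
    forall n, S' n -> finite_part (stn' n) = finite_part st'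
                      /\ decision (stn' n) = decision st'
    & conv S' (fun n => oracle (stn' n)) (oracle st')].
Proof.
case: st => W F d /= iS FE cW hstep.
have cq := cW (cf [:: qf p F e]).
have [h|h] := pselect (fam (cf [:: qf p F e]) W).
  have exb := bound_exists h.
  have exb' : exists b, `[< bound W F b >] by case: exb => b ?; exists b; apply/asboolP.
  case: (ex_minnP exb') => b /asboolP bb minb.
  have nb b' : b' < b -> ~ bound W F b' by move=> b'b /asboolP /minb; lia.
  have same : ev S (fun n => forall b', b' < b.+1 -> forall F a c i k,
      @witness (oracle (stn n)) F b' a c i k <-> @witness W F b' a c i k).
    apply: ev_bounded => b' _; have [m hm] := witness_local b'.
    apply: ev_imp (conv_agree m cW) => n Sn ag F' a c i k.
    by split; apply: hm => //; apply: agreeC.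
  have iS1 := ev_inf iS (ev_and cq same).
  set S1 := fun n => _ in iS1.
  pose data := (b.-tuple bool * b.-tuple bool * bool * 'I_b.+1)%type.
  have /choice [f hf] : forall n, exists u : data, S1 n -> exists2 W',
      W' = tr (TPos p b u.1.1.1) (oracle (stn n)) &
      [/\ witness (oracle (stn n)) F u.1.1.1 u.1.1.2 u.1.2 u.2, unbounded (rh W')
        & stn' n = Stage W' (extend F u.1.2 (part_of u.1.1.2)) (u.1.2, true)].
    move=> n; have [Sn|nS] := pselect (S1 n); last first.
      by exists ([tuple of nseq b true], [tuple of nseq b true], true, ord0).
    have [Sn0 [cqn samen]] := Sn.
    have eqb b' : b' < b.+1 -> bound (oracle (stn n)) F b' <-> bound W F b'.
      move=> b'b; split=> h' a; have [c [i [k w]]] := h' a; exists c, i, k.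
        by apply/(samen _ b'b).
      by apply/(samen _ b'b).
    case: (hstep n Sn0); rewrite (FE n Sn0).
      move=> b' a c i k _ bb' nb' w u ->.
      have ebb : b' = b.
        have [lt|gt|//] := ltngtP b' b.
          by case: (nb b' lt); apply/eqb => //; lia.
        by case: (nb' b gt); apply/eqb.
      by subst b'; exists (a, c, i, k) => _; exists (tr (TPos p b a) (oracle (stn n))).
    by move=> V i nq; case: nq; apply/cqn.
  have [[[[a c] i] k] iS2] := inf_pigeonhole f iS1.
  set S2 := fun n => _ in iS2.
  have S2S n : S2 n -> S n by case=> -[].
  have cW' : conv S2 (fun n => tr (TPos p b a) (oracle (stn n))) (tr (TPos p b a) W).
    by apply: conv_tr; apply: conv_sub cW.
  have hn n : S2 n -> [/\ witness (oracle (stn n)) F a c i k,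
      unbounded (rh (tr (TPos p b a) (oracle (stn n)))) &
      stn' n = Stage (tr (TPos p b a) (oracle (stn n))) (extend F i (part_of c)) (i, true)].
    by case=> S1n fn; have [W' -> ] := hf n S1n; rewrite fn.
  exists (Stage (tr (TPos p b a) W) (extend F i (part_of c)) (i, true)), S2; split=> //.
  - have [n S2n] : exists n, S2 n by case: (iS2 0) => n _; exists n.
    apply: (@step_pos (Stage W F d) _ b a c i k) => //=; last first.
      by apply: conv_unbounded iS2 cW' _ => m /hn [].
    by have [[Sn [_ samen]] _] := S2n; apply/(samen b) => //; case: (hn n S2n).
  - by move=> n /hn [_ _ ->].
  move=> e'; apply: ev_imp (cW' e') => n /hn [_ _ -> //].
have iS1 := ev_inf iS cq.
set S1 := fun n => _ in iS1.
have /choice [f hf] : forall n, exists u : real * bool, S1 n ->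
    [/\ basis_step (qf p F e) (oracle (stn n)) u.1, unbounded (rh (tr (TNeg u.2) u.1))
      & stn' n = Stage (tr (TNeg u.2) u.1) F (u.2, false)].
  move=> n; have [Sn|nS] := pselect (S1 n); last by exists (xpredT, true).
  have [Sn0 cqn] := Sn.
  case: (hstep n Sn0); rewrite (FE n Sn0).
    by move=> b' a c i k q; case: h; apply/cqn.
  by move=> V i _ bV u ->; exists (V, i).
have [i iS2] := inf_pigeonhole (fun n => (f n).2) iS1.
set S2 := fun n => _ in iS2.
have S2S n : S2 n -> S n by case=> -[].
have [V hV] := basis_step_total (qf p F e) W.
have cV : conv S2 (fun n => (f n).1) V.
  apply: basis_step_conv (conv_sub S2S cW) _ hV.
  by move=> n [S1n _]; case: (hf n S1n).
have cW' := conv_tr (TNeg i) cV.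
have hn n : S2 n -> unbounded (rh (tr (TNeg i) (f n).1)) /\
    stn' n = Stage (tr (TNeg i) (f n).1) F (i, false).
  by case=> S1n <-; case: (hf n S1n).
exists (Stage (tr (TNeg i) V) F (i, false)), S2; split=> //.
- apply: (@step_neg (Stage W F d) _ V i) => //=.
  by apply: conv_unbounded iS2 cW' _ => n /hn [].
- by move=> n /hn [_ ->].
by move=> e'; apply: ev_imp (cW' e') => n /hn [_ ->].
Qed.

End Step.

Definition pair_of (s : nat) : nat * nat := odflt (0, 0) (@unpickle (nat * nat)%type s).

Lemma pair_of_pickle (e : nat * nat) : pair_of (pickle e) = e.
Proof. by rewrite /pair_of pickleK. Qed.

Definition run (Z : real) (r : nat -> stage) : Prop :=
  r 0 = Stage (tr TInit Z) ([::], [::]) (true, true)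
  /\ forall s, step (pair_of s) (r s) (r s.+1).

Lemma init_unbounded Z : unbounded (rh (tr TInit Z)).
Proof. by move=> m; exists m; rewrite //= rh_join. Qed.

Lemma run_total Z : exists r, run Z r.
Proof.
have /choice [f hf] : forall u : nat * stage, exists st', unbounded (rh (oracle u.2)) ->
    step (pair_of u.1) u.2 st' /\ unbounded (rh (oracle st')).
  case=> s st /=; have [u|nu] := pselect (unbounded (rh (oracle st))); last by exists st.
  by have [st' ? ?] := step_total (pair_of s) u; exists st'.
pose r := fix r s := if s is s'.+1 then f (s', r s')
  else Stage (tr TInit Z) ([::], [::]) (true, true).
have u s : unbounded (rh (oracle (r s))).
  by elim: s => [|s IH] /=; [exact: init_unbounded|case: (hf (s, r s) IH)].
by exists r; split=> // s; case: (hf (s, r s) (u s)).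
Qed.

Definition side_set (r : nat -> stage) (i : bool) : real :=
  fun x => `[< exists s, x \in pick_side i (finite_part (r s)) >].

Lemma pick_extend F i j s : pick_side j (extend F i s) =
  if i == j then pick_side j F ++ s else pick_side j F.
Proof. by case: i; case: j. Qed.

Definition invariant (Z : real) (st : stage) := lh (oracle st) = Z /\
  forall i, hom (col p Z) i (pick_side i (finite_part st)) /\
    forall x y, x \in pick_side i (finite_part st) -> rh (oracle st) y ->
      x < y /\ col p Z x y = i.

Lemma step_invariant e Z st st' : invariant Z st -> step e st st' ->
  [/\ invariant Z st', forall x, rh (oracle st') x -> rh (oracle st) x,
      forall i x, x \in pick_side i (finite_part st) -> x \in pick_side i (finite_part st')
    & forall i x, x \in pick_side i (finite_part st') ->
        x \in pick_side i (finite_part st) \/ rh (oracle st) x].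
Proof.
case: st => W F d [] /= lhZ inv [].
  move=> b a c i n /= _ _ _ [w1 w2 _] _ ->; rewrite lhZ in w2 *; split=> /=.
  - split=> [|j] /=; first by rewrite lh_join.
    have [h1 h2] := inv j; rewrite pick_extend.
    have h3 x y : x \in pick_side j F ->
        [&& rh W y, b <= y & all (fun x => rh W x ==> (col p Z x y == nth false a x)) (iota 0 b)] ->
        x < y /\ col p Z x y = j.
      by move=> xF /andP [Wy _]; apply: h2.
    rewrite rh_join; case: eqP => [ij|//].
    subst j; split=> [x y|x y].
      rewrite !mem_cat => /orP [xF|xs] /orP [yF|ys] xy.
      + exact: h1.
      + by have [_ Wy _] := w1 y ys; case: (h2 x y xF Wy).
      + by have [_ Wx _] := w1 x xs; have [] := h2 y x yF Wx; lia.
      + exact: w2.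
    rewrite mem_cat => /orP [xF|xs]; first exact: h3.
    move=> /and3P [Wy yb /allP al].
    have [xn Wx ax] := w1 x xs; have nb := ltn_ord n; split; first by lia.
    have := al x; rewrite mem_iota add0n Wx ax /= => /(_ _)/eqP; apply; lia.
  - by move=> x; rewrite rh_join => /andP [].
  - by move=> j x; rewrite pick_extend; case: ifP => // _; rewrite mem_cat => ->.
  move=> j x; rewrite pick_extend; case: ifP => _; last by left.
  rewrite mem_cat => /orP [|xs]; first by left.
  by right; case: (w1 x xs).
move=> V i /= _ [P -> _] _ ->; rewrite /= !lh_join !rh_join; split=> //=.
- split=> [|j]; first by rewrite /= lh_join.
  rewrite /= rh_join; have [h1 h2] := inv j; split=> // x y xF /andP [Wy _].
  exact: h2.
- by move=> x /andP [].
by move=> j x; left.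
Qed.

Section OneRun.

Variables (Z : real) (r : nat -> stage).
Hypothesis rr : run Z r.

Lemma run_invariant s : invariant Z (r s).
Proof.
elim: s => [|s IH]; last by case: (step_invariant IH (proj2 rr s)).
rewrite (proj1 rr) /invariant /= lh_join; split=> //.
by move=> i; split=> x y; case: i.
Qed.

Lemma run_part_mono i x s s' : s <= s' ->
  x \in pick_side i (finite_part (r s)) -> x \in pick_side i (finite_part (r s')).
Proof.
elim: s' => [|s' IH]; first by case: s.
rewrite leq_eqVlt => /orP [/eqP <- //|/IH h /h].
by have [_ _ h3 _] := step_invariant (run_invariant s') (proj2 rr s'); apply: h3.
Qed.

Lemma run_reservoir_mono x s s' : s <= s' ->
  rh (oracle (r s')) x -> rh (oracle (r s)) x.
Proof.
elim: s' => [|s' IH]; first by case: s.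
rewrite leq_eqVlt => /orP [/eqP <- //|/IH h].
by have [_ h2 _ _] := step_invariant (run_invariant s') (proj2 rr s'); move/h2.
Qed.

Lemma run_part_new i x s s' : s <= s' -> x \in pick_side i (finite_part (r s')) ->
  x \in pick_side i (finite_part (r s)) \/ rh (oracle (r s)) x.
Proof.
elim: s' => [|s' IH]; first by case: s => // _; left.
rewrite leq_eqVlt => /orP [/eqP <- //|ss']; first by left.
have [_ _ _ h4] := step_invariant (run_invariant s') (proj2 rr s').
move/h4 => [h|h]; first exact: IH.
by right; apply: run_reservoir_mono h.
Qed.

Lemma side_set_part i x s : x \in pick_side i (finite_part (r s)) -> side_set r i x.
Proof. by move=> h; apply/asboolP; exists s. Qed.

Lemma side_set_new i x s : side_set r i x ->
  x \in pick_side i (finite_part (r s)) \/ rh (oracle (r s)) x.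
Proof.
move/asboolP => [s' h]; have [ss'|s's] := leqP s s'; first exact: run_part_new h.
by left; apply: run_part_mono h; lia.
Qed.

Lemma side_set_hom i x y : side_set r i x -> side_set r i y -> x < y -> col p Z x y = i.
Proof.
move=> /asboolP [s1 h1] /asboolP [s2 h2] xy.
have [_ /(_ i) [h _]] := run_invariant (maxn s1 s2).
by apply: h => //; [apply: run_part_mono h1|apply: run_part_mono h2]; lia.
Qed.

(** Points that enter after this stage come from a reservoir that starts at [b], and the use [n] is
    at most [b]. *)
Lemma decision_true s i : decision (r s.+1) = (i, true) ->
  fam (pick_side i (pair_of s)) (join Z (side_set r i)).
Proof.
have [lhZ _] := run_invariant s.
case: (proj2 rr s) => [b a c i' n _ _ _ [w1 _ w3] _|V i' _ _ _] rS; rewrite rS //= => -[<-].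
apply: w3; apply/agree_join; split; first by rewrite lhZ.
move=> x xn; apply/idP/asboolP => /= [xs|].
  by exists s.+1; rewrite rS /= pick_extend eqxx.
move=> hx; have /(side_set_new s.+1) : side_set r i' x by apply/asboolP.
rewrite rS /= pick_extend eqxx => -[//|].
by rewrite rh_join => /and3P [_ bx _]; have := ltn_ord n; lia.
Qed.

(** If the fact held, the finitely many new points in its use would all lie in class [i] of the
    guess, and would answer positively the very question that the guess was chosen to refute. *)
Lemma decision_false s i : decision (r s.+1) = (i, false) ->
  ~ fam (pick_side i (pair_of s)) (join Z (side_set r i)).
Proof.
have [lhZ inv] := run_invariant s.
case: (proj2 rr s) => [b a c i' n _ _ _ _ _|V i' nq bV _] rS; rewrite rS //= => -[ii'].
subst i'; move=> /(fam_open clf) [n hn].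
apply: (basis_step_avoids nq bV); apply/(fam_question clf); case: bV => B VE _.
rewrite /question VE lh_join rh_join lhZ.
pose F := pick_side i (finite_part (r s)).
exists i, [seq x <- iota 0 n | side_set r i x & x \notin F], n.
have hs x : x \in [seq x <- iota 0 n | side_set r i x & x \notin F] ->
    [/\ side_set r i x, x \notin F & x < n].
  by rewrite mem_filter mem_iota add0n => /andP [/andP []].
split.
- move=> x /hs [Hx xF xn]; split=> //.
    by case: (side_set_new s Hx) xF => // ->.
  case: (side_set_new s.+1 Hx); rewrite rS /=; first by move=> h; rewrite /F h in xF.
  by rewrite rh_join VE rh_join => /andP [_ /eqP].
- move=> x y /hs [Hx _ _] /hs [Hy _ _]; exact: side_set_hom.
move=> U agU; apply: hn; apply: (@agreeW _ n.*2); first by lia.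
apply: agree_trans agU; apply/agree_join; split=> // x xn.
rewrite /= mem_cat mem_filter mem_iota add0n xn leq0n /= andbT -/F.
case: (boolP (x \in F)) => [xF|]; last by rewrite andbT.
exact: (side_set_part xF).
Qed.

(** A single reservoir point beyond [m] is a homogeneous extension that forces growth, so the
    negative answer is excluded. *)
Lemma growth_decision s i m : pick_side i (pair_of s) = grf m ->
  (decision (r s.+1)).1 = i -> decision (r s.+1) = (i, true).
Proof.
move=> em; case ds : (decision (r s.+1)) => [j [|]] /= ji; subst j => //.
have [lhZ _] := run_invariant s.
move: ds; case: (proj2 rr s) => [b a c i' n _ _ _ _ _|V i' nq bV uW] rS; rewrite rS //=.
move=> [ii']; subst i'; exfalso.
apply: (basis_step_avoids nq bV); apply/(fam_question clf); case: bV => B VE _.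
have [x mx] := uW m; rewrite /= VE !lh_join !rh_join => /andP [Wx /eqP Bx].
rewrite /question lh_join rh_join; exists i, [:: x], x.+1; split.
- by move=> y; rewrite inE => /eqP ->.
- by move=> y z; rewrite !inE => /eqP -> /eqP ->; lia.
move=> U agU; rewrite em; apply/(fam_growth clf); exists x => //.
rewrite /rh -agU; last by lia.
by rewrite /join /= odd_double /= uphalf_double mem_cat mem_head orbT.
Qed.

(** If the side [false] misses some [e0], then each stage for a pair [(e0, e1)] serves the side
    [true], and [e1] is arbitrary. *)
Lemma run_winner : exists i, unbounded (side_set r i) /\
  forall e, exists s, pick_side i (pair_of s) = e /\ (decision (r s.+1)).1 = i.
Proof.
have [i hi] : exists i, forall e, exists s,
    pick_side i (pair_of s) = e /\ (decision (r s.+1)).1 = i.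
  have [h|/existsNP [e0 h0]] := pselect (forall e, exists s,
    pick_side false (pair_of s) = e /\ (decision (r s.+1)).1 = false); first by exists false.
  exists true => e1; exists (pickle (e0, e1)); rewrite pair_of_pickle; split=> //.
  have := h0; move/forallNP => /(_ (pickle (e0, e1))); rewrite pair_of_pickle /=.
  by case: (decision _).1 => // h; case: h.
exists i; split=> // m; have [s [es ds]] := hi (grf m).
have := decision_true (growth_decision es ds); rewrite es.
by move/(fam_growth clf); rewrite rh_join.
Qed.

End OneRun.

(** Each fact about the winning side of the limit run is decided at a single stage, and along [S']
    the decision at this stage is eventually the same in the runs [rn n]. Nothing is claimed about
    the other side. *)
Lemma run_limit S Zn Z rn : inf S -> conv S Zn Z ->
  (forall n, S n -> run (Zn n) (rn n)) ->
  exists r S' i, [/\ run Z r, inf S', forall n, S' n -> S n, unbounded (side_set r i)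
    & conv S' (fun n => join (Zn n) (side_set (rn n) i)) (join Z (side_set r i))].
Proof.
move=> iS cZ hr.
pose good (s : nat) (u : stage * (nat -> Prop)) := [/\ inf u.2, forall n, u.2 n -> S n,
  forall n, u.2 n -> finite_part (rn n s) = finite_part u.1
                     /\ decision (rn n s) = decision u.1
  & conv u.2 (fun n => oracle (rn n s)) (oracle u.1)].
have /choice [f hf] : forall u : nat * (stage * (nat -> Prop)), exists u', good u.1 u.2 ->
    [/\ good u.1.+1 u', step (pair_of u.1) u.2.1 u'.1 & forall n, u'.2 n -> u.2.2 n].
  case=> s [st T] /=; have [g|ng] := pselect (good s (st, T)); last by exists (st, T).
  have [iT TS FE cT] := g.
  have hst n : T n -> step (pair_of s) (rn n s) (rn n s.+1).
    by move=> /TS /hr [_]; apply.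
  have [st' [T' [iT' T'T st1 FE' cT']]] :=
    step_limit iT (fun n Tn => proj1 (FE n Tn)) cT hst.
  by exists (st', T'); split=> //; split=> // n /T'T /TS.
pose u0 := (Stage (tr TInit Z) ([::], [::]) (true, true), S).
pose u := fix u s := if s is s'.+1 then f (s', u s') else u0.
have gu s : good s (u s).
  elim: s => [|s IH] /=; last by case: (hf (s, u s) IH).
  split=> //=.
    by move=> n /hr [-> _].
  by move=> e; apply: ev_imp (conv_tr TInit cZ e) => n /hr [-> _].
have [S' [iS' S'S evS']] := inf_diagonal
  (fun s => let: And4 h _ _ _ := gu s in h)
  (fun s => let: And3 _ _ h := hf (s, u s) (gu s) in h).
pose r s := (u s).1.
have rr : run Z r by split=> // s; case: (hf (s, u s) (gu s)).
have [i [ui hi]] := run_winner rr.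
exists r, S', i; split=> // e.
have [s [es ds]] := hi e.
apply: ev_imp (evS' s.+1) => n S'n un.
have [_ _ /(_ n un) [_ dn] _] := gu s.+1.
have rn' := hr n (S'S n S'n).
case dE : (decision (r s.+1)) => [j v]; rewrite dE /= in ds; subst j.
have dE' : decision (rn n s.+1) = (i, v) by rewrite dn.
case: v dE dE' => dE dE'; rewrite -es.
  by split=> _; [apply: (decision_true rr)|apply: (decision_true rn')].
by split=> h; [case: (decision_false rn' dE')|case: (decision_false rr dE)].
Qed.

End Runs.

End Facts.

(** * A countable family of open facts with the closure properties *)

Lemma openp_const (P : Prop) : openp (fun=> P).
Proof. by move=> A p; exists 0. Qed.

Lemma openp_and O O' : openp O -> openp O' -> openp (fun Z => O Z /\ O' Z).
Proof.
move=> h h' A [/h [m hm] /h' [n hn]]; exists (maxn m n) => B ag.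
by split; [apply: hm|apply: hn]; apply: agreeW ag; lia.
Qed.

Lemma openp_ex (T : Type) (O : T -> real -> Prop) :
  (forall x, openp (O x)) -> openp (fun Z => exists x, O x Z).
Proof. by move=> h A [x /h [n hn]]; exists n => B /hn; exists x. Qed.

Lemma openp_in (T : eqType) (s : seq T) (O : T -> real -> Prop) :
  (forall x, openp (O x)) -> openp (fun Z => forall x, x \in s -> O x Z).
Proof.
move=> h; elim: s => [|x s IH] A hA; first by exists 0.
have [m hm] := h x A (hA x (mem_head _ _)).
have [n hn] : exists n, forall B, agree n A B -> forall y, y \in s -> O y B.
  by apply: IH => y ys; apply: hA; rewrite in_cons ys orbT.
exists (maxn m n) => B ag y; rewrite in_cons => /orP [/eqP ->|ys].
  by apply: hm; apply: agreeW ag; lia.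
by apply: hn ys; apply: agreeW ag; lia.
Qed.

Lemma openp_bit k b : openp (fun Z => Z k = b).
Proof. by move=> A h; exists k.+1 => B ag; rewrite -ag. Qed.

Lemma openp_equiv (O O' : real -> Prop) :
  (forall Z, O Z <-> O' Z) -> openp O -> openp O'.
Proof. by move=> h o A /h /o [n hn]; exists n => B /hn /h. Qed.

Lemma contin_bits (f : real -> real) (g : nat -> nat) :
  (forall Z n, f Z n = Z (g n)) -> contin f.
Proof.
by move=> h; apply: contin_pointwise => A x; exists (g x).+1 => B ag; rewrite !h ag.
Qed.

Lemma contin_comp f g : contin f -> contin g -> contin (fun Z => f (g Z)).
Proof.
move=> hf hg A n; have [m hm] := hf (g A) n; have [k hk] := hg A m.
by exists k => B /hk /hm.
Qed.

Lemma contin_join f g : contin f -> contin g -> contin (fun Z => join (f Z) (g Z)).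
Proof.
move=> hf hg A n; have [m hm] := hf A n; have [k hk] := hg A n.
exists (maxn m k) => B ag; apply: (@agreeW _ n.*2); first by lia.
by apply/agree_join; split; [apply: hm|apply: hk]; apply: agreeW ag; lia.
Qed.

Lemma contin_lh : contin lh.
Proof. exact: (@contin_bits _ (fun n => n.*2)). Qed.

Lemma contin_rh : contin rh.
Proof. exact: (@contin_bits _ (fun n => n.*2.+1)). Qed.

Lemma contin_tr d : contin (tr d).
Proof.
case: d => [|p b a|i|k] /=.
- by apply: contin_join => A n; [exists n|exists 0].
- apply: contin_join; first exact: contin_lh.
  apply: contin_pointwise => A y.
  pose q x := (pidx p (pair_code (pair_code x y) 1)).*2.
  exists (maxn y b + \max_(x < b) q x).+1.*2 => B ag.
  have hr x : x < (maxn y b).+1 -> rh A x = rh B x by move=> h; apply: ag; lia.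
  congr [&& _, _ & _]; first by apply: hr; lia.
  apply: eq_in_all => x; rewrite mem_iota add0n => /andP [_ xb].
  rewrite (hr x); last by lia.
  suff -> : col p (lh A) x y = col p (lh B) x y by [].
  rewrite /col !projE; apply: ag; rewrite -/(q x).
  have : q x <= \max_(x < b) q x := leq_bigmax (Ordinal xb) (F := fun x : 'I_b => q x).
  lia.
- apply: contin_join; first exact: contin_comp contin_lh contin_lh.
  apply: contin_pointwise => A y.
  exists y.*2.+2.*2 => B ag; rewrite /lh /rh !ag //; lia.
apply: contin_join contin_rh; apply: contin_comp contin_lh.
elim: k => [|k IH] /=; first by move=> A n; exists n.
exact: contin_comp contin_lh IH.
Qed.

Section Family.

Variable base : nat -> real -> Prop.
Hypothesis base_open : forall n, openp (base n).

(** Versions for arbitrary predicates are needed since the indices of facts exist only after the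
    interpretation of names is defined. *)
Definition gsecured (O : real -> Prop) (n : nat) (Z : real) (s : seq nat) : Prop :=
  forall V, agree n.*2 (join Z (mem s)) V -> O V.

Definition gquestion (p : seq bool) (F : seq nat * seq nat) (O : (real -> Prop) * (real -> Prop))
    (U : real) : Prop :=
  let W := lh U in
  exists i s n,
    [/\ forall x, x \in s -> [/\ x < n, rh W x & rh U x = i],
        hom (col p (lh W)) i s
      & gsecured (pick_side i O) n (lh W) (pick_side i F ++ s)].

Lemma gquestion_open p F O : openp (gquestion p F O).
Proof.
apply: openp_ex => i; apply: openp_ex => s; apply: openp_ex => n.
apply: (@openp_equiv (fun U => (forall x, x \in s -> (U (x.*2.+1).*2 = true /\ U x.*2.+1 = i) /\ x < n)
  /\ ((forall x, x \in s -> forall y, y \in s -> 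
         (U ((pidx p (pair_code (pair_code x y) 1)).*2.*2) = i \/ ~ x < y))
  /\ gsecured (pick_side i O) n (lh (lh U)) (pick_side i F ++ s)))).
  move=> U; split=> [[h1 [h2 h3]]|[h1 h2 h3]].
    split=> // [x /h1 [[? ?] ?] //|x y xs ys xy].
    by have [|//] := h2 x xs y ys; rewrite /col projE.
  split=> [x /h1 [? ? ?]|]; first by [].
  split=> // x xs y ys; have [xy|xy] := ltnP x y; last by right; apply/negP; lia.
  by left; have := h2 x y xs ys xy; rewrite /col projE.
apply: openp_and.
  apply: openp_in => x; apply: openp_and; last exact: openp_const.
  by apply: openp_and; apply: openp_bit.
apply: openp_and.
  apply: openp_in => x; apply: openp_in => y A [h|h]; last by exists 0; right.
  by have [n' hn'] := openp_bit h; exists n' => B /hn'; left.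
move=> A h; exists n.*2.*2 => B ag V agV; apply: h; apply: agree_trans agV.
apply/agree_join; split=> // x xn; apply: ag; lia.
Qed.

Definition gall (l : seq (real -> Prop)) (Z : real) : Prop :=
  forall P, exists2 k, k < size l & nth (fun=> False) l k (join Z P).

(** By compactness, finitely many uses suffice for all [P], hence so does their maximum. *)
Lemma gall_open l : (forall k, k < size l -> openp (nth (fun=> False) l k)) -> openp (gall l).
Proof.
move=> ol A h.
pose Q n P := exists2 k, k < size l &
  forall V, agree n.*2 (join A P) V -> nth (fun=> False) l k V.
have [b hb] : exists b, forall B, exists2 n, n <= b & Q n B.
  apply: fan => B; have [k kl] := h B; have ok := ol k kl; move/ok => [n hn].
  exists n => B' ag; exists k => // V agV; apply: hn.
  apply: (@agreeW _ n.*2); first by lia.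
  by apply: agree_trans agV; apply/agree_join.
exists b => B ag P; have [n nb [k kl hk]] := hb P; exists k => //.
by apply: hk; apply/agree_join; split=> //; apply: agreeW ag.
Qed.

Definition leaf := (nat + (nat + nat))%type.
Definition trans_code := (unit + (seq bool * nat * seq bool) + (bool + nat))%type.
Definition label := (unit + (trans_code + (seq bool * (seq nat * seq nat))))%type.

Variables (name : GenTree.tree leaf -> nat) (syntax : nat -> GenTree.tree leaf).
Hypothesis nameK : cancel name syntax.
Variables (tag : label -> nat) (untag : nat -> option label).
Hypothesis tagK : pcancel tag untag.

Definition trans_of (c : trans_code) : trans :=
  match c with
  | inl (inl _) => TInit
  | inl (inr (p, b, a)) => TPos p b a
  | inr (inl i) => TNeg i
  | inr (inr k) => TDrop k
  end.

Definition code_of (d : trans) : trans_code :=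
  match d with
  | TInit => inl (inl tt)
  | TPos p b a => inl (inr (p, b, a))
  | TNeg i => inr (inl i)
  | TDrop k => inr (inr k)
  end.

Lemma code_ofK : cancel code_of trans_of. Proof. by case. Qed.

Definition interp_leaf (x : leaf) : real -> Prop :=
  match x with
  | inl n => base n
  | inr (inl k) => fun Z => Z k
  | inr (inr m) => fun Z => exists2 x, m <= x & rh Z x
  end.

Definition interp_node (k : nat) (l : seq (real -> Prop)) : real -> Prop :=
  let n := nth (fun=> False) l in
  match untag k with
  | None => fun=> False
  | Some (inl _) => gall l
  | Some (inr (inl c)) => fun Z => n 0 (tr (trans_of c) Z)
  | Some (inr (inr (p, F))) => gquestion p F (n 0, n 1)
  end.

(** Facts are named by finite trees over the basic facts: closing under an operation means adding a
    node, and countability is inherited from the trees. *)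
Fixpoint interp (t : GenTree.tree leaf) : real -> Prop :=
  match t with
  | GenTree.Leaf x => interp_leaf x
  | GenTree.Node k l => interp_node k (map interp l)
  end.

Lemma interp_open t : openp (interp t).
Proof.
elim: t => [[n|[k|m]]|k l IH] /=.
- exact: base_open.
- exact: openp_bit.
- move=> A [x mx Ax]; exists x.*2.+2 => B ag; exists x => //.
  by rewrite /rh -ag //; lia.
have {}IH i : openp (nth (fun=> False) (map interp l) i).
  elim: l i IH => [|t l IHl] i /=; first by rewrite nth_nil => _; exact: openp_const.
  by case: i => [|i] [h1 h2] //=; apply: IHl.
rewrite /interp_node; case: untag => [[_|[c|[p F]]]|].
- by apply: gall_open.
- by apply: openp_comp; [apply: IH|apply: contin_tr].
- exact: gquestion_open.
exact: openp_const.
Qed.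

Definition family e := interp (syntax e).
Definition node (l : label) (s : seq nat) :=
  name (GenTree.Node (tag l) (map syntax s)).

Definition interp_label (l : option label) (s : seq (real -> Prop)) : real -> Prop :=
  let n := nth (fun=> False) s in
  match l with
  | None => fun=> False
  | Some (inl _) => gall s
  | Some (inr (inl c)) => fun Z => n 0 (tr (trans_of c) Z)
  | Some (inr (inr (p, F))) => gquestion p F (n 0, n 1)
  end.

Lemma interp_nodeE k l :
  interp (GenTree.Node k l) = interp_label (untag k) (map interp l).
Proof. by []. Qed.

Lemma family_node l s : family (node l s) = interp_label (Some l) (map family s).
Proof.
by rewrite {1}/family nameK interp_nodeE tagK -map_comp.
Qed.

Lemma family_leaf x : family (name (GenTree.Leaf x)) = interp_leaf x.
Proof. by rewrite /family nameK. Qed.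

Lemma family_closed : closed_family family
  (fun k => name (GenTree.Leaf (inr (inl k)))) (fun m => name (GenTree.Leaf (inr (inr m))))
  (node (inl tt)) (fun d e => node (inr (inl (code_of d))) [:: e])
  (fun p F e => node (inr (inr (p, F))) [:: e.1; e.2]).
Proof.
split.
- by move=> e; apply: interp_open.
- by move=> k Z; rewrite family_leaf.
- by move=> m Z; rewrite family_leaf.
- move=> l Z; rewrite family_node; split=> h P; have [x] := h P.
    rewrite size_map => xl; rewrite (nth_map 0) // => hx; exists (nth 0 l x) => //.
    exact: mem_nth.
  move=> xl hx; exists (index x l); first by rewrite size_map index_mem.
  by rewrite (nth_map 0) ?index_mem // nth_index.
- by move=> d e Z; rewrite family_node /interp_label code_ofK.
move=> p F e U; rewrite family_node.
by split=> -[i [s [n [h1 h2 h3]]]]; exists i, s, n; split=> //; move: h3; case: (i).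
Qed.

Lemma family_base n : exists e, family e = base n.
Proof. by exists (name (GenTree.Leaf (inl n))); rewrite family_leaf. Qed.

End Family.

Lemma closed_family_exists (base : nat -> real -> Prop) :
  (forall n, openp (base n)) ->
  exists fam bitf grf cf subf qf, closed_family fam bitf grf cf subf qf
    /\ forall n, exists e, fam e = base n.
Proof.
move=> base_open.
pose syntax e := odflt (GenTree.Leaf (inl 0)) (@choice.unpickle (GenTree.tree leaf) e).
have sK : cancel (@choice.pickle (GenTree.tree leaf)) syntax.
  by move=> t; rewrite /syntax choice.pickleK.
have tK := @choice.pickleK label.
by do 6 eexists; split; [exact: (family_closed base_open sK tK)|exact: (family_base _ sK)].
Qed.

(** * Outcomes of a sequence of tasks *)

Definition task := (nat * (nat + seq bool))%type.

Definition task_of (k : nat) : task :=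
  odflt (0, inl 0) (omap fst (@choice.unpickle (task * nat)%type k)).

Lemma task_often (t : task) k0 : exists2 k, k0 <= k & task_of k = t.
Proof.
(* The dummy component makes every task occur infinitely often. *)
pose f (i : nat) := choice.pickle (t, i).
have inj : injective f by move=> i j /(pcan_inj choice.pickleK) [].
have [i ki] : exists i, k0 <= f i.
  apply: contrapT => /forallNP h.
  have lt i : f i < k0 by rewrite ltnNge; apply/negP.
  pose g (i : 'I_k0.+1) : 'I_k0 := Ordinal (lt i).
  have /leq_card : injective g by move=> i j /(congr1 val) /inj /val_inj.
  by rewrite !card_ord ltnn.
by exists (f i) => //; rewrite /task_of /f choice.pickleK.
Qed.

Section Outcomes.

Variable fam : nat -> real -> Prop.
Variables (bitf grf : nat -> nat) (cf : seq nat -> nat).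
Variables (subf : trans -> nat -> nat).
Variable (qf : seq bool -> seq nat * seq nat -> nat * nat -> nat).
Hypothesis clf : closed_family fam bitf grf cf subf qf.

(* A task formulated for the oracle at level [k0] is carried out at a level
   [k >= k0]. *)
Definition operation (k : nat) : nat + seq bool :=
  let: (k0, t) := task_of k in
  match t with
  | inl e => inl (if k0 <= k then subf (TDrop (k - k0)) e else e)
  | inr p => inr (nseq (k - k0) false ++ p)
  end.

(** The single outcome of a basis step is given to both children; a Ramsey step gives one child to
    each side, as it is open which side wins. *)
Definition outcomes (k : nat) (Z Zf Zt : real) : Prop :=
  match operation k with
  | inl e => basis_step fam cf e Z Zf /\ Zt = Zf
  | inr p => exists r, [/\ run fam cf qf p Z r, Zf = join Z (side_set r false)
                         & Zt = join Z (side_set r true)]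
  end.

Definition alive_at (k : nat) (Z : real) : Prop :=
  if operation k is inr _ then unbounded (rh Z) else True.

Lemma outcomes_total k Z : exists Zf Zt, outcomes k Z Zf Zt.
Proof.
rewrite /outcomes; case: operation => [e|p].
  by have [W hW] := basis_step_total clf e Z; exists W, W.
have [r hr] := run_total clf p Z.
by exists (join Z (side_set r false)), (join Z (side_set r true)), r.
Qed.

Lemma outcomes_lh k Z Zf Zt : outcomes k Z Zf Zt -> lh Zf = Z /\ lh Zt = Z.
Proof.
rewrite /outcomes; case: operation => [e [[P -> _] ->]|p [r [_ -> ->]]].
  by rewrite lh_join.
by rewrite !lh_join.
Qed.

Lemma outcomes_limit k S Zn Z Zfn Ztn : inf S -> conv fam S Zn Z ->
  (forall n, S n -> outcomes k (Zn n) (Zfn n) (Ztn n)) ->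
  exists (i : bool) L S', [/\ inf S', forall n, S' n -> S n, lh L = Z, alive_at k L
    & conv fam S' (fun n => if i then Ztn n else Zfn n) L].
Proof.
rewrite /outcomes /alive_at => iS cZ; case: operation => [e|p] h.
  have [W hW] := basis_step_total clf e Z.
  exists false, W, S; split=> //; first by case: hW => P -> _; rewrite lh_join.
  by apply: basis_step_conv cZ _ hW => // n /h [].
have /choice [rn hr] : forall n, exists r, S n -> [/\ run fam cf qf p (Zn n) r,
    Zfn n = join (Zn n) (side_set r false) & Ztn n = join (Zn n) (side_set r true)].
  move=> n; have [/h [r ?]|nS] := pselect (S n); first by exists r.
  by exists (fun=> Stage xpredT ([::], [::]) (true, true)).
have hr' n : S n -> run fam cf qf p (Zn n) (rn n) by case/hr.
have [r [S' [i [rr iS' S'S ui cL]]]] := run_limit clf iS cZ hr'.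
exists i, (join Z (side_set r i)), S'; rewrite lh_join rh_join; split=> // e.
apply: ev_imp (cL e) => n /S'S /hr [_ -> ->].
by case: (i).
Qed.

Variable start : (nat -> nat) -> real.
Hypothesis start_cont : forall rho m, exists n, forall rho',
  (forall i, i < n -> rho i = rho' i) -> agree m (start rho) (start rho').

Definition outcome_tree (rho : nat -> nat) (Zs : seq bool -> real) : Prop :=
  Zs [::] = start rho /\
  forall v, outcomes (size v) (Zs v) (Zs (false :: v)) (Zs (true :: v)).

Lemma outcome_tree_total rho : exists Zs, outcome_tree rho Zs.
Proof.
have /choice [f hf] : forall u : nat * real, exists w, outcomes u.1 u.2 w.1 w.2.
  by move=> u; have [a [b ?]] := outcomes_total u.1 u.2; exists (a, b).
pose Zs := fix Zs v := if v is i :: v' then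
    let w := f (size v', Zs v') in if i then w.2 else w.1 else start rho.
by exists Zs; split=> // v; apply: (hf (size v, Zs v)).
Qed.

Lemma outcome_tree_lh rho Zs i v : outcome_tree rho Zs -> lh (Zs (i :: v)) = Zs v.
Proof. by case=> _ /(_ v) /outcomes_lh []; case: i. Qed.

Fixpoint alive (Zs : seq bool -> real) (v : seq bool) : Prop :=
  if v is i :: v' then alive_at (size v') (Zs v) /\ alive Zs v' else True.

Lemma alive_drop Zs v j : alive Zs v -> alive Zs (drop j v).
Proof. by elim: v j => [|i v IH] [|j] //= [_ /IH]. Qed.

Lemma alive_ext L L' v : (forall w, size w <= size v -> L' w = L w) -> alive L v -> alive L' v.
Proof.
elim: v => [|i v IH] //= h [a al]; split; first by rewrite h.
by apply: IH => // w wv; apply: h; lia.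
Qed.

(** Only one branch is followed: at each level it takes a side that wins in the limit. Nodes list
    the latest choice first, so the ancestors of [v] are the lists [drop j v]. *)
Lemma outcome_tree_limit S rhon rho Zn k : inf S ->
  conv fam S (fun n => start (rhon n)) (start rho) ->
  (forall n, S n -> outcome_tree (rhon n) (Zn n)) ->
  exists v L S', [/\ size v = k, inf S', forall n, S' n -> S n, alive L v
    & forall j, j <= k -> conv fam S' (fun n => Zn n (drop j v)) (L (drop j v))].
Proof.
move=> iS cst hn; elim: k => [|k [v [L [S' [sv iS' S'S al cL]]]]].
  exists [::], (fun=> start rho), S; split=> // j _ e.
  by apply: ev_imp (cst e) => n /hn [-> _].
have c0 : conv fam S' (fun n => Zn n v) (L v) by have := cL 0 (leq0n k); rewrite drop0.
have out n : S' n -> outcomes k (Zn n v) (Zn n (false :: v)) (Zn n (true :: v)).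
  by move=> /S'S /hn [_ /(_ v)]; rewrite sv.
have [i [M [S2 [iS2 S2S lM aM cM]]]] := outcomes_limit iS' c0 out.
pose L' w := if w == i :: v then M else L w.
have L'E w : size w <= k -> L' w = L w by rewrite /L'; case: eqP => // -> /=; rewrite sv ltnn.
exists (i :: v), L', S2; split=> //=.
- by rewrite sv.
- by move=> n /S2S /S'S.
- by split; [rewrite /L' eqxx sv|apply: alive_ext al => w; rewrite sv; apply: L'E].
move=> [_|j]; last first.
  rewrite ltnS /= => jk; rewrite L'E; first by apply: conv_sub S2S _; apply: cL.
  by rewrite size_drop sv leq_subr.
rewrite /= /L' eqxx => e; apply: ev_imp (cM e) => n _.
by case: (i).
Qed.

(** * Generic sequences of levels *)

Definition tends_to_infinity (rho : nat -> nat) : Prop :=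
  forall i, exists s, forall t, s <= t -> i <= rho t.

(** Pairs [(u, j)] act as forcing conditions: a finite initial part together with a lower bound for
    all later values. *)
Definition cone (u : seq nat) (j : nat) (rho : nat -> nat) : Prop :=
  (forall i, i < size u -> rho i = nth 0 u i) /\ (forall i, size u <= i -> j <= rho i).

Definition ext (j : nat) (u u' : seq nat) : Prop :=
  exists2 w, u' = u ++ w & all (leq j) w.

Lemma ext_refl j u : ext j u u.
Proof. by exists [::]; rewrite ?cats0. Qed.

Lemma ext_trans j u v w : ext j u v -> ext j v w -> ext j u w.
Proof.
by move=> [x -> hx] [y -> hy]; exists (x ++ y); rewrite ?catA // all_cat hx hy.
Qed.

Lemma cone_ext j u u' rho : ext j u u' -> cone u' j rho -> cone u j rho.
Proof.
move=> [w -> /all_nthP hw] [h1 h2]; split=> i iu.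
  by rewrite h1 ?nth_cat ?iu // size_cat; lia.
have [iw|iw] := ltnP i (size (u ++ w)); last exact: h2.
rewrite h1 // nth_cat ltnNge iu /=; apply: hw; rewrite size_cat in iw; lia.
Qed.

Lemma cone_limit (u : nat -> seq nat) (j : nat -> nat) :
  (forall n, ext (j n) (u n) (u n.+1)) -> (forall n, size (u n) < size (u n.+1)) ->
  (forall n, j n <= j n.+1) -> exists rho, forall n, cone (u n) (j n) rho.
Proof.
move=> he hs hj.
have szn n : n <= size (u n) by elim: n => [|n IH] //; apply: leq_ltn_trans (hs n).
have jm m n : m <= n -> j m <= j n.
  elim: n => [|n IH]; first by case: m.
  by rewrite leq_eqVlt => /orP [/eqP ->|/IH h] //; apply: leq_trans h (hj n).
have em m n : m <= n -> ext (j m) (u m) (u n).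
  elim: n => [|n IH]; first by case: m => // _; apply: ext_refl.
  rewrite leq_eqVlt => /orP [/eqP ->|mn]; first exact: ext_refl.
  apply: ext_trans (IH mn) _; have [w -> hw] := he n; exists w => //.
  by apply: sub_all hw => x; apply: leq_trans; apply: jm.
have en m n i : i < size (u m) -> i < size (u n) -> nth 0 (u m) i = nth 0 (u n) i.
  wlog mn : m n / m <= n.
    by move=> h; have [mn|nm] := leqP m n; [apply: h|move=> *; apply/esym/h => //; lia].
  by move=> im _; have [w -> _] := em m n mn; rewrite nth_cat im.
exists (fun i => nth 0 (u i.+1) i) => n; split=> i hi; first by apply: en.
have [w uE /all_nthP hw] := em n (maxn n i.+1) (leq_maxl _ _).
have iM : i < size (u (maxn n i.+1)) by apply: leq_trans (szn _); lia.
rewrite (en _ _ i (szn _) iM) uE nth_cat ltnNge hi /=; apply: hw.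
by rewrite uE size_cat in iM; lia.
Qed.

Section Generic.

Variable B : (nat -> nat) -> Prop.
Hypothesis B_limit : forall S rhon rho, inf S ->
  conv fam S (fun n => start (rhon n)) (start rho) ->
  (forall n, S n -> B (rhon n)) -> tends_to_infinity rho.

(** The value [j] is appended before the fact is decided. Repeating this with [j] fixed yields a
    function with infinitely many values [j]. *)
Lemma decide_fact n u j : exists u', [/\ ext j u u', size u < size u', nth 0 u' (size u) = j
  & (forall rho, cone u' j rho -> fam n (start rho)) \/
    (forall rho, cone u' j rho -> ~ fam n (start rho))].
Proof.
have uv : ext j u (rcons u j) by exists [:: j]; rewrite -?cats1 //= leqnn.
have [[rho [crho hf]]|h] := pselect (exists rho, cone (rcons u j) j rho /\ fam n (start rho)).
  have [m hm] := fam_open clf hf; have [k hk] := start_cont rho m.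
  pose N := maxn k (size u).+1; exists (mkseq rho N).
  have [c1 c2] := crho; have sN : size u < N by rewrite /N; lia.
  have eN : mkseq rho N = rcons u j ++
      drop (size u).+1 (mkseq rho N).
    rewrite -{1}(cat_take_drop (size u).+1 (mkseq rho N)); congr (_ ++ _).
    have st : size (take (size u).+1 (mkseq rho N)) = (size u).+1.
      by rewrite size_take size_mkseq; case: ltnP; lia.
    apply: (@eq_from_nth _ 0); rewrite st ?size_rcons // => i iu.
    by rewrite nth_take // nth_mkseq; [apply: c1; rewrite size_rcons|lia].
  split.
  - apply: ext_trans uv _; exists (drop (size u).+1 (mkseq rho N)) => //.
    apply/(all_nthP 0) => i; rewrite size_drop size_mkseq => iN.
    rewrite nth_drop nth_mkseq; last by lia.
    by apply: c2; rewrite size_rcons; lia.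
  - by rewrite size_mkseq.
  - by rewrite nth_mkseq // c1 ?size_rcons // nth_rcons ltnn eqxx.
  left=> rho' [c1' _]; apply: hm; apply: hk => i ik.
  by rewrite c1' ?size_mkseq ?nth_mkseq //; rewrite /N; lia.
exists (rcons u j); split=> //; first by rewrite size_rcons.
  by rewrite nth_rcons ltnn eqxx.
by right=> rho c hf; apply: h; exists rho.
Qed.

(** Suppose that [B] meets the cone of every proper extension. Deciding all facts one after the
    other produces [rho] and members of [B] converging to it, so [rho] tends to infinity by
    [B_limit]; but it takes the value [j] infinitely often. *)
Lemma avoid u j : exists u', [/\ ext j u u', size u < size u'
  & forall rho, cone u' j rho -> ~ B rho].
Proof.
apply: contrapT => /forallNP h.
have hB u' : ext j u u' -> size u < size u' -> exists rho, cone u' j rho /\ B rho.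
  move=> e s; apply: contrapT => /forallNP h1; apply: (h u'); split=> // rho c b.
  by apply: (h1 rho).
have /choice [f hf] : forall x : nat * seq nat, exists u', [/\ ext j x.2 u', size x.2 < size u',
    nth 0 u' (size x.2) = j & (forall rho, cone u' j rho -> fam x.1 (start rho)) \/
    (forall rho, cone u' j rho -> ~ fam x.1 (start rho))].
  by move=> x; apply: decide_fact.
pose U := fix U n := if n is n'.+1 then f (n', U n') else u.
have hU n := hf (n, U n).
have hs n : size (U n) < size (U n.+1) by case: (hU n).
have he n : ext j (U n) (U n.+1) by case: (hU n).
have [rho hrho] := cone_limit he hs (fun n => leqnn j).
have em m n : m <= n -> ext j (U m) (U n).
  elim: n => [|n IH]; first by case: m => // _; apply: ext_refl.
  rewrite leq_eqVlt => /orP [/eqP ->|mn]; first exact: ext_refl.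
  exact: ext_trans (IH mn) (he n).
have szU n : size u < size (U n.+1).
  elim: n => [|n IH]; first exact: (hs 0).
  exact: ltn_trans IH (hs n.+1).
have /choice [rhon hn] : forall n, exists rho', cone (U n.+1) j rho' /\ B rho'.
  by move=> n; apply: hB; [apply: (em 0)|apply: szU].
have iT : inf xpredT by move=> m; exists m.
have cv : conv fam xpredT (fun n => start (rhon n)) (start rho).
  move=> e; exists e => n en _.
  have c : cone (U e.+1) j (rhon n) by apply: cone_ext _ (proj1 (hn n)); apply: em; lia.
  have [_ _ _ [d|d]] := hU e; first by split=> _; apply: d => //; apply: (hrho e.+1).
  by split=> hf'; exfalso; [apply: (d _ c)|apply: (d _ (hrho e.+1))].
have tot := B_limit iT cv (fun n _ => proj2 (hn n)).
have [s hs'] := tot j.+1.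
have szn n : n <= size (U n) by elim: n => [|n IH] //; apply: leq_ltn_trans (hs n).
have := hs' (size (U s)) (szn s).
by rewrite (proj1 (hrho s.+1)) ?hs //; case: (hU s) => _ _ -> _; rewrite ltnn.
Qed.

End Generic.

(** The [i]-th set is avoided above the lower bound [i]; raising the bounds makes [rho] tend to
    infinity. *)
Lemma generic_exists (B : nat -> (nat -> nat) -> Prop) :
  (forall i S rhon rho, inf S -> conv fam S (fun n => start (rhon n)) (start rho) ->
    (forall n, S n -> B i (rhon n)) -> tends_to_infinity rho) ->
  exists rho, tends_to_infinity rho /\ forall i, ~ B i rho.
Proof.
move=> hB.
have /choice [f hf] : forall x : nat * seq nat, exists u', [/\ ext x.1 x.2 u',
    size x.2 < size u' & forall rho, cone u' x.1 rho -> ~ B x.1 rho].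
  by move=> x; apply: avoid; apply: hB.
pose U := fix U n := if n is n'.+1 then f (n', U n') else [::].
have hU n := hf (n, U n).
have [rho hrho] : exists rho, forall n, cone (U n) n rho.
  apply: (@cone_limit U id); last by move=> n /=.
    by move=> n; case: (hU n).
  by move=> n; case: (hU n).
exists rho; split=> [i|i]; first by exists (size (U i)); case: (hrho i).
have [_ _ hc] := hU i; apply: hc; split; first by case: (hrho i.+1).
by move=> t ht; have [_ /(_ t ht)] := hrho i.+1; rewrite /=; lia.
Qed.

(** * A tree of outcomes without good sets *)

Variable good : (nat -> nat) -> real -> Prop.
Hypothesis good_limit : forall S rhon rho Zn Z p, inf S ->
  conv fam S (fun n => start (rhon n)) (start rho) -> conv fam S Zn Z ->
  (forall n, S n -> good (rhon n) (proj p (Zn n))) -> good rho (proj p Z).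
Hypothesis good_tends : forall rho A, good rho A -> tends_to_infinity rho.

Definition defect := (nat * nat + seq bool)%type.

(** The bound [n] of a homogeneous set and the column [p] of a good sequence are part of the defect,
    so they stay the same along a sequence that realises one assignment. *)
Definition defective (rho : nat -> nat) (Zs : seq bool -> real) (v : seq bool)
    (x : defect) : Prop :=
  match x with
  | inl (j, n) => [/\ j < size v,
      (if operation (size (drop j v)).-1 is inr _ then true else false)
      & forall x, n <= x -> ~ rh (Zs (drop j v)) x]
  | inr p => good rho (proj p (Zs v))
  end.

Definition assignment (k : nat) := {ffun k.-tuple bool -> defect}.

Definition all_defective (i : {k & assignment k}) (rho : nat -> nat) : Prop :=
  exists2 Zs, outcome_tree rho Zs &
    forall v : (tag i).-tuple bool, defective rho Zs v (tagged i v).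

(** Some branch converges to a branch on which all homogeneous sets are infinite, and its defect
    does not change along the sequence. A bounded set would contradict a growth fact of the limit.
    Hence the defect is a good column, and goodness passes to the limit. *)
Lemma all_defective_limit i S rhon rho : inf S ->
  conv fam S (fun n => start (rhon n)) (start rho) ->
  (forall n, S n -> all_defective i (rhon n)) -> tends_to_infinity rho.
Proof.
case: i => k a iS cst hn.
have /choice [Zn hZ] : forall n, exists Zs, S n -> outcome_tree (rhon n) Zs /\
    forall v : k.-tuple bool, defective (rhon n) Zs v (a v).
  move=> n; have [/hn [Zs ? ?]|nS] := pselect (S n); first by exists Zs.
  by exists (fun=> xpredT).
have [v [L [S' [sv iS' S'S al cL]]]] :=
  outcome_tree_limit k iS cst (fun n Sn => proj1 (hZ n Sn)).
have sv' : size v == k by apply/eqP.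
pose v' := Tuple sv'.
have hd n : S' n -> defective (rhon n) (Zn n) v (a v').
  by move=> /S'S /hZ [_ /(_ v')].
case: (a v') hd => [[j m]|p] /= hd; last first.
  apply: good_tends; apply: (@good_limit S' rhon rho (fun n => Zn n v) (L v) p) => //.
    exact: conv_sub S'S cst.
  by have := cL 0 (leq0n k); rewrite drop0.
have [n S'n] : exists n, S' n by case: (iS' 0) => n _; exists n.
have [jv op _] := hd n S'n; rewrite sv in jv.
have := alive_drop j al; case e : (drop j v) op => [|b w] /=.
  by have := congr1 size e; rewrite size_drop /=; lia.
rewrite /alive_at; case: operation => // q _ [u _].
have cj := cL j (ltnW jv).
have f1 : fam (grf m) (L (b :: w)) by apply/(fam_growth clf).
have [n' [S'n' /= en']] := inf_ev iS' (cj (grf m)).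
rewrite e in en'; have /(fam_growth clf) [x mx hx] := (proj2 en' f1).
by have [_ _ /(_ x mx)] := hd n' S'n'; rewrite e.
Qed.

Definition sound (rho : nat -> nat) (Zs : seq bool -> real) (v : seq bool) :=
  forall x, ~ defective rho Zs v x.

Lemma sound_tail rho Zs i v : outcome_tree rho Zs ->
  sound rho Zs (i :: v) -> sound rho Zs v.
Proof.
move=> hZ h [[j n]|p] /= hd; first by apply: (h (inl (j.+1, n))); case: hd.
by apply: (h (inr (false :: p))) => /=; rewrite (outcome_tree_lh i v hZ).
Qed.

Lemma konig_path (ok : seq bool -> Prop) :
  (forall k, exists2 v, size v = k & ok v) -> (forall i v, ok (i :: v) -> ok v) ->
  exists b : nat -> seq bool, b 0 = [::] /\
    forall k, ok (b k) /\ exists i, b k.+1 = i :: b k.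
Proof.
move=> hk hok.
have okc w v : ok (w ++ v) -> ok v by elim: w => [|i w IH] //= /hok.
pose big v := forall m, exists2 w, m <= size w & ok (w ++ v).
have bigS v : big v -> exists i, big (i :: v).
  move=> hb; apply: contrapT => /forallNP h.
  have [m0 h0] : exists m, forall w, m <= size w -> ~ ok (w ++ false :: v).
    have /existsNP [m hm] := h false; exists m => w mw o; apply: hm; exists w => //.
  have [m1 h1] : exists m, forall w, m <= size w -> ~ ok (w ++ true :: v).
    have /existsNP [m hm] := h true; exists m => w mw o; apply: hm; exists w => //.
  have [w sw] := hb (maxn m0 m1).+1; case/lastP: w sw => [|w i]; first by rewrite ltn0.
  rewrite size_rcons cat_rcons ltnS => sw.
  by case: i; [apply: h1|apply: h0]; lia.
have /choice [f hf] : forall v, exists i, big v -> big (i :: v).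
  move=> v; have [/bigS [i ?]|nb] := pselect (big v); first by exists i.
  by exists true.
pose b := fix b k := if k is k'.+1 then f (b k') :: b k' else [::].
have bb k : big (b k).
  elim: k => [|k IH] /=; last exact: hf.
  by move=> m; have [v <- ov] := hk m; exists v; rewrite ?cats0.
exists b; split=> // k; split; last by exists (f (b k)).
by have [w _ /okc] := bb k 0.
Qed.

Lemma proj_nseq d p Z : proj (nseq d false ++ p) Z = proj p (iter d lh Z).
Proof. by elim: d Z => [|d IH] Z //=; rewrite IH -iterSr. Qed.

Lemma sound_ideal : exists rho Z, [/\ tends_to_infinity rho, Z 0 = start rho,
  forall k, lh (Z k.+1) = Z k & forall k p, ~ good rho (proj p (Z k))] /\
  (forall k e, ~ fam (cf [:: e]) (Z k) ->
     exists2 k', k <= k' & ~ fam e (join (Z k) (rh (Z k'.+1)))) /\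
  (forall k p, exists k' i, [/\ k <= k', unbounded (rh (Z k'.+1))
     & forall x y, rh (Z k'.+1) x -> rh (Z k'.+1) y -> x < y -> col p (Z k) x y = i]).
Proof.
pose B n := if @choice.unpickle {k & assignment k} n is Some i then all_defective i
  else fun=> False.
have [rho [tot hB]] : exists rho, tends_to_infinity rho /\ forall i, ~ B i rho.
  apply: generic_exists => n S rhon rho iS cst; rewrite /B.
  case: choice.unpickle => [i|] h; first exact: all_defective_limit cst h.
  by have [m _ /h] := iS 0.
have [Zs hZ] := outcome_tree_total rho.
(* If all nodes of a level had defects, choosing one for each would realise an assignment that [rho]
   avoids. *)
have hk k : exists2 v, size v = k & sound rho Zs v.
  apply: contrapT => /forall2NP h.
  have /choice [a ha] : forall v : k.-tuple bool, exists x, defective rho Zs v x.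
    move=> v; have [|/existsNP [x /contrapT hx]] := h v; first by rewrite size_tuple.
    by exists x.
  pose i : {k & assignment k} := Tagged assignment [ffun v => a v].
  apply: (hB (choice.pickle i)); rewrite /B choice.pickleK; exists Zs => // v.
  by rewrite ffunE.
have ht i v : sound rho Zs (i :: v) -> sound rho Zs v by apply: sound_tail.
have [b [b0 hb]] := konig_path hk ht.
have sb k : size (b k) = k.
  by elim: k => [|k IH]; [rewrite b0|have [_ [i ->]] := hb k; rewrite /= IH].
exists rho, (fun k => Zs (b k)).
have lhZ k : lh (Zs (b k.+1)) = Zs (b k).
  by have [_ [i ->]] := hb k; rewrite (outcome_tree_lh _ _ hZ).
have itZ k k' : k <= k' -> iter (k' - k) lh (Zs (b k')) = Zs (b k).
  move=> kk'; rewrite -{2}(subnKC kk'); move: (k' - k) => d.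
  by elim: d => [|d IH]; [rewrite addn0|rewrite iterSr addnS lhZ].
have out k : exists i, Zs (b k.+1) = (if i then Zs (true :: b k) else Zs (false :: b k))
    /\ outcomes k (Zs (b k)) (Zs (false :: b k)) (Zs (true :: b k)).
  have [_ [i ->]] := hb k; exists i; split; first by case: (i).
  by have := proj2 hZ (b k); rewrite sb.
split; [split=> //|split].
- by rewrite b0; case: hZ.
- by move=> k p gd; case: (hb k) => h _; apply: (h (inr p)).
- move=> k e ne; have [k' kk' tk'] := task_often (k, inl e) k; exists k' => //.
  have [i [-> ]] := out k'; rewrite /outcomes /operation tk' kk' => -[bs et].
  rewrite et if_same; set e' := subf _ _ in bs.
  have eE P : fam e' (join (Zs (b k')) P) <-> fam e (join (Zs (b k)) P).
    by rewrite (fam_tr clf) /= lh_join rh_join itZ.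
  have ne' : ~ fam (cf [:: e']) (Zs (b k')).
    move=> /(fam_all clf) h; apply: ne; apply/(fam_all clf) => P; have [f] := h P.
    by rewrite inE => /eqP -> /eE hf; exists e; rewrite ?mem_head.
  rewrite -eE -[X in join X _](outcome_tree_lh false (b k') hZ) join_lr.
  exact: basis_step_avoids ne' bs.
move=> k p; have [k' kk' tk'] := task_often (k, inr p) k; exists k'.
have [i [Zi]] := out k'; rewrite /outcomes.
case op : (operation k') => [//|q]; first by move: op; rewrite /operation tk'.
have -> : q = nseq (k' - k) false ++ p by move: op; rewrite /operation tk' => -[].
move=> [r [rr Zf Zt]]; exists i.
have rZ : rh (Zs (b k'.+1)) = side_set r i by rewrite Zi Zf Zt; case: (i); rewrite rh_join.
split=> //.
  move=> m; apply: contrapT => /forall2NP hm.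
  have [hs _] := hb k'.+1; apply: (hs (inl (0, m))); rewrite /= drop0 sb op; split=> // x mx.
  by case: (hm x).
move=> x y; rewrite rZ => hx hy xy; have := side_set_hom rr hx hy xy.
by rewrite /col proj_nseq itZ.
Qed.

End Outcomes.

(** * Soundness and omega-models *)

Lemma teval_subst v s t : teval v (tsubst s t) = teval (fun i => teval v (s i)) t.
Proof. by elim: t => //= t -> u ->. Qed.

Lemma teval_shift n v t : teval (scons n v) (tshift t) = teval v t.
Proof. by rewrite /tshift teval_subst. Qed.

Lemma sat_subst M A : forall v V s r,
  sat M v V (fsubst s r A) <-> sat M (fun i => teval v (s i)) (fun i => V (r i)) A.
Proof.
have up_s v s n : (fun i => teval (scons n v) (up s i)) = scons n (fun i => teval v (s i)).
  by apply: funext => -[|i] //=; rewrite teval_shift.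
have up_r (V : nat -> nat -> Prop) r X : (fun i => scons X V (up2 r i)) = scons X (fun i => V (r i)).
  by apply: funext => -[|i].
elim: A => [t u|t u|t X||A IHA B IHB|A IHA B IHB|A IHA B IHB|A IH|A IH|A IH|A IH] v V s r /=;
  rewrite ?teval_subst //.
- by rewrite IHA IHB.
- by rewrite IHA IHB.
- by rewrite IHA IHB.
- by split=> h n; have := h n; rewrite IH up_s.
- by split=> -[n h]; exists n; move: h; rewrite IH up_s.
- by split=> h X MX; have := h X MX; rewrite IH up_r.
by split=> -[X MX h]; exists X => //; move: h; rewrite IH up_r.
Qed.

Lemma sat_shift1 M n v V A : sat M (scons n v) V (shift1 A) <-> sat M v V A.
Proof. exact: sat_subst. Qed.

Lemma sat_shift2 M X v V A : sat M v (scons X V) (shift2 A) <-> sat M v V A.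
Proof. exact: sat_subst. Qed.

Lemma sat_inst1 M v V A t : sat M v V (inst1 A t) <-> sat M (scons (teval v t) v) V A.
Proof.
rewrite /inst1 sat_subst; suff -> : (fun i : nat => teval v match i with
  0 => t | j.+1 => TVar j end) = scons (teval v t) v by [].
by apply: funext => -[].
Qed.

Lemma sat_inst2 M v V A X : sat M v V (inst2 A X) <-> sat M v (scons (V X) V) A.
Proof.
rewrite /inst2 sat_subst; suff -> : (fun i : nat => V match i with
  0 => X | j.+1 => j end) = scons (V X) V by [].
by apply: funext => -[].
Qed.

(** The quantifier rules are sound although the theory is not shifted, because its members hold in
    [M] under all valuations. *)
Lemma soundness M T G A : nd T G A -> models_theory M T ->
  forall v V, (forall i, M (V i)) -> (forall B, List.In B G -> sat M v V B) -> sat M v V A.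
Proof.
have in_map (f : formula -> formula) B G' : List.In B (map f G') ->
    exists2 C, List.In C G' & B = f C.
  elim: G' => [//|C G' IH] /= [<-|/IH [D ? ->]]; first by exists C; [left|].
  by exists D; [right|].
move=> h hT; elim: h => {G A}.
- by move=> G A TA v V hV _; apply: hT.
- by move=> G A GA v V hV; apply.
- by move=> G A B _ IH v V hV hG /= hA; apply: IH => // C [<-|/hG].
- by move=> G A B _ IHA _ IHB v V hV hG; apply: (IHA v V hV hG); apply: IHB.
- by move=> G A B _ IHA _ IHB v V hV hG; split; [apply: IHA|apply: IHB].
- by move=> G A B _ IH v V hV hG; case: (IH v V hV hG).
- by move=> G A B _ IH v V hV hG; case: (IH v V hV hG).
- by move=> G A B _ IH v V hV hG; left; apply: IH.
- by move=> G A B _ IH v V hV hG; right; apply: IH.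
- move=> G A B C _ IH _ IHA _ IHB v V hV hG.
  case: (IH v V hV hG) => hAB; [apply: IHA|apply: IHB] => // D [<-|/hG] //.
- move=> G A _ IH v V hV hG; apply: contrapT => nA.
  by apply: (IH v V hV) => B [<-|/hG].
- move=> G A _ IH v V hV hG n; apply: IH => // B /in_map [C GC ->].
  by apply/sat_shift1; apply: hG.
- by move=> G A t _ IH v V hV hG; apply/sat_inst1; apply: IH.
- by move=> G A t _ IH v V hV hG; exists (teval v t); apply/sat_inst1; apply: IH.
- move=> G A C _ IH _ IHC v V hV hG; have [n hn] := IH v V hV hG.
  apply/(sat_shift1 M n); apply: IHC => // B /= [<- //|/in_map [D GD ->]].
  by apply/sat_shift1; apply: hG.
- move=> G A _ IH v V hV hG X MX; apply: IH => [[|i]|B /in_map [C GC ->]] //=.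
  by apply/sat_shift2; apply: hG.
- by move=> G A X _ IH v V hV hG; apply/sat_inst2; apply: IH.
- by move=> G A X _ IH v V hV hG; exists (V X) => //; apply/sat_inst2; apply: IH.
- move=> G A C _ IH _ IHC v V hV hG; have [X MX hX] := IH v V hV hG.
  apply/(sat_shift2 M X); apply: IHC => [[|i]|B] //= [<- //|/in_map [D GD ->]].
  by apply/sat_shift2; apply: hG.
- by [].
move=> G A t u _ IH _ IHA v V hV hG; apply/sat_inst1.
by rewrite -(IH v V hV hG); apply/sat_inst1; apply: IHA.
Qed.

Lemma proves_models M T A : proves T A -> models_theory M T -> models M A.
Proof. by move=> p hT v V hV; apply: (soundness p hT) => //. Qed.

Lemma teval_closed d t v v' : tclosed d t -> (forall i, i < d -> v i = v' i) ->
  teval v t = teval v' t.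
Proof.
by move=> ct h; elim: t ct => [i|||t IHt u IHu|t IHt u IHu] //= => [/h|/andP [/IHt -> /IHu ->]|/andP [/IHt -> /IHu ->]].
Qed.

Lemma sat_closed M A : forall d e v v' V V', fclosed d e A ->
  (forall i, i < d -> v i = v' i) -> (forall i, i < e -> V i = V' i) ->
  sat M v V A <-> sat M v' V' A.
Proof.
elim: A => [t u|t u|t X||A IHA B IHB|A IHA B IHB|A IHA B IHB|A IH|A IH|A IH|A IH]
  d e v v' V V' /= cA hv hV //.
- by case/andP: cA => /teval_closed ht /teval_closed hu; rewrite (ht v v') ?(hu v v').
- by case/andP: cA => /teval_closed ht /teval_closed hu; rewrite (ht v v') ?(hu v v').
- by case/andP: cA => /teval_closed ht /hV ->; rewrite (ht v v').
- by case/andP: cA => cA cB; rewrite (IHA d e v v' V V') ?(IHB d e v v' V V').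
- by case/andP: cA => cA cB; rewrite (IHA d e v v' V V') ?(IHB d e v v' V V').
- by case/andP: cA => cA cB; rewrite (IHA d e v v' V V') ?(IHB d e v v' V V').
- have h n : sat M (scons n v) V A <-> sat M (scons n v') V' A.
    by apply: IH cA _ hV => -[|i] //=; apply: hv.
  by split=> h' n; apply/h.
- have h n : sat M (scons n v) V A <-> sat M (scons n v') V' A.
    by apply: IH cA _ hV => -[|i] //=; apply: hv.
  by split=> -[n /h h']; exists n.
- have h X : sat M v (scons X V) A <-> sat M v' (scons X V') A.
    by apply: IH cA hv _ => -[|i] //=; apply: hV.
  by split=> h' X MX; apply/h; apply: h'.
have h X : sat M v (scons X V) A <-> sat M v' (scons X V') A.
  by apply: IH cA hv _ => -[|i] //=; apply: hV.
by split=> -[X MX /h h']; exists X.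
Qed.

(** The numbers of an omega-model are the standard ones, so induction holds for every formula. *)
Lemma models_induction M A : models M (induction_axiom A).
Proof.
move=> v V hV; rewrite /induction_axiom /= => -[/sat_inst1 /= h0 hS] n; elim: n => [//|n IH].
have := hS n IH; rewrite sat_subst; set v' := fun i => _.
suff -> : v' = scons n.+1 v by [].
by apply: funext => -[|i] //; rewrite /v' /= addn1.
Qed.

Lemma models_PA M : models_theory M PA.
Proof. by move=> _ [A _]; apply: models_induction. Qed.

Lemma models_tplus M S T : models_theory M S -> models_theory M T ->
  models_theory M (tplus S T).
Proof. by move=> hS hT A [/hS|/hT]. Qed.

Lemma models_basic M A : List.In A basic_axioms -> models M (A 0 0).
Proof.
by case=> [<-|[<-|[<-|[<-|[<-|[<-|[<-|[<-|[]]]]]]]]] v V _ /=; move=> *; try split; lia.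
Qed.

Lemma models_RCA0 M :
  (forall A B, sigma01 A -> pi01 B -> models M (comprehension_axiom A B)) ->
  models_theory M RCA0.
Proof.
move=> h _ [A|A _|A B]; [exact: models_basic|exact: models_induction|exact: h].
Qed.

(** * Binary digits *)

Definition bit (i a : nat) : bool := odd (a %/ 2 ^ i).

Lemma bit0 a : bit 0 a = odd a.
Proof. by rewrite /bit expn0 divn1. Qed.

Lemma bitS i a : bit i.+1 a = bit i a./2.
Proof. by rewrite /bit expnS -divn2 divnMA. Qed.

Lemma bit_inj a b : (forall i, bit i a = bit i b) -> a = b.
Proof.
elim/ltn_ind: a b => a IH b h.
have ho : odd a = odd b by rewrite -!bit0.
have [a0|an0] := eqVneq a 0.
  subst a; clear IH ho; elim/ltn_ind: b h => b IH h.
  have [->//|bn0] := eqVneq b 0.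
  have hb : b./2 < b by lia.
  have e : 0 = b./2 by apply: IH => // i; rewrite -bitS -h bitS.
  by have := h 0; rewrite !bit0 /=; lia.
have e : a./2 = b./2 by apply: IH => [|i]; rewrite -?bitS //; lia.
by rewrite -(odd_double_half a) -(odd_double_half b) ho e.
Qed.

Lemma bit_pow_sum (s : seq nat) i : uniq s -> bit i (\sum_(x <- s) 2 ^ x) = (i \in s).
Proof.
elim: i s => [|i IH] s us.
  rewrite bit0; elim: s us => [|x s IHs] /= => [_|/andP [xs us]]; first by rewrite big_nil.
  rewrite big_cons oddD IHs // in_cons oddX /= orbF eq_sym.
  by case: eqP => [e|_]; [rewrite -e in xs; rewrite (negbTE xs)|].
have -> : (\sum_(x <- s) 2 ^ x) = (0 \in s) + (\sum_(x <- [seq x.-1 | x <- s & x != 0]) 2 ^ x).*2.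
  elim: s us => [|x s IHs] /= => [_|/andP [xs us]]; first by rewrite !big_nil.
  rewrite big_cons in_cons IHs //; case: x xs => [|x] xs /=.
    by rewrite (negbTE xs).
  by rewrite big_cons expnS; lia.
rewrite bitS; set t := map _ _; have ut : uniq t.
  rewrite map_inj_in_uniq ?filter_uniq // => x y; rewrite !mem_filter.
  by case: x y => [|x] [|y] //= _ _ ->.
have -> : ((0 \in s) + (\sum_(x <- t) 2 ^ x).*2)./2 = \sum_(x <- t) 2 ^ x.
  by rewrite half_bit_double.
rewrite IH //; apply/mapP/idP => [[x]|h].
  by rewrite mem_filter; case: x => //= x /= h ->.
by exists i.+1; rewrite ?mem_filter.
Qed.

Definition finite_code (s : seq nat) : nat := \sum_(x <- undup s) 2 ^ x.

Lemma bit_finite_code s i : bit i (finite_code s) = (i \in s).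
Proof. by rewrite bit_pow_sum ?undup_uniq // mem_undup. Qed.

Lemma bit_bound i a : bit i a -> i < a.
Proof.
rewrite /bit ltnNge => h; apply/negP => ai.
by move: h; rewrite divn_small // (leq_ltn_trans ai) // ltn_expl.
Qed.

Lemma bit_set_code n (a : {set 'I_n}) i : bit i (set_code a) <-> exists2 j, j \in a & i = j.
Proof.
have -> : set_code a = \sum_(x <- [seq val j | j <- enum a]) 2 ^ x.
  by rewrite big_map /set_code big_enum.
rewrite bit_pow_sum; last by rewrite map_inj_uniq ?enum_uniq //; apply: val_inj.
split; first by case/mapP => j; rewrite mem_enum => ja ->; exists j.
by case=> j ja ->; apply: map_f; rewrite mem_enum.
Qed.

Lemma pair_code_inj x y x' y' : pair_code x y = pair_code x' y' -> x = x' /\ y = y'.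
Proof.
rewrite /pair_code => h.
have lt u v u' v' : u + v < u' + v' ->
    (u + v) * (u + v) + u < (u' + v') * (u' + v') + u'.
  move=> l; have : (u + v).+1 * (u + v).+1 <= (u' + v') * (u' + v') by apply: leq_mul.
  by lia.
have [l|l|e] := ltngtP (x + y) (x' + y').
- by have := lt _ _ _ _ l; rewrite h ltnn.
- by have := lt _ _ _ _ l; rewrite h ltnn.
by rewrite e in h; lia.
Qed.

Lemma bit_emb_code m n (f : emb m n) i j :
  bit (pair_code i j) (emb_code f) <-> exists k : 'I_m, i = k /\ j = f k.
Proof.
have -> : emb_code f = \sum_(x <- [seq pair_code k (f k) | k : 'I_m]) 2 ^ x.
  by rewrite big_map big_enum.
rewrite bit_pow_sum; last first.
  by rewrite map_inj_uniq ?enum_uniq // => k l /pair_code_inj [/val_inj].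
split; first by case/mapP => k _ /pair_code_inj [-> ->]; exists k.
by case=> k [-> ->]; apply: map_f; rewrite mem_enum.
Qed.

Lemma bit_emb_code_pair m n (f : emb m n) c : bit c (emb_code f) ->
  exists k : 'I_m, c = pair_code k (f k).
Proof.
have -> : emb_code f = \sum_(x <- [seq pair_code k (f k) | k : 'I_m]) 2 ^ x.
  by rewrite big_map big_enum.
rewrite bit_pow_sum; last first.
  by rewrite map_inj_uniq ?enum_uniq // => k l /pair_code_inj [/val_inj].
by case/mapP => k _ ->; exists k.
Qed.

(** * Goedel's beta function *)

Definition s_beta (c d i x : nat) : Prop :=
  x < d * (i + 1) + 1 /\ exists q, c = q * (d * (i + 1) + 1) + x.

Lemma s_betaE c d i x : s_beta c d i x <-> x = c %% (d * (i + 1) + 1).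
Proof.
rewrite /s_beta; split=> [[h [q ->]]|->].
  by rewrite modnMDl modn_small.
split; first by rewrite ltn_mod; lia.
by exists (c %/ (d * (i + 1) + 1)); rewrite -divn_eq.
Qed.

Lemma beta_exists (h : nat -> nat) n : exists c d, forall i, i <= n -> s_beta c d i (h i).
Proof.
(* [N] exceeds the indices and the values: the differences of indices divide the factorial [d],
   which makes the moduli pairwise coprime, and each value is below its modulus. *)
pose N := maxn n.+1 (\max_(i < n.+1) h i).+1.
pose d := N`!; pose m i := d * (i + 1) + 1.
have dN k : 0 < k -> k <= N -> k %| d by move=> k0 kN; apply: dvdn_fact; rewrite k0.
have cop i k : i < k -> k <= n -> coprime (m i) (m k).
  move=> ik kn; rewrite /coprime; set g := gcdn _ _.
  have gi : g %| m i := dvdn_gcdl _ _.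
  have gk : g %| m k := dvdn_gcdr _ _.
  have cgd : coprime g d.
    rewrite /coprime -dvdn1; have h1 : gcdn g d %| m i by apply: dvdn_trans gi; apply: dvdn_gcdl.
    rewrite -(dvdn_addr 1 (_ : gcdn g d %| d * (i + 1))) //.
    by apply: dvdn_mulr; apply: dvdn_gcdr.
  have gd : g %| d * (k - i).
    have -> : d * (k - i) = m k - m i by rewrite /m; nia.
    exact: dvdn_sub.
  rewrite Gauss_dvdr // in gd.
  have gd' : g %| d by apply: dvdn_trans gd (dN _ _ _); rewrite /N; lia.
  by move: cgd; rewrite /coprime (gcdn_idPl gd').
have [c hc] : exists c, forall i, i < n.+1 -> c = h i %[mod m i].
  have : n.+1 <= n.+1 by [].
  elim: {-2}(n.+1) => [_|k IH kn]; first by exists 0.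
  have [c hc] := IH (ltnW kn).
  have cp : coprime (\prod_(i < k) m i) (m k).
    apply: (big_ind (fun x => coprime x (m k))); first exact: coprime1n.
      by move=> x y hx hy; rewrite coprimeMl hx.
    by move=> i _; apply: cop => //; lia.
  exists (chinese (\prod_(i < k) m i) (m k) c (h k)) => i.
  rewrite ltnS leq_eqVlt => /orP [/eqP ->|ik]; first by rewrite chinese_modr.
  rewrite -hc //; apply/eqP.
  have dv : m i %| \prod_(i < k) m i.
    by rewrite (bigD1 (Ordinal ik)) //=; apply: dvdn_mulr.
  by rewrite -(modn_dvdm _ dv) (chinese_modl cp) modn_dvdm.
exists c, d => i ni; apply/s_betaE; rewrite -/(m i) hc // modn_small //.
have hi : h i <= \max_(k < n.+1) h k.
  exact: (leq_bigmax (Ordinal (ni : i < n.+1)) (F := fun i : 'I_n.+1 => h i)).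
have d0 : N <= d by apply: dvdn_leq; [exact: fact_gt0|apply: dN; rewrite /N; lia].
have hN : h i < N by rewrite /N; lia.
rewrite /m mulnDr muln1; apply: leq_trans hN _; apply: leq_trans d0 _; lia.
Qed.

Definition s_pow2 (i x : nat) : Prop :=
  exists c d, s_beta c d 0 1
    /\ (forall j, j < i -> forall y, s_beta c d j y -> s_beta c d (j + 1) (y + y))
    /\ s_beta c d i x.

Lemma s_pow2E i x : s_pow2 i x <-> x = 2 ^ i.
Proof.
split=> [[c [d [h0 [hS hi]]]]|->].
  have h j : j <= i -> s_beta c d j (2 ^ j).
    elim: j => [//|j IH] ji; rewrite -addn1 expnD muln2 -addnn.
    by apply: hS => //; apply: IH; lia.
  by move/s_betaE: hi; have /s_betaE := h i (leqnn i) => <-.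
have [c [d h]] := beta_exists (fun j => 2 ^ j) i; exists c, d; split; first exact: h.
split; last exact: h.
move=> j ji y /s_betaE hy; have /s_betaE := h j (ltnW ji); rewrite -hy => <-.
by have := h (j + 1); rewrite expnD muln2 -addnn; apply; lia.
Qed.

Definition s_mem (i a : nat) : Prop :=
  exists p q r, s_pow2 i p /\ a = (q + q + 1) * p + r /\ r < p.

Lemma s_memE i a : s_mem i a <-> bit i a.
Proof.
split=> [[p [q [r [/s_pow2E -> [-> rp]]]]]|h].
  by rewrite /bit divnMDl ?expn_gt0 // divn_small // addn0 oddD addnn odd_double.
exists (2 ^ i), (a %/ 2 ^ i)./2, (a %% 2 ^ i); split; first exact/s_pow2E.
split; last by rewrite ltn_mod expn_gt0.
have -> : (a %/ 2 ^ i)./2 + (a %/ 2 ^ i)./2 + 1 = a %/ 2 ^ i.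
  by rewrite -{3}(odd_double_half (a %/ 2 ^ i)) -/(bit i a) h -addnn; lia.
exact: divn_eq.
Qed.

Notation set_of_nat := (nat -> Prop).

(** * The formulas of the definitions, read in an omega-model *)

(** The notions with prefix [s_] follow the formulas so closely that [sat] reduces to them by
    conversion. *)
Definition s_infinite (X : set_of_nat) : Prop := forall k, exists x, k < x /\ X x.

Definition s_string (n a : nat) : Prop := forall i, s_mem i a -> i < n.

Definition s_binary_tree (T : set_of_nat) : Prop :=
  (forall c, T c -> exists n a, c = pair_code n a /\ s_string n a)
  /\ (forall n a m b, T (pair_code n a) -> m < n \/ m = n -> s_string m b ->
        (forall i, i < m -> (s_mem i b <-> s_mem i a)) -> T (pair_code m b)).

Definition s_path (T X : set_of_nat) : Prop :=
  forall n, exists a, s_string n a /\ (forall i, i < n -> (s_mem i a <-> X i))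
    /\ T (pair_code n a).

Lemma sat_weak_konig M v V : sat M v V weak_konig <->
  forall T, M T -> s_binary_tree T -> s_infinite T -> exists2 X, M X & s_path T X.
Proof. by []. Qed.

Definition s_colouring (C : set_of_nat) : Prop :=
  forall x y, x < y -> exists i, (i < 1 \/ i = 1) /\ C (pair_code (pair_code x y) i)
    /\ forall j, C (pair_code (pair_code x y) j) -> j = i.

Lemma sat_ramsey22 M v V : sat M v V ramsey22 <->
  forall C, M C -> s_colouring C -> exists2 H, M H & s_infinite H
    /\ exists i, forall x y, H x -> H y -> x < y -> C (pair_code (pair_code x y) i).
Proof. by []. Qed.

Definition s_linear (r : nat -> nat -> Prop) : Prop :=
  forall x y, (r x y -> r x x /\ r y y)
    /\ (r x y -> r y x -> x = y)
    /\ (forall z, r x y -> r y z -> r x z)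
    /\ (r x x -> r y y -> r x y \/ r y x).

Definition s_function (F : set_of_nat) : Prop :=
  forall n, exists x, F (pair_code n x) /\ forall y, F (pair_code n y) -> y = x.

Definition s_wf_rel (M : set_of_nat -> Prop) (r : nat -> nat -> Prop) : Prop :=
  ~ exists2 F, M F & s_function F /\ forall n x y,
    F (pair_code n x) -> F (pair_code (n + 1) y) -> r y x /\ ~ r x y.

Definition s_le (X : set_of_nat) (x y : nat) : Prop := X (pair_code x y).
Definition s_lt_ord (X : set_of_nat) (x y : nat) : Prop := X (pair_code x y) /\ ~ (x = y).

Section CodedPredilators.

Variable D : set_of_nat.

Definition s_dle (n s t : nat) : Prop := D (pair_code 0 (pair_code n (pair_code s t))).
Definition s_ddom (n s : nat) : Prop := s_dle n s s.
Definition s_dmor (m n f s t : nat) : Prop :=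
  D (pair_code 1 (pair_code (pair_code m (pair_code n f)) (pair_code s t))).
Definition s_dsupp (n s a : nat) : Prop :=
  D (pair_code (1 + 1) (pair_code n (pair_code s a))).

Definition s_emb (m n f : nat) : Prop :=
  (forall c, s_mem c f -> exists i j, c = pair_code i j /\ i < m /\ j < n)
  /\ (forall i, i < m -> exists j, s_mem (pair_code i j) f)
  /\ (forall i j k, s_mem (pair_code i j) f -> s_mem (pair_code i k) f -> j = k)
  /\ (forall i i' j j', s_mem (pair_code i j) f -> s_mem (pair_code i' j') f ->
        i < i' -> j < j').

Definition s_predilator : Prop :=
  (forall n, s_linear (s_dle n))
  /\ (forall m n f s t, s_dmor m n f s t -> s_emb m n f /\ s_ddom m s /\ s_ddom n t)
  /\ (forall m n f s, s_emb m n f -> s_ddom m s ->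
        exists t, s_dmor m n f s t /\ forall u, s_dmor m n f s u -> u = t)
  /\ (forall m n f s s' t t', s_dmor m n f s t -> s_dmor m n f s' t' ->
        (s_dle m s s' <-> s_dle n t t'))
  /\ (forall n f s, s_emb n n f -> (forall i, i < n -> s_mem (pair_code i i) f) ->
        s_ddom n s -> s_dmor n n f s s)
  /\ (forall l m n f g h, s_emb l m f -> s_emb m n g -> s_emb l n h ->
        (forall i j k, s_mem (pair_code i j) f -> s_mem (pair_code j k) g ->
           s_mem (pair_code i k) h) ->
        forall s t u, s_dmor l m f s t -> s_dmor m n g t u -> s_dmor l n h s u)
  /\ (forall m n f g, s_emb m n f -> s_emb m n g ->
        (forall i j k, s_mem (pair_code i j) f -> s_mem (pair_code i k) g -> j < k \/ j = k) ->
        forall s t u, s_dmor m n f s t -> s_dmor m n g s u -> s_dle n t u)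
  /\ (forall n s a, s_dsupp n s a -> s_ddom n s /\ forall i, s_mem i a -> i < n)
  /\ (forall n s, s_ddom n s ->
        exists a, s_dsupp n s a /\ forall b, s_dsupp n s b -> b = a)
  /\ (forall m n f s t a b, s_dmor m n f s t -> s_dsupp m s a ->
        s_dsupp n t b -> forall j, s_mem j b <-> exists i, s_mem i a /\ s_mem (pair_code i j) f)
  /\ (forall m n f t b, s_emb m n f -> s_dsupp n t b ->
        (forall j, s_mem j b -> exists i, s_mem (pair_code i j) f) -> exists s, s_dmor m n f s t).

End CodedPredilators.

Section CodedExtension.

Variables D X : set_of_nat.

Definition s_enumerates (k e a : nat) : Prop :=
  (forall c, s_mem c e -> exists i x, c = pair_code i x /\ i < k /\ s_mem x a)
  /\ (forall i, i < k -> exists x, s_mem (pair_code i x) e)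
  /\ (forall x, s_mem x a -> exists i, s_mem (pair_code i x) e)
  /\ (forall i x y, s_mem (pair_code i x) e -> s_mem (pair_code i y) e -> x = y)
  /\ (forall i j x y, s_mem (pair_code i x) e -> s_mem (pair_code j y) e -> i < j ->
        s_lt_ord X x y).

Definition s_inclusion_morphism (a b k l f : nat) : Prop :=
  s_emb k l f /\ exists ea eb, s_enumerates k ea a /\ s_enumerates l eb b
    /\ forall i j x, s_mem (pair_code i j) f -> s_mem (pair_code i x) ea ->
         s_mem (pair_code j x) eb.

Definition s_bar_dom (s a : nat) : Prop :=
  (forall y, s_mem y a -> s_le X y y)
  /\ exists k e, s_enumerates k e a /\ s_ddom D k s
       /\ exists b, s_dsupp D k s b /\ forall i, s_mem i b <-> i < k.

Definition s_bar_le (x y : nat) : Prop :=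
  exists s a t b, x = pair_code s a /\ y = pair_code t b /\ s_bar_dom s a /\ s_bar_dom t b
    /\ exists c, (forall z, s_mem z c <-> s_mem z a \/ s_mem z b)
    /\ exists k l n f g u v,
         s_inclusion_morphism a c k n f /\ s_inclusion_morphism b c l n g
         /\ s_dmor D k n f s u /\ s_dmor D l n g t v /\ s_dle D n u v.

End CodedExtension.

Definition s_dilator (M : set_of_nat -> Prop) (D : set_of_nat) : Prop :=
  s_predilator D /\ forall X, M X ->
    s_linear (s_le X) /\ s_wf_rel M (s_le X) -> s_wf_rel M (s_bar_le D X).

(* [denotes d v x n]: at depth [d] and under [v], [x] has the value [n], also
   below further quantifiers. *)
Definition denotes (d : nat) (v : nat -> nat) (x : tm) (n : nat) : Prop :=
  forall l : seq nat, teval (foldr (@scons nat) v l) (x (size l + d)) = n.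

Lemma denotes_eval d v x n : denotes d v x n -> teval v (x d) = n.
Proof. by move/(_ [::]). Qed.

Lemma denotes_push d v x n a : denotes d v x n -> denotes d.+1 (scons a v) x n.
Proof. by move=> h l; have := h (rcons l a); rewrite size_rcons foldr_rcons addSnnS. Qed.

Lemma denotes_var d v a : denotes d.+1 (scons a v) (fun d' => TVar (d' - d.+1)) a.
Proof. by move=> l /=; rewrite addnK; elim: l. Qed.

Lemma denotes_succ d v x n : denotes d v x n -> denotes d v (m_add x m_one) (n + 1).
Proof. by move=> h l /=; rewrite h. Qed.

Lemma denotes_zero d v : denotes d v m_zero 0. Proof. by []. Qed.
Lemma denotes_one d v : denotes d v m_one 1. Proof. by []. Qed.

Lemma sat_beta M V e d v c d' i x nc nd ni nx : denotes d v c nc -> denotes d v d' nd ->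
  denotes d v i ni -> denotes d v x nx ->
  sat M v V (m_beta c d' i x d e) <-> s_beta nc nd ni nx.
Proof.
move=> hc hd hi hx; rewrite /s_beta /=.
rewrite (denotes_eval hx) (denotes_eval hd) (denotes_eval hi).
split=> -[h [q hq]]; split=> //; exists q; move: hq;
by rewrite (denotes_eval (denotes_push q hx)) (denotes_eval (denotes_push q hd))
  (denotes_eval (denotes_push q hi)) (denotes_eval (denotes_push q hc)) subnn.
Qed.

(** This one is not a conversion: the formula is built by recursion on the program, and for [PRec] a
    sequence coded by the beta function must be exchanged for a function. *)
Lemma sat_peval M p : forall xs ys y n d e v V, size xs = size ys ->
  (forall i, denotes d v (nth m_zero xs i) (nth 0 ys i)) -> denotes d v y n ->
  sat M v V (m_peval p xs y d e) <-> peval p ys n.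
Proof.
have nthc d v (xs : seq tm) ys x n : denotes d v x n ->
    (forall i, denotes d v (nth m_zero xs i) (nth 0 ys i)) ->
    forall i, denotes d v (nth m_zero (x :: xs) i) (nth 0 (n :: ys) i).
  by move=> hx h [|i]; [exact: hx|exact: h].
have push d v xs ys a : (forall i, denotes d v (nth m_zero xs i) (nth 0 ys i)) ->
    forall i, denotes d.+1 (scons a v) (nth m_zero xs i) (nth 0 ys i).
  by move=> h i; apply: denotes_push.
elim: p => [i||p IHp|p IHp q IHq|p IHp b IHb s IHs|p IHp] xs ys y n d e v V sz hxs hy /=.
- by rewrite (denotes_eval hy) (denotes_eval (hxs i)).
- by rewrite (denotes_eval hy).
- have E z : sat M (scons z v) V (m_peval p xs (fun d' => TVar (d' - d.+1)) d.+1 e) <-> peval p ys z.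
    by apply: IHp => //; [apply: (push)|apply: denotes_var].
  have ey z : teval (scons z v) (y d.+1) = n by apply: denotes_eval; apply: denotes_push.
  split=> [[z []]|[z hz en]]; [|exists z]; rewrite ey subnn /= addn1; last by split; [apply/E|].
  by move/E => h en; exists z.
- have E z : sat M (scons z v) V (m_peval p xs (fun d' => TVar (d' - d.+1)) d.+1 e) <-> peval p ys z.
    by apply: IHp => //; [apply: (push)|apply: denotes_var].
  have E' z : sat M (scons z v) V (m_peval q ((fun d' => TVar (d' - d.+1)) :: xs) y d.+1 e)
      <-> peval q (z :: ys) n.
    apply: IHq; [by rewrite /= sz| |exact: denotes_push].
    by apply: nthc (push _ _ _ _ _ hxs); apply: denotes_var.
  by split=> [[z [/E h /E' h']]|[z h h']]; exists z => //; split; [apply/E|apply/E'].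
- pose N : tm := fun d' => TVar (d' - d.+1); pose C : tm := fun d' => TVar (d' - d.+2).
  pose E : tm := fun d' => TVar (d' - d.+3).
  have hN n0 : denotes d.+1 (scons n0 v) N n0 by apply: denotes_var.
  have Ep n0 : sat M (scons n0 v) V (m_peval p xs N d.+1 e) <-> peval p ys n0.
    by apply: IHp => //; apply: (push).
  have ER n0 c dd : sat M (scons dd (scons c (scons n0 v))) V
      (m_and (m_ex (fun z => m_and (m_beta C E m_zero z) (m_peval b xs z)))
      (m_and (m_all (fun k => m_imp (m_lt k N) (m_ex (fun z => m_ex (fun w =>
        m_and (m_beta C E k z) (m_and (m_beta C E (m_add k m_one) w)
          (m_peval s [:: z, k & xs] w)))))))
      (m_beta C E N y)) d.+3 e) <->
      [/\ exists z, s_beta c dd 0 z /\ peval b ys z,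
         forall k, k < n0 -> exists z w, s_beta c dd k z /\ s_beta c dd (k + 1) w
           /\ peval s [:: z, k & ys] w
       & s_beta c dd n0 n].
    set v3 := scons dd _.
    have hN3 : denotes d.+3 v3 N n0 by do 2 apply: denotes_push.
    have hC3 : denotes d.+3 v3 C c by apply: denotes_push; apply: denotes_var.
    have hE3 : denotes d.+3 v3 E dd by apply: denotes_var.
    have hy3 : denotes d.+3 v3 y n by do 3 apply: denotes_push.
    have hx3 : forall i, denotes d.+3 v3 (nth m_zero xs i) (nth 0 ys i) by do 3 apply: (push).
    have e1 z : sat M (scons z v3) V (m_beta C E m_zero (fun d' => TVar (d' - d.+4)) d.+4 e)
        <-> s_beta c dd 0 z.
      by apply: sat_beta; try exact: denotes_push; exact: denotes_var.
    have e2 z : sat M (scons z v3) V (m_peval b xs (fun d' => TVar (d' - d.+4)) d.+4 e)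
        <-> peval b ys z.
      by apply: IHb => //; [exact: push|exact: denotes_var].
    have e3 : sat M v3 V (m_beta C E N y d.+3 e) <-> s_beta c dd n0 n by apply: sat_beta.
    pose K : tm := fun d' => TVar (d' - d.+4); pose Z : tm := fun d' => TVar (d' - d.+4.+1).
    pose W : tm := fun d' => TVar (d' - d.+4.+2).
    have hK k z w : denotes d.+4.+2 (scons w (scons z (scons k v3))) K k.
      by do 2 apply: denotes_push; apply: denotes_var.
    have hZ k z w : denotes d.+4.+2 (scons w (scons z (scons k v3))) Z z.
      by apply: denotes_push; apply: denotes_var.
    have hW k z w : denotes d.+4.+2 (scons w (scons z (scons k v3))) W w.
      by apply: denotes_var.
    have e4 k z w : sat M (scons w (scons z (scons k v3))) V (m_beta C E K Z d.+4.+2 e)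
        <-> s_beta c dd k z.
      by apply: sat_beta => //; do 3 apply: denotes_push.
    have e5 k z w : sat M (scons w (scons z (scons k v3))) V
        (m_beta C E (m_add K m_one) W d.+4.+2 e) <-> s_beta c dd (k + 1) w.
      apply: sat_beta => //; try by do 3 apply: denotes_push.
      exact: denotes_succ.
    have e6 k z w : sat M (scons w (scons z (scons k v3))) V
        (m_peval s [:: Z, K & xs] W d.+4.+2 e) <-> peval s [:: z, k & ys] w.
      apply: IHs => //; first by rewrite /= sz.
      by do 2 (apply: (nthc) => //); do 3 apply: (push).
    have e7 k : sat M (scons k v3) V (m_lt K N d.+4 e) <-> k < n0.
      rewrite (_ : sat _ _ _ _ = (teval (scons k v3) (K d.+4) < teval (scons k v3) (N d.+4))) //.
      by rewrite (denotes_eval (denotes_push _ hN3)) /K /= subnn.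
    split=> [[[z [/e1 h1 /e2 h2]] [h3 /e3 h4]]|[[z [h1 h2]] h3 h4]].
      split=> //; first by exists z.
      move=> k /e7 kn; have [z' [w [/e4 ? [/e5 ? /e6 ?]]]] := h3 k kn.
      by exists z', w.
    split; first by exists z; split; [apply/e1|apply/e2].
    split; last exact/e3.
    move=> k /e7 kn; have [z' [w [? [? ?]]]] := h3 k kn.
    by exists z', w; split; [apply/e4|split; [apply/e5|apply/e6]].
  split=> [[n0 [/Ep hp [c [dd /ER [[z [hz hb]] hs hn]]]]]|[n0 [hp [h [hb hs hn]]]]].
    exists n0; split=> //; exists (fun k => c %% (dd * (k + 1) + 1)); split.
    - by rewrite -(proj1 (s_betaE _ _ _ _) hz).
    - move=> k kn; have [z' [w [/s_betaE -> [/s_betaE -> ]]]] := hs k kn.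
      by rewrite !addn1.
    by move/s_betaE: hn => <-.
  have [c [dd hc]] := beta_exists h n0.
  exists n0; split; first exact/Ep.
  exists c, dd; apply/ER; split; first by exists (h 0); split=> //; apply: hc.
    move=> k kn; exists (h k), (h k.+1); split; first by apply: hc; lia.
    by rewrite addn1; split; [apply: hc|apply: hs].
  by rewrite -hn; apply: hc.
have E : sat M v V (m_peval p (y :: xs) m_zero d e) <-> peval p (n :: ys) 0.
  by apply: IHp; [rewrite /= sz|exact: nthc|].
pose K : tm := fun d' => TVar (d' - d.+1); pose Z : tm := fun d' => TVar (d' - d.+2).
have E' k z : sat M (scons z (scons k v)) V (m_peval p (K :: xs) (m_add Z m_one) d.+2 e)
    <-> peval p (k :: ys) z.+1.
  rewrite -(addn1 z); apply: IHp; first by rewrite /= sz.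
    apply: nthc; first by apply: denotes_push; apply: denotes_var.
    by do 2 apply: (push).
  by apply: denotes_succ; apply: denotes_var.
have ey k : sat M (scons k v) V (m_lt K y d.+1 e) <-> k < n.
  rewrite (_ : sat _ _ _ _ = (teval (scons k v) (K d.+1) < teval (scons k v) (y d.+1))) //.
  by rewrite (denotes_eval (denotes_push _ hy)) /K /= subnn.
split=> [[/E h1 h2]|[h1 h2]]; split=> //; try exact/E.
  by move=> k /ey kn; have [z /E' hz] := h2 k kn; exists z.
by move=> k /ey /h2 [z hz]; exists z; apply/E'.
Qed.

Lemma sat_dilator_sentence M v V p : sat M v V (dilator_sentence p) <->
  exists2 D, M D & computes p D /\ s_dilator M D.
Proof.
have E x D y n : denotes 1 (scons x v) y n ->
    sat M (scons x v) (scons D V) (m_peval p [:: fun d' => TVar (d' - 1)] y 1 1) <-> peval p [:: x] n.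
  move=> hy; apply: sat_peval => //; case=> [|i]; last by rewrite !nth_default.
  exact: denotes_var.
have E1 x D := E x D _ _ (@denotes_one 1 (scons x v)).
have E0 x D := E x D _ _ (@denotes_zero 1 (scons x v)).
split=> -[D MD [hc hd]]; exists D => //; split => //.
  by move=> x; case: (hc x) => -[Dx /=]; [move/E1; left|move/E0; right].
by move=> x; case: (hc x) => -[Dx /=]; [move/E1; left|move/E0; right].
Qed.

(** * Comparing elements of a predilator under valuations *)

Lemma emb_lt m n (f : emb m n) (i j : 'I_m) : i < j -> f i < f j.
Proof. by have /forallP/(_ i)/forallP/(_ j)/implyP := emb_incr f. Qed.

Lemma emb_ext m n (f g : emb m n) : (forall i, f i = g i :> nat) -> f = g.
Proof.
move=> fg; have : emb_fun f = emb_fun g by apply/ffunP => i; apply/val_inj/fg.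
case: f g {fg} => [f fi] [g gi] /= efg; rewrite -efg in gi *.
by rewrite (bool_irrelevance fi gi).
Qed.

Lemma emb_exists m n (u : nat -> nat) : (forall i, i < m -> u i < n) ->
  (forall i j, i < j -> j < m -> u i < u j) -> exists f : emb m n, forall i, f i = u i :> nat.
Proof.
move=> un uu.
have incr : increasing [ffun i : 'I_m => Ordinal (un i (ltn_ord i))].
  by apply/forallP => i; apply/forallP => j; apply/implyP => ij; rewrite !ffunE /=; apply: uu.
by exists (Emb incr) => i; rewrite /= ffunE.
Qed.

Lemma emb_widen n n' : n <= n' -> exists f : emb n n', forall i, f i = i :> nat.
Proof. by move=> nn'; apply: (emb_exists (u := id)) => //= i; lia. Qed.

Definition increasing_fun (E : nat -> nat) : Prop := forall x y, x < y -> E x < E y.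

Lemma extend_increasing E B : (forall x y, x < y -> y < B -> E x < E y) ->
  exists2 E', increasing_fun E' & forall x, x < B -> E' x = E x.
Proof.
move=> Ei; exists (fun x => if x < B then E x else \max_(i < B) E i + x.+1); last by move=> x ->.
move=> x y xy; case: ifP => xB; case: ifP => yB; [exact: Ei| |lia|lia].
by have := leq_bigmax (Ordinal xB) (F := fun i : 'I_B => E i); rewrite /=; lia.
Qed.

(* The two realisations share the values listed in [s]; the second one is
   pushed down in each gap between shared values, except that it is put just
   above [z] in the gap of [z] when [high] is set. *)
Lemma amalgam (s : seq (nat * nat)) (high : bool) (z B : nat) :
  (forall p q, p \in s -> q \in s -> (p.1 <= q.1) = (p.2 <= q.2)) ->
  (forall p, p \in s -> p.2 < B) ->
  exists E1 E2, [/\ increasing_fun E1, increasing_fun E2,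
    forall p, p \in s -> E1 p.1 = E2 p.2,
    forall v, high -> v < B -> (forall p, p \in s -> p.2 != v) ->
      (forall p, p \in s -> (p.2 <= v) = (p.1 <= z)) -> E1 z < E2 v
  & forall v w, v < B -> (high -> z < w) ->
      (forall p, p \in s -> p.2 <= v -> p.1 < w) -> E2 v < E1 w].
Proof.
(* The first realisation and the shared values use multiples of [K]. The other values of the second
   one are placed inside the blocks of length [K], with offsets [v.+1] below [K]. By default the
   block is the one just after the last shared value below [v]. *)
move=> pat sB; pose K := B.+2.
pose l v := \max_(p <- s | p.2 <= v) p.1.+1.
pose shared v := v \in map snd s.
pose gap v := [&& high, ~~ shared v & all (fun p => (p.2 <= v) == (p.1 <= z)) s].
pose base v := if gap v then z.+1 else l v.
pose F v := K * base v + (if shared v then 0 else v.+1).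
have lle p v : p \in s -> p.2 <= v -> p.1 < l v.
  by move=> ps pv; exact: (@leq_bigmax_seq _ s (fun p => p.2 <= v) (fun p => p.1.+1)).
have lmon v v' : v <= v' -> l v <= l v'.
  by move=> vv; apply/bigmax_leqP_seq => p ps pv; apply: lle ps (leq_trans pv vv).
have lsh p : p \in s -> l p.2 = p.1.+1.
  move=> ps; apply/eqP; rewrite eqn_leq; apply/andP; split; last exact: lle.
  by apply/bigmax_leqP_seq => q qs qp; rewrite ltnS (pat _ _ qs ps).
have shP v : shared v -> exists2 p, p \in s & v = p.2 by move/mapP.
have gapP v : gap v -> forall p, p \in s -> (p.2 <= v) = (p.1 <= z).
  by move=> /and3P [_ _ /allP h] p /h /eqP.
have lgap v : gap v -> l v <= z.+1.
  by move=> gv; apply/bigmax_leqP_seq => p ps; rewrite (gapP v gv p ps).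
have above v p : p \in s -> v < p.2 -> base v <= p.1.
  move=> ps vp; rewrite /base; case: ifP => gv.
    by rewrite ltnNge -(gapP v gv p ps) -ltnNge.
  by apply/bigmax_leqP_seq => q qs /= qv; rewrite ltnNge pat // -ltnNge (leq_ltn_trans qv vp).
have baseS v : l v <= base v by rewrite /base; case: ifP => // /lgap.
have bmon v v' : v < v' -> shared v' -> base v < base v'.
  move=> vv /shP [p ps ev]; apply: (leq_trans (n := p.1.+1)); first by rewrite ltnS above -?ev.
  by apply: leq_trans (baseS v'); rewrite ev lsh.
have bmon' v v' : v < v' -> base v <= base v'.
  move=> vv; case: (boolP (has (fun p => v < p.2 <= v') s)) => [/hasP [p ps /andP [vp pv]]|/hasPn none].
    by apply: leq_trans (above _ _ ps vp) _; apply: leq_trans (baseS v'); apply/ltnW/lle.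
  have same p : p \in s -> (p.2 <= v') = (p.2 <= v).
    by move=> ps; have /= := none p ps; case: (leqP p.2 v); case: (leqP p.2 v') => /=; lia.
  have [sv|sv] := boolP (shared v).
    apply: leq_trans (baseS v'); rewrite /base ifN; first exact/lmon/ltnW.
    by rewrite /gap sv /= andbF.
  have [sv'|sv'] := boolP (shared v').
    by have [p ps ev] := shP _ sv'; have := same p ps; lia.
  have -> : base v = base v'; last by [].
  rewrite /base; have -> : gap v = gap v'.
    by rewrite /gap sv sv'; congr andb; apply: eq_in_all => p /same ->.
  case: ifP => // _; rewrite /l big_seq_cond [RHS]big_seq_cond; apply: eq_bigl => p /=.
  by case ps: (p \in s) => //=; rewrite same.
have Fi v v' : v < v' -> v' < B -> F v < F v'.
  move=> vv vB; rewrite /F; case: (boolP (shared v')) => sv'.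
    have := bmon _ _ vv sv'; rewrite -(leq_pmul2l (isT : 0 < K)) mulnS.
    by rewrite /K; case: ifP; lia.
  have : K * base v <= K * base v' by rewrite leq_mul2l bmon' ?orbT.
  by case: ifP; lia.
have [E2 E2i E2F] := extend_increasing Fi.
exists (fun w => K * w.+1), E2; split=> //.
- by move=> x y xy; rewrite ltn_mul2l /K.
- move=> p ps; rewrite (E2F _ (sB p ps)) /F ifT; last by apply/mapP; exists p.
  by rewrite addn0 /base ifN ?lsh // /gap negb_and; apply/orP; right; rewrite negb_and negbK;
    apply/orP; left; apply/mapP; exists p.
- move=> v hi vB nsh gv; rewrite E2F // /F.
  have sv : ~~ shared v by apply/negP => /shP [p /nsh /eqP]; lia.
  by rewrite (negbTE sv) /base ifT; [lia|rewrite /gap hi sv; apply/allP => p /gv ->].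
- move=> v w vB zw sw; rewrite E2F // /F.
  have bw : base v <= w.
    rewrite /base; case: ifP => [/and3P [/zw //]|_].
    by apply/bigmax_leqP_seq => p ps /sw ->.
  have : K * base v <= K * w by rewrite leq_mul2l bw orbT.
  by rewrite mulnS /K; case: ifP; lia.
Qed.

Section Comparison.

Variable D : predilator.

Implicit Types (e : nat * seq nat) (h g : nat -> nat) (l : seq nat).

(* A pair [(s, l)] stands for the element [(s, a)] of an extension of [D],
   where [l] is the increasing enumeration of [a]; it becomes an element of
   the extension to the natural numbers under a valuation [h] that is
   monotone on [l]. *)
Definition element e : Prop :=
  dom (ob D (size e.2)) e.1 /\ supp D (size e.2) e.1 = [set: 'I_(size e.2)].

Definition mono h l : Prop :=
  forall i j, i < j -> j < size l -> h (nth 0 l i) < h (nth 0 l j).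

Definition realizes l h N (f : emb (size l) N) : Prop :=
  forall i, f i = h (nth 0 l i) :> nat.

Definition ble e h e' h' : Prop :=
  exists N (f : emb (size e.2) N) (f' : emb (size e'.2) N),
    [/\ realizes h f, realizes h' f' & le (ob D N) (mor D f e.1) (mor D f' e'.1)].

Lemma bounded_on h l : exists N, forall x, x \in l -> h x < N.
Proof.
exists (\max_(x <- l) h x).+1 => x xl.
exact: (@leq_bigmax_seq _ l xpredT h).
Qed.

Lemma realizes_exists h l N : mono h l -> (forall x, x \in l -> h x < N) ->
  exists f : emb (size l) N, realizes h f.
Proof.
move=> hl hN; apply: (emb_exists (u := fun i => h (nth 0 l i))); last exact: hl.
by move=> i il; apply/hN/mem_nth.
Qed.

Lemma realizes_comp l h N (f : emb (size l) N) (E : nat -> nat) N' (w : emb N N') :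
  realizes h f -> (forall i : 'I_N, w i = E i :> nat) -> realizes (E \o h) (emb_comp w f).
Proof. by move=> fh wE i; rewrite /= ffunE wE fh. Qed.

Lemma realizes_unique l h N (f f' : emb (size l) N) : realizes h f -> realizes h f' -> f = f'.
Proof. by move=> fh fh'; apply: emb_ext => i; rewrite fh fh'. Qed.

Lemma ble_rescale E e h e' h' : element e -> element e' -> increasing_fun E ->
  ble e h e' h' -> ble e (E \o h) e' (E \o h').
Proof.
move=> [de _] [de' _] Ei [N [f [f' [fh fh' lef]]]].
have [w wE] : exists w : emb N (E N), forall i : 'I_N, w i = E i :> nat.
  by apply: emb_exists => *; apply: Ei.
exists (E N), (emb_comp w f), (emb_comp w f'); split; [exact: realizes_comp..|].
by rewrite !mor_comp // -mor_le //; apply: mor_dom.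
Qed.

(** Both comparisons can be moved to a common target, and morphisms reflect the order, so the choice
    of [N] in [ble] does not matter. *)
Lemma ble_at e h e' h' N (f : emb (size e.2) N) (f' : emb (size e'.2) N) :
  element e -> element e' -> realizes h f -> realizes h' f' ->
  (le (ob D N) (mor D f e.1) (mor D f' e'.1) <-> ble e h e' h').
Proof.
move=> [de _] [de' _] fh fh'; split=> [lef|[N' [g [g' [gh gh' leg]]]]]; first by exists N, f, f'.
have [w wE] := emb_widen (leq_maxl N N'); have [w' wE'] := emb_widen (leq_maxr N N').
rewrite (mor_le w); [|exact: mor_dom..].
have cmp := fun l k M (u : emb (size l) M) M' => @realizes_comp l k M u id M'.
rewrite -!mor_comp // (realizes_unique (cmp _ _ _ _ _ _ fh wE) (cmp _ _ _ _ _ _ gh wE')).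
rewrite (realizes_unique (cmp _ _ _ _ _ _ fh' wE) (cmp _ _ _ _ _ _ gh' wE')) !mor_comp //.
by rewrite -mor_le //; apply: mor_dom.
Qed.

Lemma ble_ext e g h e' g' h' : {in e.2, g =1 h} -> {in e'.2, g' =1 h'} ->
  ble e g e' g' -> ble e h e' h'.
Proof.
move=> gh gh' [N [f [f' [fg fg' lef]]]]; exists N, f, f'; split=> // i.
  by rewrite fg gh // mem_nth.
by rewrite fg' gh' // mem_nth.
Qed.

Lemma mono_rescale E h l : increasing_fun E -> mono h l -> mono (E \o h) l.
Proof. by move=> Ei hl i j ij jl; apply/Ei/hl. Qed.

Lemma ble_total e h e' h' : element e -> element e' -> mono h e.2 -> mono h' e'.2 ->
  ble e h e' h' \/ ble e' h' e h.
Proof.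
move=> [de _] [de' _] hm hm'.
have [N hN] := bounded_on h e.2; have [N' hN'] := bounded_on h' e'.2.
have [x /hN|f fh] := @realizes_exists h e.2 (maxn N N') hm; first by lia.
have [x /hN'|f' fh'] := @realizes_exists h' e'.2 (maxn N N') hm'; first by lia.
have [lef|lef] := le_total (mor_dom f de) (mor_dom f' de'); [left|right].
  by exists (maxn N N'), f, f'.
by exists (maxn N N'), f', f.
Qed.

Lemma ble_trans e h e' h' e'' h'' : element e -> element e' -> element e'' ->
  mono h e.2 -> mono h' e'.2 -> mono h'' e''.2 ->
  ble e h e' h' -> ble e' h' e'' h'' -> ble e h e'' h''.
Proof.
move=> el el' el'' hm hm' hm''.
have [N hN] := bounded_on h e.2; have [N' hN'] := bounded_on h' e'.2.
have [N'' hN''] := bounded_on h'' e''.2.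
have [x /hN|f fh] := @realizes_exists h e.2 (N + N' + N'') hm; first by lia.
have [x /hN'|f' fh'] := @realizes_exists h' e'.2 (N + N' + N'') hm'; first by lia.
have [x /hN''|f'' fh''] := @realizes_exists h'' e''.2 (N + N' + N'') hm''; first by lia.
rewrite -(ble_at el el' fh fh') -(ble_at el' el'' fh' fh'') -(ble_at el el'' fh fh'').
exact: le_trans.
Qed.

Lemma ble_unrescale E e h e' h' : element e -> element e' -> mono h e.2 -> mono h' e'.2 ->
  increasing_fun E -> ble e (E \o h) e' (E \o h') -> ble e h e' h'.
Proof.
move=> el el' hm hm' Ei lef.
have [N hN] := bounded_on h e.2; have [N' hN'] := bounded_on h' e'.2.
have [x /hN|f fh] := @realizes_exists h e.2 (N + N') hm; first by lia.
have [x /hN'|f' fh'] := @realizes_exists h' e'.2 (N + N') hm'; first by lia.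
have [w wE] : exists w : emb (N + N') (E (N + N')), forall i : 'I_(N + N'), w i = E i :> nat.
  by apply: emb_exists => *; apply: Ei.
move: lef; rewrite -(ble_at el el' (realizes_comp fh wE) (realizes_comp fh' wE)).
rewrite -(ble_at el el' fh fh') !mor_comp ?(proj1 el) ?(proj1 el') // -?mor_le //;
by [apply: mor_dom; case: el|apply: mor_dom; case: el'|case: el|case: el'].
Qed.

Lemma ble_le e h h' : element e -> mono h e.2 -> mono h' e.2 ->
  (forall x, x \in e.2 -> h x <= h' x) -> ble e h e h'.
Proof.
move=> [de _] hm hm' hh'.
have [N hN] := bounded_on h e.2; have [N' hN'] := bounded_on h' e.2.
have [x /hN|f fh] := @realizes_exists h e.2 (N + N') hm; first by lia.
have [x /hN'|f' fh'] := @realizes_exists h' e.2 (N + N') hm'; first by lia.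
exists (N + N'), f, f'; split=> //; apply: mor_mono => // i.
by rewrite fh fh'; apply/hh'/mem_nth.
Qed.

(* Full support makes the values of [h] on [e.2] recoverable from the
   element that [h] defines. *)
Lemma ble_strict e h h' x : element e -> mono h e.2 -> mono h' e.2 ->
  (forall x, x \in e.2 -> h x <= h' x) -> x \in e.2 -> h x < h' x -> ~ ble e h' e h.
Proof.
move=> el hm hm' hh' xe hx le2; have le1 := ble_le el hm hm' hh'.
have [N hN] := bounded_on h e.2; have [N' hN'] := bounded_on h' e.2.
have [y /hN|f fh] := @realizes_exists h e.2 (N + N') hm; first by lia.
have [y /hN'|f' fh'] := @realizes_exists h' e.2 (N + N') hm'; first by lia.
move: le1 le2; rewrite -(ble_at el el fh fh') -(ble_at el el fh' fh) => le1 le2.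
have eqf := le_anti le1 le2; case: el => de se.
have eqs : f @: [set: 'I_(size e.2)] = f' @: [set: 'I_(size e.2)].
  by rewrite -se -!supp_natural // eqf.
have hhs : [seq val (f i) | i <- enum 'I_(size e.2)] = [seq val (f' i) | i <- enum 'I_(size e.2)].
  have srt (k : emb (size e.2) (N + N')) : sorted ltn [seq val (k i) | i <- enum 'I_(size e.2)].
    rewrite sorted_map; have : sorted ltn (map val (enum 'I_(size e.2))).
      by rewrite val_enum_ord iota_ltn_sorted.
    by rewrite sorted_map; apply: sub_sorted => i j /= /emb_lt.
  apply: (irr_sorted_eq ltn_trans ltnn) => // y.
  apply/mapP/mapP => -[i _ ->].
    have /imsetP [j _ ->] : f i \in f' @: [set: 'I_(size e.2)] by rewrite -eqs imset_f.
    by exists j; rewrite ?mem_enum.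
  have /imsetP [j _ ->] : f' i \in f @: [set: 'I_(size e.2)] by rewrite eqs imset_f.
  by exists j; rewrite ?mem_enum.
have ix : index x e.2 < size e.2 by rewrite index_mem.
have /eq_in_map/(_ (Ordinal ix)) := hhs; rewrite mem_enum => /(_ isT) /=.
by rewrite fh fh' /= nth_index //; lia.
Qed.

Lemma mono_lt h l x y : mono h l -> x \in l -> y \in l -> (h x < h y) = (index x l < index y l).
Proof.
move=> hl xl yl; have hx : nth 0 l (index x l) = x by apply: nth_index.
have hy : nth 0 l (index y l) = y by apply: nth_index.
apply/idP/idP => [|lt]; last by rewrite -{1}hx -{1}hy hl // index_mem.
apply: contraTT; rewrite -!leqNgt leq_eqVlt => /orP [/eqP e|lt].
  by rewrite -hx -hy e.
by rewrite -{1}hx -{1}hy ltnW // hl // index_mem.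
Qed.

Lemma mono_le h l x y : mono h l -> x \in l -> y \in l -> (h x <= h y) = (index x l <= index y l).
Proof. by move=> hl xl yl; rewrite leqNgt (mono_lt hl) // -leqNgt. Qed.

Lemma mono_inj h l x y : mono h l -> x \in l -> y \in l -> h x = h y -> x = y.
Proof.
move=> hl xl yl e; have := mono_le hl xl yl; have := mono_le hl yl xl; rewrite e leqnn.
move=> h1 h2; have : index x l = index y l by lia.
by move=> ei; rewrite -(nth_index 0 xl) -(nth_index 0 yl) ei.
Qed.

(** When all coordinates are declared shared, the amalgam turns both pairs of valuations into the
    same one. *)
Lemma ble_pattern e e' h h' g g' : element e -> element e' ->
  mono h e.2 -> mono h' e'.2 -> mono g e.2 -> mono g' e'.2 ->
  (forall x y, x \in e.2 -> y \in e'.2 -> (h x <= h' y) = (g x <= g' y)) ->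
  (forall x y, x \in e.2 -> y \in e'.2 -> (h' y <= h x) = (g' y <= g x)) ->
  ble e h e' h' -> ble e g e' g'.
Proof.
move=> el el' hm hm' gm gm' pat pat' lef.
pose s := [seq (h x, g x) | x <- e.2] ++ [seq (h' y, g' y) | y <- e'.2].
have [B gB] := bounded_on g e.2; have [B' gB'] := bounded_on g' e'.2.
have [||E1 [E2 [E1i E2i E _ _]]] := @amalgam s false 0 (B + B').
- move=> p q; rewrite !mem_cat => /orP [|] /mapP [x xe ->] /orP [|] /mapP [y ye ->] /=.
  + by rewrite !(mono_le _ xe ye).
  + exact: pat.
  + exact: pat'.
  + by rewrite !(mono_le _ xe ye).
- move=> p; rewrite mem_cat => /orP [|] /mapP [x xe ->] /=; first by have := gB x xe; lia.
  by have := gB' x xe; lia.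
apply: (ble_unrescale el el' gm gm' E2i).
apply: ble_ext (ble_rescale el el' E1i lef) => x xe /=.
  by apply: (E (h x, g x)); rewrite mem_cat map_f.
by apply: (E (h' x, g' x)); rewrite mem_cat [X in _ || X]map_f ?orbT.
Qed.

Lemma max_exists (T : eqType) (r : T -> T -> Prop) (s : seq T) x0 : x0 \in s ->
  {in s &, forall x y, r x y \/ r y x} ->
  {in s & &, forall x y z, r x y -> r y z -> r x z} ->
  exists2 x, x \in s & forall y, y \in s -> r y x.
Proof.
move=> x0s tot tr; suff main : forall (t : seq T) x0, {subset t <= s} -> x0 \in t ->
    exists2 x, x \in t & forall y, y \in t -> r y x by exact: main x0s.
have rr x : x \in s -> r x x by move=> xs; case: (tot x x xs xs).
move=> {x0s x0}; elim=> // a t IHt _ sub _; have as_ : a \in s by apply: sub; rewrite mem_head.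
have subt : {subset t <= s} by move=> u ut; apply: sub; rewrite in_cons ut orbT.
case: t IHt subt {sub} => [|b t] IHt subt.
  exists a; first exact: mem_head.
  by move=> y; rewrite mem_seq1 => /eqP ->; apply: rr.
have [x xt hx] := IHt b subt (mem_head _ _).
have [ax|xa] := tot a x as_ (subt _ xt).
  exists x; first by rewrite in_cons xt orbT.
  by move=> y; rewrite in_cons => /orP [/eqP -> //|]; apply: hx.
exists a; first exact: mem_head.
move=> y; rewrite in_cons => /orP [/eqP ->|yt]; first exact: rr.
exact: (tr _ _ _ (subt _ yt) (subt _ xt) as_ (hx _ yt) xa).
Qed.

(* Among the coordinates outside of [P], one dominates all the others: let it
   be the one whose increase by a small amount yields the largest element.
   Any finite decrease of other coordinates can then be made one coordinate
   at a time, each compensated by a small increase of the dominating one. *)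
Lemma top_coordinate e (P : seq nat) x0 : element e -> uniq e.2 -> x0 \in e.2 -> x0 \notin P ->
  exists x, [/\ x \in e.2, x \notin P & forall h g, mono h e.2 -> mono g e.2 ->
    {in P, h =1 g} -> h x < g x -> ~ ble e g e h].
Proof.
move=> el ul x0l x0P; set l := e.2 in x0l ul *.
(* Doubling leaves room to raise [x] alone by one without reaching the next coordinate. *)
pose d x u := 2 * index u l + (u == x).
have dm x : mono (d x) l.
  by move=> i j ij jl; rewrite /d !index_uniq //; [lia|exact: ltn_trans jl].
have [|x y _ _|x y z _ _ _|x xs xmax] :=
    @max_exists _ (fun y x => ble e (d y) e (d x)) [seq u <- l | u \notin P] x0.
- by rewrite mem_filter x0P.
- exact: ble_total.
- exact: ble_trans.
move: xs; rewrite mem_filter => /andP [xP xl]; exists x; split=> // h g hm gm hg hx.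
(* At the first [k] positions [h] is already at most [g]. Once this holds everywhere, [ble_strict]
   applies. *)
suff main : forall n k h g, k + n = size l -> mono h l -> mono g l -> {in P, h =1 g} -> h x < g x ->
    (forall i, i < k -> h (nth 0 l i) <= g (nth 0 l i)) -> ~ ble e g e h.
  exact: (main (size l) 0).
elim=> [|n IHn] k {hm gm hg hx}h {}g kn hm gm hg hx hk.
  apply: (ble_strict el hm gm _ xl hx) => u ul'; rewrite -(nth_index 0 ul'); apply: hk.
  by rewrite -[k]addn0 kn index_mem.
have kl : k < size l by lia.
have [hgk|hgk] := leqP (h (nth 0 l k)) (g (nth 0 l k)).
  apply: (IHn k.+1) => //; first by lia.
  by move=> i; rewrite ltnS leq_eqVlt => /orP [/eqP -> //|]; apply: hk.
set y := nth 0 l k in hgk; have yl : y \in l by apply: mem_nth.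
have yx : y != x by apply: contraTneq hgk => ->; rewrite -leqNgt ltnW.
have yP : y \notin P by apply: contraTN hgk => /hg ->; rewrite ltnn.
have iy : index y l = k by apply: index_uniq.
have ey : nth 0 l k = y by [].
clearbody y.
(* One exchange on the doubled scale: [y] drops to its value under [g] and [x] rises by one.
   Compared with [2 * h], the pattern is that of [d x] compared with [d y], so by the maximality of
   [x] the element does not decrease. *)
pose h2 u := if u == x then 2 * h x + 1 else if u == y then 2 * g y else 2 * h u.
have h2k u v : u \in l -> v \in l -> index u l < index v l -> 2 * h u < h2 v /\ h2 u < 2 * h v /\ h2 u < h2 v.
  move=> uL vL iuv; have := mono_lt hm uL vL; have := mono_lt gm uL vL; rewrite iuv.
  have hu : index u l < k -> h u <= g u by move=> ik; rewrite -(nth_index 0 uL); apply: hk.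
  have hv : index v l < k -> h v <= g v by move=> ik; rewrite -(nth_index 0 vL); apply: hk.
  rewrite /h2; case: (eqVneq u x) => [eu|nu]; case: (eqVneq v x) => [ev|nv].
  - by rewrite eu ev ltnn in iuv.
  - by rewrite eu in iuv hu hv *; case: (eqVneq v y) => [ev'|nv']; rewrite ?ev' in iuv hv *; lia.
  - by rewrite ev in iuv hu hv *; case: (eqVneq u y) => [eu'|nu']; rewrite ?eu' in iuv hu *; lia.
  case: (eqVneq u y) => [eu'|nu']; case: (eqVneq v y) => [ev'|nv'].
  - by rewrite eu' ev' ltnn in iuv.
  - by rewrite eu' in iuv *; lia.
  - by rewrite ev' in iuv *; lia.
  - by lia.
have h2m : mono h2 l.
  move=> i j ij jl; have il := ltn_trans ij jl.
  by case: (h2k (nth 0 l i) (nth 0 l j)) => [| | |_ [_ ]]; rewrite ?mem_nth // !index_uniq.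
pose E u := 2 * u; have Ei : increasing_fun E by rewrite /E => ? ?; lia.
have hm2 := mono_rescale Ei hm; have gm2 := mono_rescale Ei gm.
have le2 : ble e (E \o h) e h2.
  have lexy : ble e (d y) e (d x) by apply: xmax; rewrite mem_filter yP.
  have cmp u v : u \in l -> v \in l ->
      (d y u <= d x v) = (E (h u) <= h2 v) /\ (d x v <= d y u) = (h2 v <= E (h u)).
    move=> uL vL; rewrite /d /E; case: (ltngtP (index u l) (index v l)) => [iuv|ivu|eqi].
    - by have := h2k u v uL vL iuv; case: (u == y); case: (v == x); lia.
    - by have := h2k v u vL uL ivu; case: (u == y); case: (v == x); lia.
    - have -> : v = u by rewrite -(nth_index 0 uL) -(nth_index 0 vL) eqi.
      rewrite /h2; case: (eqVneq u x) => [ux|ux].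
        by rewrite ux eq_sym (negbTE yx); lia.
      by case: (eqVneq u y) => [->|_]; lia.
  by apply: (ble_pattern el el (dm y) (dm x)) lexy => // u v uL vL; have [] := cmp u v uL vL.
move=> le1; have le3 := ble_rescale el el Ei le1.
apply: (IHn k.+1 h2 (E \o g)) (ble_trans el el el gm2 hm2 h2m le3 le2) => //; first by lia.
- move=> u uP; rewrite /h2 /E /= -(hg u uP).
  case: (eqVneq u x) => [eu|_]; first by rewrite eu (negbTE xP) in uP.
  by case: (eqVneq u y) => [eu|//]; rewrite eu (negbTE yP) in uP.
- by rewrite /h2 eqxx /E /=; lia.
- move=> i ik; rewrite /h2 /E /=; case: (eqVneq _ x) => [->|_]; first by lia.
  case: (eqVneq _ y) => [->//|ne]; move: ik; rewrite ltnS leq_eqVlt => /orP [/eqP ei|/hk]; last by lia.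
  by rewrite ei ey eqxx in ne.
Qed.

Definition top (P : seq nat) e x : Prop := [/\ x \in e.2, x \notin P & forall h g, mono h e.2 -> mono g e.2 ->
  {in P, h =1 g} -> h x < g x -> ~ ble e g e h].

Lemma top_or_none e (P : seq nat) : element e -> uniq e.2 ->
  {subset e.2 <= P} \/ exists x, top P e x.
Proof.
move=> el ul; have [/allP ?|/allPn [x xl xP]] := boolP (all [in P] e.2); first by left.
by right; apply: top_coordinate el ul xl xP.
Qed.

(** Here [e'] stays below [e] however the coordinates outside of [P] are placed; the valuations need
    not come from a common order on all coordinates. *)
Definition prec (P : seq nat) e' e : Prop := forall h h', mono h e.2 -> mono h' e'.2 ->
  {in P, h =1 h'} -> ~ ble e h e' h'.

Lemma not_ble e h e' h' : element e -> element e' -> mono h e.2 -> mono h' e'.2 ->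
  ~ ble e h e' h' -> ble e' h' e h.
Proof. by move=> el el' hm hm' nle; case: (ble_total el el' hm hm'). Qed.

Lemma amalgam_on (P l : seq nat) (high : bool) z B h g : {subset P <= l} -> mono h l -> mono g l ->
  exists E1 E2, [/\ increasing_fun E1, increasing_fun E2,
    forall p, p \in P -> E1 (h p) = E2 (g p),
    forall x, high -> g x < B -> x \in l -> x \notin P -> z = h x -> E1 z < E2 (g x)
  & forall v w, v < B -> (high -> z < w) ->
      (forall p, p \in P -> g p <= v -> h p < w) -> E2 v < E1 w].
Proof.
move=> Pl hm gm; have [B' gB] := bounded_on g P.
have [p q /mapP [u uP ->] /mapP [v vP ->] /=|p /mapP [u uP ->] /=|E1 [E2 [i1 i2 E hi lo]]] :=
  @amalgam [seq (h p, g p) | p <- P] high z (B + B').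
- by rewrite !(mono_le _ (Pl _ uP) (Pl _ vP)).
- by have := gB u uP; lia.
exists E1, E2; split=> //.
- by move=> p pP; apply: (E (h p, g p)); apply: (map_f (fun p => (h p, g p))).
- move=> x high' gx xl xP ez; apply: hi => //; first by lia.
    move=> p /mapP [u uP ->] /=; apply/eqP => /(mono_inj gm (Pl _ uP) xl) eu.
    by rewrite -eu uP in xP.
  by move=> p /mapP [u uP ->] /=; rewrite ez !(mono_le _ (Pl _ uP) xl).
- move=> v w vB zw vw; apply: lo => //; first by lia.
  by move=> p /mapP [u uP ->] /=; apply: vw.
Qed.

(* If [h x < h' y] and [ble e' h' e h], push the valuations of the other
   comparison into the gap between [h x] and [h' y]. *)
Lemma cross e e' P x y h0 h0' : element e -> element e' ->
  {subset P <= e.2} -> {subset P <= e'.2} -> top P e x -> top P e' y ->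
  mono h0 e.2 -> mono h0' e'.2 -> {in P, h0 =1 h0'} -> ble e h0 e' h0' ->
  forall h h', mono h e.2 -> mono h' e'.2 -> {in P, h =1 h'} -> h x < h' y -> ~ ble e' h' e h.
Proof.
move=> el el' Pl Pl' [xl xP tx] [yl yP ty] m0 m0' ag0 le0 h h' hm hm' ag hxy le1.
have [E1 [E2 [i1 i2 E hi lo]]] := @amalgam_on P e.2 true (h x) (h0 x + h0' y).+1 h h0 Pl hm m0.
have xlt : E1 (h x) < E2 (h0 x) by apply: hi => //; lia.
have ylt : E2 (h0' y) < E1 (h' y).
  apply: lo => //; first by lia.
  move=> p pP; rewrite ag0 // ag // (mono_le m0' (Pl' _ pP) yl) (mono_lt hm' (Pl' _ pP) yl).
  rewrite leq_eqVlt => /orP [/eqP ei|//]; suff ep : p = y by rewrite -ep pP in yP.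
  by rewrite -(nth_index 0 (Pl' _ pP)) ei nth_index.
apply: (ty (E2 \o h0') (E1 \o h')) => //; try exact: mono_rescale.
  by move=> p pP; rewrite /= -ag // E // ag0.
have le2 := ble_rescale el' el i1 le1; have le3 := ble_rescale el el' i2 le0.
have le4 : ble e (E1 \o h) e (E2 \o h0).
  have [//|le5] := ble_total el el (mono_rescale i1 hm) (mono_rescale i2 m0).
  case: (tx _ _ (mono_rescale i1 hm) (mono_rescale i2 m0) _ xlt le5) => p pP.
  exact: E.
apply: (ble_trans el' el el') (ble_trans el' el el _ _ _ le2 le4) le3; exact: mono_rescale.
Qed.

Lemma ble_shared e (P : seq nat) h g : element e -> {subset e.2 <= P} -> mono h e.2 ->
  {in P, h =1 g} -> ble e h e g.
Proof.
move=> el lP hm hg; have : ble e h e h by case: (ble_total el el hm hm).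
by apply: ble_ext => // x /lP; apply: hg.
Qed.

Lemma low_amalgam (P l : seq nat) h g : {subset P <= l} -> mono h l -> mono g l ->
  exists E1 E2, [/\ increasing_fun E1, increasing_fun E2,
    forall p, p \in P -> E1 (h p) = E2 (g p)
  & forall x, x \in l -> x \notin P -> E2 (g x) < E1 (h x)].
Proof.
move=> Pl hm gm; have [B gB] := bounded_on g l.
have [E1 [E2 [i1 i2 E _ lo]]] := @amalgam_on P l false 0 B h g Pl hm gm.
exists E1, E2; split=> // x xl xP; apply: lo => //; first exact: gB.
move=> p pP; rewrite (mono_le gm (Pl _ pP) xl) (mono_lt hm (Pl _ pP) xl).
rewrite leq_eqVlt => /orP [/eqP ei|//]; suff ep : p = x by rewrite -ep pP in xP.
by rewrite -(nth_index 0 (Pl _ pP)) ei nth_index.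
Qed.

(** As [e] depends on the shared coordinates only, the two comparisons can be chained through it.
    They would put [e'] with a larger value at [y] below [e'] with a smaller one, against the
    dominance of [y]. *)
Lemma cross_none e e' (P : seq nat) y h0 h0' h1 h1' : element e -> element e' ->
  {subset P <= e.2} -> {subset P <= e'.2} -> {subset e.2 <= P} -> top P e' y ->
  mono h0 e.2 -> mono h0' e'.2 -> {in P, h0 =1 h0'} -> ble e h0 e' h0' ->
  mono h1 e.2 -> mono h1' e'.2 -> {in P, h1 =1 h1'} -> ~ ble e' h1' e h1.
Proof.
move=> el el' Pl Pl' lP [yl yP ty] m0 m0' ag0 le0 m1 m1' ag1 le1.
have [E1 [E2 [i1 i2 E lo]]] := low_amalgam Pl' m1' m0'.
have le2 := ble_rescale el' el i1 le1; have le3 := ble_rescale el el' i2 le0.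
have EP : {in P, E1 \o h1 =1 E2 \o h0} by move=> p pP /=; rewrite ag1 // E // ag0.
have le4 := ble_shared el lP (mono_rescale i1 m1) EP.
have n1 := mono_rescale i1 m1'; have n0 := mono_rescale i2 m0'.
have n1' := mono_rescale i1 m1; have n0' := mono_rescale i2 m0.
apply: (ty _ _ n0 n1 _ (lo y yl yP)); first by move=> p pP; rewrite /= E.
by apply: (ble_trans el' el el') (ble_trans el' el el _ _ _ le2 le4) le3.
Qed.

(* A [prec]-minimal [e0] is a lower bound for [prec] along any sequence that
   decreases from it. *)
Lemma not_prec e0 e e' P h0 h k0 k : element e0 -> element e -> element e' -> uniq e0.2 ->
  {subset P <= e0.2} -> {subset P <= e.2} -> mono h0 e0.2 -> mono h e'.2 -> {in P, h0 =1 h} ->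
  ble e0 h0 e' h -> mono k0 e0.2 -> mono k e.2 -> {in P, k0 =1 k} -> ~ ble e0 k0 e k ->
  ~ prec P e' e.
Proof.
move=> el0 el el' u0 Pl0 Pl m0 m ag le0 n0 n ag' le1 pr.
have [E1 [E2 [i1 i2 E lo]]] := low_amalgam Pl0 m0 n0.
have M0 := mono_rescale i1 m0; have M := mono_rescale i1 m.
have N0 := mono_rescale i2 n0; have N := mono_rescale i2 n.
have EP : {in P, E2 \o k0 =1 E1 \o h0} by move=> p pP /=; rewrite E.
have le2 := ble_rescale el0 el' i1 le0.
have le3 : ble e' (E1 \o h) e (E2 \o k).
  by apply: not_ble => //; apply: pr => // p pP; rewrite /= -ag // -ag' // E.
have nle4 : ~ ble e0 (E2 \o k0) e (E2 \o k) by move=> /(ble_unrescale el0 el n0 n i2).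
have le4 := not_ble el0 el N0 N nle4.
have le5 := ble_trans el0 el' el M0 M N le2 le3.
apply: nle4; apply: (ble_trans el0 el0 el N0 M0 N _ le5).
have [lP|[x [xl xP tx]]] := top_or_none P el0 u0; first exact: ble_shared EP.
by apply: not_ble => //; apply: tx => //; apply: lo.
Qed.

End Comparison.

(** * The coded extension of a coded predilator *)

Lemma finite_choice k (R : nat -> nat -> Prop) : (forall i, i < k -> exists x, R i x) ->
  exists u : nat -> nat, forall i, i < k -> R i (u i).
Proof.
move=> h; have h' i : exists x, i < k -> R i x.
  by have [/h [x hx]|_] := ltnP i k; [exists x|exists 0].
by have [u hu] := choice h'; exists u.
Qed.

Section Coded.

Variable D : predilator.

Lemma code_leE n s t : s_dle (code D) n s t <-> le (ob D n) s t.
Proof.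
split; last exact: code_le.
rewrite /s_dle; move eqc : (pair_code 0 _) => c h; case: h eqc => {c} [n' s' t' h|m n' f s' h|n' s' h].
- by move=> /pair_code_inj [_ /pair_code_inj [-> /pair_code_inj [-> ->]]].
- by move=> /pair_code_inj [].
- by move=> /pair_code_inj [].
Qed.

Lemma code_morE m n f s t : s_dmor (code D) m n f s t <->
  exists F : emb m n, [/\ emb_code F = f, dom (ob D m) s & t = mor D F s].
Proof.
split=> [|[F [<- ds ->]]]; last exact: code_mor.
rewrite /s_dmor; move eqc : (pair_code 1 _) => c h; case: h eqc => {c} [n' s' t' h|m' n' F s' h|n' s' h].
- by move=> /pair_code_inj [].
- move=> /pair_code_inj [_ /pair_code_inj [/pair_code_inj [em /pair_code_inj [en ->]] /pair_code_inj [-> ->]]].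
  by rewrite em en; exists F.
- by move=> /pair_code_inj [].
Qed.

Lemma code_suppE n s a : s_dsupp (code D) n s a <-> dom (ob D n) s /\ a = set_code (supp D n s).
Proof.
split=> [|[ds ->]]; last exact: code_supp.
rewrite /s_dsupp; move eqc : (pair_code _ _) => c h; case: h eqc => {c} [n' s' t' h|m' n' F s' h|n' s' h].
- by move=> /pair_code_inj [].
- by move=> /pair_code_inj [].
- by move=> /pair_code_inj [_ /pair_code_inj [-> /pair_code_inj [-> ->]]].
Qed.

Lemma emb_code_inj m n (F G : emb m n) : emb_code F = emb_code G -> F = G.
Proof.
move=> e; apply: emb_ext => i.
have : bit (pair_code i (F i)) (emb_code G) by rewrite -e; apply/bit_emb_code; exists i.
by move/bit_emb_code => [k [ik ->]]; have -> : k = i by apply: val_inj.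
Qed.

Lemma s_embE m n f : s_emb m n f <-> exists F : emb m n, emb_code F = f.
Proof.
split=> [[hp [hd [hf hi]]]|[F <-]].
  have [u hu] := finite_choice hd.
  have un i : i < m -> u i < n.
    by move=> /hu /hp [i' [j [/pair_code_inj [_ ->] []]]].
  have [|F Fu] := emb_exists un; first by move=> i j ij jm; exact: hi (hu _ (ltn_trans ij jm)) (hu _ jm) ij.
  exists F; apply: bit_inj => c; apply/idP/idP.
    by move=> /bit_emb_code_pair [k ->]; rewrite Fu; apply/s_memE/hu.
  move=> /s_memE hc; have [i [j [ec [im jn]]]] := hp c hc; rewrite ec in hc *.
  apply/bit_emb_code; exists (Ordinal im); split=> //=.
  by rewrite Fu; apply: (hf i) hc _; apply: hu.
split=> [c /s_memE /bit_emb_code_pair [k ->]|].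
  by exists k, (F k); split=> //; split; apply: ltn_ord.
split=> [i im|].
  by exists (F (Ordinal im)); apply/s_memE/bit_emb_code; exists (Ordinal im).
split=> [i j k /s_memE /bit_emb_code [x [ix ->]] /s_memE /bit_emb_code [y [iy ->]]|].
  by have -> : x = y by apply: val_inj; rewrite /= -ix -iy.
move=> i i' j j' /s_memE /bit_emb_code [x [-> ->]] /s_memE /bit_emb_code [y [-> ->]].
exact: emb_lt.
Qed.

Variable X : set_of_nat.
Hypothesis X_linear : s_linear (s_le X).

Definition chain (l : seq nat) : Prop :=
  forall i j, i < j -> j < size l -> s_lt_ord X (nth 0 l i) (nth 0 l j).

Definition lists (l : seq nat) (a : nat) : Prop := forall x, s_mem x a <-> x \in l.

Lemma s_lt_trans x y z : s_lt_ord X x y -> s_lt_ord X y z -> s_lt_ord X x z.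
Proof.
move=> [xy nxy] [yz nyz]; have [_ [_ [tr _]]] := X_linear x y.
split; first exact: tr xy yz.
by move=> exz; rewrite -exz in yz; have [_ [an _]] := X_linear x y; apply: nxy; apply: an.
Qed.

Lemma s_lt_irr x : ~ s_lt_ord X x x.
Proof. by case. Qed.

Lemma s_lt_total x y : s_le X x x -> s_le X y y -> x <> y -> s_lt_ord X x y \/ s_lt_ord X y x.
Proof.
move=> dx dy nxy; have [_ [_ [_ tot]]] := X_linear x y.
by case: (tot dx dy) => ?; [left|right; split=> // /esym].
Qed.

Lemma chain_sorted l : chain l -> sorted (fun x y => `[< s_lt_ord X x y >]) l.
Proof. by move=> cl; apply/(sortedP 0) => i il; apply/asboolP/cl. Qed.

Lemma chain_unique l l' : chain l -> chain l' -> l =i l' -> l = l'.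
Proof.
move=> /chain_sorted sl /chain_sorted sl' ll.
apply: (@irr_sorted_eq _ (fun x y => `[< s_lt_ord X x y >])) => //.
- by move=> y x z /asboolP xy /asboolP yz; apply/asboolP/(s_lt_trans xy yz).
- by move=> x; apply/asboolP/s_lt_irr.
Qed.

Lemma chain_uniq l : chain l -> uniq l.
Proof.
move=> /chain_sorted sl; apply: (@sorted_uniq _ (fun x y => `[< s_lt_ord X x y >])) => //.
- by move=> y x z /asboolP xy /asboolP yz; apply/asboolP/(s_lt_trans xy yz).
- by move=> x; apply/asboolP/s_lt_irr.
Qed.

Lemma chain_exists (s : seq nat) : (forall x, x \in s -> s_le X x x) ->
  exists2 l, chain l & l =i s.
Proof.
move=> ds; pose r x y := `[< s_le X x y >].
have rtot : {in mem s &, total r}.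
  move=> x y xs ys; have [_ [_ [_ tot]]] := X_linear x y.
  by case: (tot (ds x xs) (ds y ys)) => h; apply/orP; [left|right]; apply/asboolP.
have rtr : transitive r.
  move=> y x z /asboolP xy /asboolP yz; apply/asboolP.
  by have [_ [_ [tr _]]] := X_linear x y; apply: tr xy yz.
have ss : sorted r (sort r (undup s)).
  by apply: (sort_sorted_in rtot); apply/allP => x; rewrite mem_undup.
exists (sort r (undup s)); last by move=> x; rewrite mem_sort mem_undup.
have us : uniq (sort r (undup s)) by rewrite sort_uniq undup_uniq.
move=> i j ij jl; have il := ltn_trans ij jl; split.
  by apply/asboolP; apply: (sorted_ltn_nth rtr 0 ss).
by apply/eqP; rewrite nth_uniq //; lia.
Qed.

Definition monoX (h : nat -> nat) (l : seq nat) : Prop :=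
  forall x y, x \in l -> y \in l -> s_lt_ord X x y -> h x < h y.

Lemma monoX_mono h l l' : chain l -> {subset l <= l'} -> monoX h l' -> mono h l.
Proof.
move=> cl ll hl i j ij jl; apply: hl; last exact: cl.
  by apply/ll/mem_nth/(ltn_trans ij jl).
exact/ll/mem_nth.
Qed.

Lemma index_monoX l : chain l -> (forall x, x \in l -> s_le X x x) -> monoX (index^~ l) l.
Proof.
move=> cl dl x y xl yl xy; rewrite ltnNge leq_eqVlt; apply/negP => /orP [/eqP e|lt].
  have e' : x = y by rewrite -(nth_index 0 xl) -(nth_index 0 yl) e.
  by rewrite e' in xy; apply: s_lt_irr xy.
have := cl _ _ lt; rewrite index_mem xl !nth_index // => /(_ isT) yx.
exact: (s_lt_irr (s_lt_trans xy yx)).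
Qed.

Lemma monoX_leq h g l x y : (forall x, x \in l -> s_le X x x) -> monoX h l -> monoX g l ->
  x \in l -> y \in l -> (h x <= h y) = (g x <= g y).
Proof.
move=> dl hm gm xl yl; have [->|/eqP nxy] := eqVneq x y; first by rewrite !leqnn.
have [xy|yx] := s_lt_total (dl x xl) (dl y yl) nxy.
  by have := hm _ _ xl yl xy; have := gm _ _ xl yl xy; lia.
by have := hm _ _ yl xl yx; have := gm _ _ yl xl yx; lia.
Qed.

Lemma enumerates_list k e a : s_enumerates X k e a -> exists l,
  [/\ size l = k, chain l, lists l a
    & forall i x, s_mem (pair_code i x) e <-> i < k /\ x = nth 0 l i].
Proof.
move=> [hp [hd [hs [hf hi]]]]; have [u hu] := finite_choice hd.
have eE i x : s_mem (pair_code i x) e <-> i < k /\ x = nth 0 (mkseq u k) i.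
  split=> [h|[ik ->]]; last by rewrite nth_mkseq //; apply: hu.
  have [i' [x' [/pair_code_inj [ei _] [ik _]]]] := hp _ h; rewrite -ei in ik.
  by split=> //; rewrite nth_mkseq //; apply: (hf i) h (hu _ ik).
exists (mkseq u k); rewrite size_mkseq; split=> //.
  move=> i j ij; rewrite size_mkseq => jk; have ik := ltn_trans ij jk.
  by rewrite !nth_mkseq //; apply: (hi i j) (hu _ ik) (hu _ jk) ij.
move=> x; split=> [/hs [i /eE [ik ->]]|/(nthP 0) [i]]; first by rewrite mem_nth ?size_mkseq.
rewrite size_mkseq => ik <-; rewrite nth_mkseq //.
by have [i' [x' [/pair_code_inj [_ ->] []]]] := hp _ (hu i ik).
Qed.

Lemma list_enumerates l a : chain l -> lists l a -> exists e,
  s_enumerates X (size l) e a /\ forall i x, s_mem (pair_code i x) e <-> i < size l /\ x = nth 0 l i.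
Proof.
move=> cl la; pose e := finite_code [seq pair_code i (nth 0 l i) | i <- iota 0 (size l)].
have eP c : s_mem c e <-> exists2 i, i < size l & c = pair_code i (nth 0 l i).
  rewrite s_memE bit_finite_code; split=> [/mapP [i]|[i il ->]].
    by rewrite mem_iota add0n /= => il ->; exists i.
  by apply: map_f; rewrite mem_iota.
have eE i x : s_mem (pair_code i x) e <-> i < size l /\ x = nth 0 l i.
  by rewrite eP; split=> [[j jl /pair_code_inj [-> ->]]|[il ->]]; [|exists i].
exists e; split=> //; split=> [c /eP [i il ->]|].
  by exists i, (nth 0 l i); split=> //; split=> //; apply/la/mem_nth.
split=> [i il|]; first by exists (nth 0 l i); apply/eE.
split=> [x /la xl|]; first by exists (index x l); apply/eE; rewrite index_mem nth_index.
split=> [i x y /eE [_ ->] /eE [_ ->] //|i j x y /eE [_ ->] /eE [jl ->] ij].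
exact: cl.
Qed.

Lemma lists_exists l : exists a, lists l a.
Proof. by exists (finite_code l) => x; rewrite s_memE bit_finite_code. Qed.

Definition codes_element (e : nat * seq nat) (c : nat) : Prop :=
  [/\ element D e, chain e.2, forall x, x \in e.2 -> s_le X x x
    & exists2 a, lists e.2 a & c = pair_code e.1 a].

Lemma bar_dom_element s a : s_bar_dom (code D) X s a <->
  exists e, codes_element e (pair_code s a).
Proof.
split=> [[da [k [e [/enumerates_list [l [sl cl la _]] [ds [b [hb bk]]]]]]]|].
  exists (s, l); split=> //; last by exists a.
    move/code_suppE: hb => [dom_s eb]; rewrite -sl in dom_s eb bk *.
    split=> //=; apply/setP => i; rewrite [RHS]inE; apply/idP.
    have /s_memE : s_mem i b by apply/bk.
    rewrite eb => /bit_set_code [j ja ij].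
    by have -> : i = j by apply: val_inj.
  by move=> x xl; apply/da/la.
move=> [[s' l] [[/= ds ss] cl dl [a' la /pair_code_inj [/= es ea]]]]; subst s' a'.
split=> [y /la/dl //|]; have [e [he _]] := list_enumerates cl la.
exists (size l), e; split=> //; split; first exact/code_leE.
exists (set_code (supp D (size l) s)); split; first exact/code_suppE.
move=> i; rewrite s_memE bit_set_code ss; split=> [[j _ ->] //|il].
by exists (Ordinal il).
Qed.

Lemma inclusion_emb l l' a b f : chain l -> chain l' -> lists l a -> lists l' b ->
  s_inclusion_morphism X a b (size l) (size l') f ->
  exists2 F : emb (size l) (size l'), emb_code F = f & realizes (l := l) (index^~ l') F.
Proof.
move=> cl cl' la lb [/s_embE [F Ff] [ea [eb [/enumerates_list [m [sm cm ma me]]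
  [/enumerates_list [m' [sm' cm' mb me']] h]]]]].
have em : m = l by apply: chain_unique => // x; apply/idP/idP => [/ma/la|/la/ma].
have em' : m' = l' by apply: chain_unique => // x; apply/idP/idP => [/mb/lb|/lb/mb].
subst m m'; exists F => // i.
have hf : s_mem (pair_code i (F i)) f by apply/s_memE; rewrite -Ff; apply/bit_emb_code; exists i.
have /me' [_ ->] := h _ _ _ hf (proj2 (me i _) (conj (ltn_ord i) erefl)).
by rewrite index_uniq // chain_uniq.
Qed.

Lemma emb_inclusion l l' a b (F : emb (size l) (size l')) : chain l -> chain l' ->
  lists l a -> lists l' b -> {subset l <= l'} -> realizes (l := l) (index^~ l') F ->
  s_inclusion_morphism X a b (size l) (size l') (emb_code F).
Proof.
move=> cl cl' la lb ll hF; split; first by apply/s_embE; exists F.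
have [ea [hea ea_]] := list_enumerates cl la; have [eb [heb eb_]] := list_enumerates cl' lb.
exists ea, eb; split=> //; split=> // i j x /s_memE /bit_emb_code [k [-> ->]] /ea_ [_ ->].
apply/eb_; split; first exact: ltn_ord.
by rewrite hF nth_index //; apply/ll/mem_nth.
Qed.

(** By [ble_pattern] only the order pattern of the coordinates counts, so the enumeration of the
    union in the coded definition may be replaced by any monotone valuation. *)
Lemma bar_leE e e' c c' : codes_element e c -> codes_element e' c' ->
  s_bar_le (code D) X c c' <-> exists2 h, monoX h (e.2 ++ e'.2) & ble D e h e' h.
Proof.
case: e e' => [s l] [t l'] [el cl dl [a la ->]] [el' cl' dl' [b lb ->]] /=.
have sub1 (m : seq nat) : m =i l ++ l' -> {subset l <= m} by move=> e x xl; rewrite e mem_cat xl.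
have sub2 (m : seq nat) : m =i l ++ l' -> {subset l' <= m} by move=> e x xl; rewrite e mem_cat xl orbT.
have dom_m (m : seq nat) : m =i l ++ l' -> forall x, x \in m -> s_le X x x.
  by move=> e x; rewrite e mem_cat => /orP [/dl|/dl'].
split.
  move=> [s' [a' [t' [b' [/pair_code_inj [<- <-] [/pair_code_inj [<- <-] [_ [_ [c0 [hc
    [k [k' [n [f [g [u [v [hf [hg [hu [hv huv]]]]]]]]]]]]]]]]]]]]].
  have [ef [ec [/enumerates_list [m [sm cm ma _]] [/enumerates_list [mc [smc cmc mca _]] _]]]] := proj2 hf.
  have [eg [ec' [/enumerates_list [m' [sm' cm' mb _]] _]]] := proj2 hg.
  have em : m = l by apply: chain_unique => // x; apply/idP/idP => [/ma/la|/la/ma].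
  have em' : m' = l' by apply: chain_unique => // x; apply/idP/idP => [/mb/lb|/lb/mb].
  subst m m' k k' n.
  have mcE : mc =i l ++ l'.
    move=> x; rewrite mem_cat; apply/idP/idP => [/mca/hc [/la ->|/lb ->]|]; rewrite ?orbT //.
    by move=> /orP [/la h|/lb h]; apply/mca/hc; [left|right].
  have [F Ff Fr] := inclusion_emb cl cmc la mca hf.
  have [G Gg Gr] := inclusion_emb cl' cmc lb mca hg.
  move/code_morE: hu => [F' [F'f ds ->]] in huv; move/code_morE: hv => [G' [G'g dt ->]] in huv.
  have eF : F' = F by apply: emb_code_inj; rewrite F'f.
  have eG : G' = G by apply: emb_code_inj; rewrite G'g.
  subst F' G'; exists (index^~ mc).
    by move=> x y; rewrite -!mcE; apply: index_monoX => //; apply: dom_m.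
  by exists (size mc), F, G; split=> //; apply/code_leE.
move=> [h hm hle]; have [mc cmc mcE] : exists2 mc, chain mc & mc =i l ++ l'.
  by apply: chain_exists; apply: dom_m.
have [c0 mca] := lists_exists mc.
have im := index_monoX cmc (dom_m _ mcE).
have iml : mono (index^~ mc) l by apply: (monoX_mono cl _ im); apply: sub1.
have iml' : mono (index^~ mc) l' by apply: (monoX_mono cl' _ im); apply: sub2.
have hml : mono h l by apply: (monoX_mono cl _ hm) => x xl; rewrite mem_cat xl.
have hml' : mono h l' by apply: (monoX_mono cl' _ hm) => x xl; rewrite mem_cat xl orbT.
have [x xl|F Fr] := @realizes_exists (index^~ mc) l (size mc) iml.
  by rewrite index_mem; apply: sub1 xl.
have [x xl|G Gr] := @realizes_exists (index^~ mc) l' (size mc) iml'.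
  by rewrite index_mem; apply: sub2 xl.
have hm' : monoX h mc by move=> x y; rewrite !mcE; apply: hm.
have leFG : le (ob D (size mc)) (mor D F s) (mor D G t).
  apply/(@ble_at D (s, l) (index^~ mc) (t, l') (index^~ mc)) => //.
  apply: (ble_pattern el el' hml hml' iml iml') hle => /= x y xl yl.
    by apply: (monoX_leq (dom_m _ mcE) hm' im); [apply: sub1 xl|apply: sub2 yl].
  by apply: (monoX_leq (dom_m _ mcE) hm' im); [apply: sub2 yl|apply: sub1 xl].
exists s, a, t, b; split=> //; split=> //; split.
  by apply/bar_dom_element; exists (s, l); split=> //; exists a.
split; first by apply/bar_dom_element; exists (t, l'); split=> //; exists b.
exists c0; split.
  move=> z; rewrite (mca z) mcE mem_cat; split=> [/orP [/la|/lb]|[/la|/lb] ->]; rewrite ?orbT //; by [left|right].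
exists (size l), (size l'), (size mc), (emb_code F), (emb_code G), (mor D F s), (mor D G t).
split; first by apply: emb_inclusion => //; apply: sub1.
split; first by apply: emb_inclusion => //; apply: sub2.
split; first by apply/code_morE; exists F; split=> //; case: el.
split; first by apply/code_morE; exists G; split=> //; case: el'.
exact/code_leE.
Qed.

Lemma bar_le_elements c c' : s_bar_le (code D) X c c' ->
  (exists e, codes_element e c) /\ exists e, codes_element e c'.
Proof.
by move=> [s [a [t [b [-> [-> [/bar_dom_element [e he] [/bar_dom_element [e' he'] _]]]]]]]]; split;
  [exists e|exists e'].
Qed.

Lemma monoX_exists (l : seq nat) : (forall x, x \in l -> s_le X x x) -> exists h, monoX h l.
Proof.
move=> dl; have [m cm ml] := chain_exists dl; exists (index^~ m) => x y.
by rewrite -!ml; apply: index_monoX => // z; rewrite ml; apply: dl.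
Qed.

End Coded.

(** * Extracting a ladder from a descending sequence *)

Section Ladder.

Variable D : predilator.

Definition descends (X : set_of_nat) (u : nat -> nat) : Prop :=
  forall n, s_lt_ord X (u n.+1) (u n).

Definition bar_descends (X : set_of_nat) (c : nat -> nat) : Prop :=
  forall n, s_bar_le (code D) X (c n.+1) (c n) /\ ~ s_bar_le (code D) X (c n) (c n.+1).

Hypothesis bar_wf : forall X, s_linear (s_le X) -> (forall u, ~ descends X u) ->
  forall c, ~ bar_descends X c.

Lemma ble_relabel s l l' h h' t m m' k k' : size l = size l' -> size m = size m' ->
  (forall i, i < size l -> h (nth 0 l i) = h' (nth 0 l' i)) ->
  (forall i, i < size m -> k (nth 0 m i) = k' (nth 0 m' i)) ->
  ble D (s, l) h (t, m) k -> ble D (s, l') h' (t, m') k'.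
Proof.
move=> sl sm hh kk; rewrite /ble /realizes /= => -[N [f [g [hf hg le]]]]; exists N.
move: f hf g hg le; rewrite sl sm => f hf g hg le; exists f, g; split=> // i.
  by rewrite hf hh // sl.
by rewrite hg kk // sm.
Qed.

Lemma count_lt (T : eqType) (p q : pred T) s y : subpred p q -> y \in s -> q y -> ~~ p y ->
  count p s < count q s.
Proof.
move=> pq; elim: s => // a s IH; rewrite in_cons => /orP [/eqP <- qy py|ys qy py] /=.
  by rewrite qy (negbTE py) add0n ltnS sub_count.
by have := IH ys qy py; have := pq a; case: (p a) => [/(_ isT) ->|_]; case: (q a); lia.
Qed.

(** A coding of omega squared: the first component will number the gaps between shared points, the
    second the positions in a gap. *)
Definition lex (z : nat) : Prop := exists a b a' b',
  z = pair_code (pair_code a b) (pair_code a' b') /\ (a < a' \/ a = a' /\ b <= b').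

Lemma lexE a b a' b' : s_le lex (pair_code a b) (pair_code a' b') <->
  (a < a' \/ a = a' /\ b <= b').
Proof.
split=> [[? [? [? [? [/pair_code_inj [/pair_code_inj [-> ->] /pair_code_inj [-> ->]] ?]]]]]|h] //.
by exists a, b, a', b'.
Qed.

Lemma lex_pair x y : s_le lex x y -> (exists a b, x = pair_code a b) /\ exists a b, y = pair_code a b.
Proof. by move=> [a [b [a' [b' [/pair_code_inj [-> ->] _]]]]]; split; [exists a, b|exists a', b']. Qed.

Lemma lex_linear : s_linear (s_le lex).
Proof.
move=> x y; split.
  by move=> /lex_pair [[a [b ->]] [a' [b' ->]]]; rewrite !lexE; lia.
split.
  move=> xy; have [[a [b ex]] [a' [b' ey]]] := lex_pair xy; move: xy; rewrite ex ey !lexE => h h'.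
  by have [-> ->] : a = a' /\ b = b' by lia.
split.
  move=> z xy yz; have [[a [b ex]] [a' [b' ey]]] := lex_pair xy; have [_ [a2 [b2 ez]]] := lex_pair yz.
  by move: xy yz; rewrite ex ey ez !lexE; lia.
move=> /lex_pair [[a [b ->]] _] /lex_pair [[a' [b' ->]] _]; rewrite !lexE; lia.
Qed.

Lemma lex_wf u : ~ descends lex u.
Proof.
suff main a b v : v 0 = pair_code a b -> ~ descends lex v.
  move=> du; have [h _] := du 0; have [_ [a [b e]]] := lex_pair h.
  exact: main e du.
elim/ltn_ind: a b v => a IHa b; elim/ltn_ind: b => b IHb v ev dv.
have [h1 n1] : s_lt_ord lex (v 1) (v 0) := dv 0.
have [[a' [b' ev']] _] := lex_pair h1; rewrite -/(s_le lex _ _) in h1.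
have dv' : descends lex (v \o succn) by move=> n; apply: dv.
move: h1 n1; rewrite ev ev' lexE => -[aa|[ea bb]] n1; first exact: (IHa a' aa b' _ ev' dv').
rewrite ea in ev' n1; apply: (IHb b' _ _ ev' dv').
by rewrite ltn_neqAle bb andbT; apply: contra_not_neq n1 => ->.
Qed.

Lemma element_relabel s l l' : size l = size l' -> element D (s, l) -> element D (s, l').
Proof. by rewrite /element /= => ->. Qed.

(** The labelling [v n] may change with [n]. This serves twice: for [prec]-chains with labels in
    [lex], and for the copies of points in the orders coded by functions. *)
Lemma bar_descends_relabel Y e v c : s_linear (s_le Y) -> (forall n, element D (e n)) ->
  (forall n i j, i < j -> j < size (e n).2 ->
    s_lt_ord Y (v n (nth 0 (e n).2 i)) (v n (nth 0 (e n).2 j))) ->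
  (forall n (x : nat), x \in (e n).2 -> s_le Y (v n x) (v n x)) ->
  (forall n h, mono (h \o v n) (e n).2 -> mono (h \o v n.+1) (e n.+1).2 ->
    monoX Y h (map (v n) (e n).2 ++ map (v n.+1) (e n.+1).2) ->
    ~ ble D (e n) (h \o v n) (e n.+1) (h \o v n.+1)) ->
  (forall n, exists2 a, lists (map (v n) (e n).2) a & c n = pair_code (e n).1 a) ->
  bar_descends Y c.
Proof.
move=> Ylin el vlt vdom nle hc n.
pose e' n := ((e n).1, map (v n) (e n).2).
have nthv m i : i < size (e m).2 -> nth 0 (map (v m) (e m).2) i = v m (nth 0 (e m).2 i).
  by move=> ie; apply: nth_map.
have cod m : codes_element D Y (e' m) (c m).
  split=> /=; last exact: hc.
  - have := el m; rewrite {1}(surjective_pairing (e m)); apply: element_relabel.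
    by rewrite size_map.
  - move=> i j ij; rewrite size_map => jn; rewrite !nthv //; last exact: ltn_trans jn.
    exact: vlt.
  - by move=> x /mapP [u ue ->]; apply: vdom.
have blee h m k : ble D (e' m) h (e' k) h <-> ble D (e m) (h \o v m) (e k) (h \o v k).
  move: (nthv m) (nthv k); rewrite /e'; case: (e m) => [s l]; case: (e k) => [t l'] /= nl nl'.
  by split; apply: ble_relabel => // [||i|i]; rewrite ?size_map // => ?; rewrite /= ?nl ?nl'.
have mon h m : monoX Y h (map (v m) (e m).2) -> mono (h \o v m) (e m).2.
  move=> hm i j ij jm; have im := ltn_trans ij jm.
  by apply: hm; [apply/map_f/mem_nth..|apply: vlt].
have nble h : monoX Y h ((e' n).2 ++ (e' n.+1).2) -> ~ ble D (e' n) h (e' n.+1) h.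
  move=> hm /blee; apply: nle => //.
  - by apply: mon => x y xe ye; apply: hm; rewrite mem_cat ?xe ?ye.
  - by apply: mon => x y xe ye; apply: hm; rewrite mem_cat ?xe ?ye orbT.
have [el1 ch1 d1 _] := cod n; have [el2 ch2 d2 _] := cod n.+1.
have [h hm] : exists h, monoX Y h ((e' n).2 ++ (e' n.+1).2).
  by apply: (monoX_exists Ylin) => x; rewrite mem_cat; move=> /orP [/d1|/d2].
have hm1 : monoX Y h (e' n).2 by move=> x y xe ye; apply: hm; rewrite mem_cat ?xe ?ye.
have hm2 : monoX Y h (e' n.+1).2 by move=> x y xe ye; apply: hm; rewrite mem_cat ?xe ?ye orbT.
have mn1 : mono h (e' n).2 by apply: (monoX_mono ch1 _ hm1).
have mn2 : mono h (e' n.+1).2 by apply: (monoX_mono ch2 _ hm2).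
split.
  apply/(bar_leE Ylin (cod n.+1) (cod n)); exists h.
    by move=> x y; rewrite mem_cat orbC -mem_cat => xe; rewrite mem_cat orbC -mem_cat => ye; apply: hm.
  exact: not_ble el1 el2 mn1 mn2 (nble h hm).
by move=> /(bar_leE Ylin (cod n) (cod n.+1)) [k km]; apply: nble.
Qed.

Variable X : set_of_nat.
Hypothesis X_linear : s_linear (s_le X).

(* Relabelling the coordinates by their positions relative to [P] embeds the
   whole [prec]-chain into a single extension of [D], along a well order. *)
Lemma prec_wf (P : seq nat) (e : nat -> nat * seq nat) : (forall n, element D (e n)) ->
  (forall n, chain X (e n).2) -> (forall n, {subset P <= (e n).2}) ->
  (forall n x, x \in (e n).2 -> s_le X x x) -> ~ forall n, prec D P (e n.+1) (e n).
Proof.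
move=> el ce Pe de pr.
(* [b u] numbers the gap of [u]. A point of [P] opens its gap with the label 0, independent of [n],
   so the labellings agree on [P]. *)
pose b u := count (fun q => `[< s_le X q u >]) P.
pose v n u := pair_code (b u) (if u \in P then 0 else (index u (e n).2).+1).
have vlt n x y : x \in (e n).2 -> y \in (e n).2 -> s_lt_ord X x y -> s_lt_ord lex (v n x) (v n y).
  move=> xe ye xy; have [xy1 nxy] := xy.
  have xP u : s_le X u x -> s_le X u y.
    by move=> ux; have [_ [_ [tr _]]] := X_linear u x; apply: tr ux xy1.
  have bxy : b x <= b y by apply: sub_count => q /asboolP /xP qy; apply/asboolP.
  have ixy : index x (e n).2 < index y (e n).2 by apply: (index_monoX X_linear (ce n)) => //; apply: de.
  have bP : y \in P -> b x < b y.
    move=> yP; apply: (count_lt (y := y)) => //.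
    - by move=> q /asboolP /xP qy; apply/asboolP.
    - by apply/asboolP; apply: de ye.
    - apply/asboolP => yx; have [_ [an _]] := X_linear x y; exact: nxy (an xy1 yx).
  have lt : b x < b y \/ b x = b y /\ (if x \in P then 0 else (index x (e n).2).+1) <
      (if y \in P then 0 else (index y (e n).2).+1).
    move: bP; case: (y \in P) => [/(_ isT)|_]; first by left.
    by move: bxy; rewrite leq_eqVlt => /orP [/eqP|]; [right; split=> //; case: (x \in P)|left].
  split; first by apply/lexE; case: lt => [|[-> /ltnW]]; [left|right].
  by move=> /pair_code_inj [eb ei]; case: lt; rewrite ?eb ?ei ltnn => // -[].
have ex n : exists y, exists2 a, lists (map (v n) (e n).2) a & y = pair_code (e n).1 a.
  by have [a ha] := lists_exists (map (v n) (e n).2); exists (pair_code (e n).1 a), a.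
have [c hc] := choice ex.
apply: (bar_wf lex_linear lex_wf (c := c)); apply: (bar_descends_relabel lex_linear el _ _ _ hc) => n.
- move=> i j ij jn; apply: vlt; [exact/mem_nth/(ltn_trans ij)|exact: mem_nth|exact: ce].
- by move=> x xe; apply/lexE; right.
- by move=> h m1 m2 _; apply: pr => // p pP /=; rewrite /v pP.
Qed.

Variable e : nat -> nat * seq nat.
Hypothesis e_element : forall n, element D (e n).
Hypothesis e_chain : forall n, chain X (e n).2.
Hypothesis e_dom : forall n (x : nat), x \in (e n).2 -> s_le X x x.
Hypothesis e_descends : forall n h, monoX X h ((e n).2 ++ (e n.+1).2) ->
  ~ ble D (e n) h (e n.+1) h.

(** [X] may have descending sequences, so this is not automatic. It will hold because the model
    containing [X] has none and can compute [x]. *)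
Hypothesis settles : forall (P : seq nat) s (x : nat -> nat), (forall t, s <= t -> top D P (e t) (x t)) ->
  (forall t t', s <= t -> t < t' -> ~ s_lt_ord X (x t) (x t')) ->
  exists2 s', s <= s' & forall t, s' <= t -> x t = x s'.

Let e_uniq n : uniq (e n).2 := chain_uniq X_linear (@e_chain n).

Lemma e_descends_lt s t : s < t -> exists k,
  [/\ monoX X k ((e s).2 ++ (e t).2), mono k (e s).2, mono k (e t).2,
    ble D (e t) k (e s) k & ~ ble D (e s) k (e t) k].
Proof.
move=> st; pose all := flatten [seq (e i).2 | i <- iota 0 t.+1].
have allP i : i <= t -> {subset (e i).2 <= all}.
  move=> it x xe; apply/flatten_mapP; exists i => //; rewrite mem_iota add0n /=; lia.
have [k km] : exists k, monoX X k all.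
  by apply: (monoX_exists X_linear) => x /flatten_mapP [i _]; apply: e_dom.
have kmi i : i <= t -> monoX X k (e i).2.
  by move=> it x y xe ye; apply: km; apply: (allP i).
have mk i : i <= t -> mono k (e i).2 by move=> it; apply: (monoX_mono (@e_chain i) _ (kmi i it)).
have km2 i j : i <= t -> j <= t -> monoX X k ((e i).2 ++ (e j).2).
  move=> it jt x y; rewrite !mem_cat => /orP xe /orP ye; apply: km.
    by case: xe; [apply: (allP i)|apply: (allP j)].
  by case: ye; [apply: (allP i)|apply: (allP j)].
have nle : forall n, s + n.+1 <= t -> ~ ble D (e s) k (e (s + n.+1)) k.
  elim=> [|n IH] nt.
    by rewrite addn1 in nt *; apply: e_descends; apply: km2; lia.
  move=> le1; apply: (IH ltac:(lia)).
  apply: (ble_trans (e_element _) (e_element _) (e_element _) _ _ _ le1); try by apply: mk; lia.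
  apply: not_ble => //; try by apply: mk; lia.
  by rewrite (_ : s + n.+2 = (s + n.+1).+1); last lia; apply: e_descends; apply: km2; lia.
exists k; have nst : ~ ble D (e s) k (e t) k.
  by have := nle (t - s).-1; rewrite (_ : s + (t - s).-1.+1 = t) //; [apply|lia].
split=> //; try by apply: mk; lia.
  by apply: km2; lia.
by apply: not_ble => //; apply: mk; lia.
Qed.

Lemma prec_minimal (P : seq nat) s : (forall t, s <= t -> {subset P <= (e t).2}) ->
  exists2 s', s <= s' & forall t, s' < t -> ~ prec D P (e t) (e s').
Proof.
move=> sP; apply: contrapT => none.
have next u : exists t, s <= u -> u < t /\ prec D P (e t) (e u).
  have [su|us] := leqP s u; last by exists 0 => su; lia.
  apply: contrapT => nt; apply: none; exists u => // t ut pr.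
  by apply: nt; exists t.
have [f hf] := choice next; pose w n := iter n f s.
have sw n : s <= w n by elim: n => //= n IH; have [] := hf _ IH; rewrite -/(w n); lia.
apply: (@prec_wf P (fun n => e (w n))) => // [n|n x|n]; first exact/sP/sw.
  exact: e_dom.
by have [] := hf _ (sw n).
Qed.

(** After a [prec]-minimal term, [not_prec] gives [e t] at most [e t'] for [t < t'] under some
    valuations that agree on [P], whereas [e t'] is smaller under a common valuation. Hence
    dominating coordinates exist, and by [cross] they never increase in [X]. Their final value is
    [p], and [cross] with the roles exchanged gives the rule for [p]. *)
Lemma stage_point (P : seq nat) s : (forall t, s <= t -> {subset P <= (e t).2}) ->
  exists p s', [/\ s < s', p \notin P, forall t, s' <= t -> p \in (e t).2
    & forall t t' h h', s' <= t -> t < t' -> mono h (e t).2 -> mono h' (e t').2 ->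
      {in P, h =1 h'} -> h' p < h p -> ~ ble D (e t) h (e t') h'].
Proof.
move=> sP; have [s0 ss0 smin] := prec_minimal sP.
have sub t : s0 < t -> {subset P <= (e t).2} by move=> st; apply: sP; lia.
have low t t' : s0 < t -> t < t' -> exists h h',
    [/\ mono h (e t).2, mono h' (e t').2, {in P, h =1 h'} & ble D (e t) h (e t') h'].
  move=> st tt.
  have nprec u v : ~ prec D P (e v) (e u) -> exists h h',
      [/\ mono h (e u).2, mono h' (e v).2, {in P, h =1 h'} & ble D (e u) h (e v) h'].
    move=> np; apply: contrapT => none; apply: np => h h' hm hm' hh le1; apply: none.
    by exists h, h'.
  apply: (nprec t t'); have [h0 [h [m0 m hh le0]]] := nprec _ _ (smin t' ltac:(lia)).
  have [k [_ k0 k1 _ nle]] := e_descends_lt st.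
  exact: (@not_prec _ (e s0) (e t) (e t') P h0 h k k) (sP s0 ss0) (sub t st) _ _ _ le0 _ _ _ nle.
have tops t : s0 < t -> exists x, top D P (e t) x.
  move=> st; have [k [_ k0 k1 le1 nle1]] := e_descends_lt (ltnSn t).
  have [h [h' [hm hm' hh le0]]] := low t t.+1 st (ltnSn t).
  have st' : s0 < t.+1 by lia.
  case: (top_or_none P (e_element t) (e_uniq t)) => [none|//].
  case: (top_or_none P (e_element t.+1) (e_uniq t.+1)) => [none'|[y ty]].
    have [E1 [E2 [i1 i2 E _ _]]] := @amalgam_on P (e t).2 false 0 0 h k (sub t st) hm k0.
    case: nle1; apply: (ble_unrescale _ _ k0 k1 i2) => //.
    apply: ble_ext (ble_rescale (e_element t) (e_element t.+1) i1 le0) => x /=.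
      by move/none/E.
    by move=> /none' xP; rewrite -hh // E.
  by case: (cross_none (e_element t) (e_element t.+1) (sub t st) (sub _ st') none ty hm hm' hh le0
    k0 k1 _ le1).
have [x hx] : exists x : nat -> nat, forall t, s0 < t -> top D P (e t) (x t).
  have h t : exists x, s0 < t -> top D P (e t) x.
    by have [/tops [x hx]|_] := ltnP s0 t; [exists x|exists 0].
  by have [x hx] := choice h; exists x.
have dec t t' : s0 < t -> t < t' -> ~ s_lt_ord X (x t) (x t').
  move=> st tt xx; have [k [km k0 k1 le1 nle1]] := e_descends_lt tt.
  have [h [h' [hm hm' hh le0]]] := low t t' st tt; have st' : s0 < t' by lia.
  have [[xt _ _] [xt' _ _]] := (hx t st, hx t' st').
  apply: (cross (e_element t) (e_element t') (sub t st) (sub t' st') (hx t st) (hx t' st') hm hm' hh le0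
    k0 k1 _ _ le1) => //.
  by apply: km => //; rewrite mem_cat ?xt ?xt' ?orbT.
have [s1 ss1 xc] := settles hx dec.
have [x1 x1P _] := hx s1 ss1.
exists (x s1), s1; split=> //; first by lia.
  by move=> t st; rewrite -(xc t st); have [] := hx t ltac:(lia).
move=> t t' h h' st tt hm hm' hh lt; have [k [_ k0 k1 le1 _]] := e_descends_lt tt.
have st1 : s0 < t by lia.
have st2 : s0 < t' by lia.
apply: (cross (e_element t') (e_element t) (sub t' st2) (sub t st1) (hx t' st2) (hx t st1) k1 k0 _ le1
  hm' hm _ _) => //; first by move=> p pP; rewrite hh.
by rewrite !xc //; lia.
Qed.

Lemma ladder : exists (p : nat -> nat) (f : nat -> nat), [/\ injective p,
  forall t i, i <= t.+1 -> p i \in (e (f t)).2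
  & forall t j h h', j <= t.+1 -> mono h (e (f t)).2 -> mono h' (e (f t.+1)).2 ->
      (forall i, i < j -> h (p i) = h' (p i)) -> h' (p j) < h (p j) ->
      ~ ble D (e (f t)) h (e (f t.+1)) h'].
Proof.
pose ok (w : seq nat * nat) := forall t, w.2 <= t -> {subset w.1 <= (e t).2}.
pose next (w w' : seq nat * nat) := exists p, [/\ w'.1 = rcons w.1 p, w.2 < w'.2, p \notin w.1, ok w'
    & forall t t' h h', w'.2 <= t -> t < t' -> mono h (e t).2 -> mono h' (e t').2 ->
      {in w.1, h =1 h'} -> h' p < h p -> ~ ble D (e t) h (e t') h'].
have ex w : exists w', ok w -> next w w'.
  have [okw|] := pselect (ok w); last by exists w.
  have [p [s' [ss' pw ps' hp]]] := stage_point okw.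
  exists (rcons w.1 p, s') => _; exists p; split=> // t st x; rewrite mem_rcons in_cons.
  by move=> /orP [/eqP ->|]; [apply: ps'|apply: okw; apply: leq_trans st; apply: ltnW].
have [F hF] := choice ex; pose w n := iter n F ([::], 0).
have okw n : ok (w n) by elim: n => [t _ x //|n /hF [p []]].
have nw n : next (w n) (w n.+1) by apply: hF.
have [p hp] := choice nw.
have w1 n : (w n).1 = mkseq p n.
  elim: n => // n IH; have [-> _ _ _ _] := hp n; rewrite IH /mkseq -[in RHS]addn1 iotaD map_cat /=.
  by rewrite cats1.
have w2 m n : m < n -> (w m).2 < (w n).2.
  elim: n => // n IH; rewrite ltnS leq_eqVlt; have [_ lt _ _ _] := hp n.
  by move=> /orP [/eqP ->|/IH] //; lia.
have mem i n : i < n -> p i \in (w n).1.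
  by move=> i_n; rewrite w1; apply: map_f; rewrite mem_iota.
have pinj i j : i < j -> p i != p j.
  by move=> ij; have [_ _ nP _ _] := hp j; apply: contraNneq nP => <-; apply: mem.
(* From stage [t.+2] of the iteration on, the points with index up to [t.+1] are present. *)
exists p, (fun t => (w t.+2).2); split.
- move=> i j; case: (ltngtP i j) => // ij eij; have := pinj _ _ ij; by rewrite eij eqxx.
- by move=> t i it; apply: (okw t.+2) => //; apply: mem.
- move=> t j h h' jt hm hm' hh lt; have [_ _ _ _ hj] := hp j; apply: hj => //.
  + by have [->//|/eqP ne] := eqVneq j t.+1; apply/ltnW/w2; lia.
  + by apply: w2.
  + by move=> q; rewrite w1 => /mapP [i]; rewrite mem_iota add0n => /= ij ->; apply: hh.
Qed.

End Ladder.

(** * Descending sequences inside an omega-model *)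

Section Enumeration.

Variable M : set_of_nat -> Prop.
Hypothesis M_RCA0 : models_theory M RCA0.

Lemma model_comprehension A B v V : sigma01 A -> pi01 B -> (forall i, M (V i)) ->
  (forall m, sat M (scons m v) V A <-> sat M (scons m v) V B) ->
  M (fun m => sat M (scons m v) V A).
Proof.
move=> sA pB MV AB; have ax : models M (comprehension_axiom A B) by apply/M_RCA0/RCA0_comprehension.
have [|W MW hW] := ax v V MV.
  by move=> m; split=> [/AB|/AB].
rewrite (_ : (fun m => _) = W) //; apply: funext => m; apply: propext.
by have [h1 h2] := hW m; split=> [h|/h1/sat_shift2 //]; apply: h2; apply/sat_shift2.
Qed.

(* The witnesses [a] require finitely many elements of [F] and of [X]; as
   they never require the absence of an element, the tables do not refer to
   [F] and [X]. *)
Definition requires (T F X : set_of_nat) (a : nat) : Prop := forall i, i < a ->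
  (T (pair_code 1 (pair_code i a)) -> F i) /\ (T (pair_code (1 + 1) (pair_code i a)) -> X i).

Definition t_pair (t u : term) : term := TAdd (TMul (TAdd t u) (TAdd t u)) t.

(** Outside of the bounded quantifier, the number variables 0, 1, 2 stand for the witness, the
    element and the index of the enumeration; the set variables 0, 1, 2 stand for [T], [F], [X]. *)
Definition table_matrix (flag : term) : formula :=
  FAnd (FIn (t_pair flag (t_pair (t_pair (TVar 2) (TVar 1)) (TVar 0))) 0)
    (FAll (FImp (FLt (TVar 0) (tshift (TVar 0)))
      (FAnd (FImp (FIn (t_pair TOne (t_pair (TVar 0) (TVar 1))) 0) (FIn (TVar 0) 1))
        (FImp (FIn (t_pair (TAdd TOne TOne) (t_pair (TVar 0) (TVar 1))) 0) (FIn (TVar 0) 2))))).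

Lemma table_matrix_delta flag : delta00 (table_matrix flag).
Proof. by do !constructor. Qed.

Definition t_three : term := TAdd TOne (TAdd TOne TOne).

(** Columns 0 and 3 of the table enumerate [W] and its complement relative to [F] and [X], so
    recursive comprehension applies. *)
Lemma model_enumerated T F X W e : M T -> M F -> M X ->
  (forall m, W m <-> exists a, T (pair_code 0 (pair_code (pair_code e m) a)) /\ requires T F X a) ->
  (forall m, ~ W m <-> exists a, T (pair_code 3 (pair_code (pair_code e m) a)) /\ requires T F X a) ->
  M W.
Proof.
move=> MT MF MX h0 h3; pose V := scons T (scons F (fun _ => X)).
have MV i : M (V i) by case: i => [|[|i]].
pose A := FEx (table_matrix TZero); pose B := FAll (FNot (table_matrix t_three)).
have sA : sigma01 A by exists (table_matrix TZero) => //; apply: table_matrix_delta.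
have pB : pi01 B.
  by exists (FNot (table_matrix t_three)) => //; apply: delta00_imp; [exact: table_matrix_delta|constructor].
have WA m : sat M (scons m (fun _ => e)) V A <-> W m.
  by rewrite h0.
have WB m : sat M (scons m (fun _ => e)) V B <-> W m.
  split=> [/= hB|/= Wm a hB].
    apply: contrapT => /h3 [a [Ta ra]]; exact: (hB a (conj Ta ra)).
  by have := proj2 (h3 m); case=> //; exists a.
rewrite (_ : W = fun m => sat M (scons m (fun _ => e)) V A).
  by apply: (model_comprehension sA pB MV) => m; rewrite WA WB.
by apply: funext => m; apply: propext; rewrite WA.
Qed.

Lemma model_column T k : M T -> M (fun m => T (pair_code (k + 4) m)).
Proof.
move=> MT; pose V (_ : nat) := T; pose C := FIn (t_pair (TVar 2) (TVar 1)) 0.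
have h m (n : nat) : sat M (scons n (scons m (fun _ => k + 4))) V C <-> T (pair_code (k + 4) m) by [].
rewrite (_ : (fun m => _) = fun m => sat M (scons m (fun _ => k + 4)) V (FEx C)).
  apply: (@model_comprehension (FEx C) (FAll C)) => //; try by exists C => //; constructor.
  by move=> m; split=> [[n hn] n'|hn]; [exact: hn|exists 0; apply: hn].
by apply: funext => m; apply: propext; split=> [Tm|[]//]; exists 0.
Qed.

End Enumeration.

Section Changes.

Variables (x : nat -> nat) (s : nat).

(** Reindexing by the number of changes turns a nonincreasing sequence that never settles into a
    strictly descending one. *)
Definition changes (t : nat) : nat := count (fun u => x u.+1 != x u) (iota s (t - s)).

Lemma changesS t : s <= t -> changes t.+1 = changes t + (x t.+1 != x t).
Proof.
move=> st; rewrite /changes subSn // -[(t - s).+1]addn1 iotaD count_cat /= addn0.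
by rewrite subnKC.
Qed.

Lemma changes_start : changes s = 0.
Proof. by rewrite /changes subnn. Qed.

Lemma changes_mono t t' : s <= t -> t <= t' -> changes t <= changes t'.
Proof.
move=> st; elim: t' => [|t' IH]; first by rewrite leqn0 => /eqP ->.
rewrite leq_eqVlt => /orP [/eqP -> //|]; rewrite ltnS => tt'.
by rewrite changesS; [have := IH tt'; lia|lia].
Qed.

Lemma changes_same t t' : s <= t -> t <= t' -> changes t = changes t' -> x t = x t'.
Proof.
move=> st; elim: t' => [|t' IH]; first by rewrite leqn0 => /eqP ->.
rewrite leq_eqVlt => /orP [/eqP -> //|]; rewrite ltnS => tt'; have st' : s <= t' by lia.
rewrite changesS //; have := changes_mono st tt'; have := IH tt'.
by case: eqP => [->|_] /= h1 h2 h3; [apply: h1|]; lia.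
Qed.

Lemma changes_surjective n : (forall t, s <= t -> exists2 t', t <= t' & x t' <> x t) ->
  exists2 t, s <= t & changes t = n.
Proof.
move=> ch; elim: n => [|n [t st tn]]; first by exists s => //; apply: changes_start.
have [t1 tt1 n1] := ch t st.
have : exists t', (t <= t') && (changes t' != n).
  exists t1; rewrite tt1; apply/eqP => e; apply: n1; symmetry.
  by apply: changes_same => //; rewrite tn e.
move=> ex; case: (ex_minnP ex) => t' /andP [tt' nt'] mint.
case: t' tt' nt' mint => [|t'] tt' nt' mint.
  by move: nt'; have -> : 0 = t by [lia]; rewrite tn eqxx.
have e' : changes t' = n.
  have tt2 : t <= t'.
    by move: tt'; rewrite leq_eqVlt => /orP [/eqP e|]; [rewrite -e tn eqxx in nt'|].
  by apply/eqP; apply: contraTT (ltnSn t') => ne; rewrite -leqNgt mint // tt2.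
exists t'.+1; first by lia.
have st' : s <= t'.
  by rewrite leqNgt; apply: contra nt' => st'; rewrite (_ : t'.+1 = t) ?tn //; lia.
by move: nt'; rewrite changesS // e'; case: (x _ != _) => /=; lia.
Qed.

End Changes.

Lemma top_unique D P e x y : element D e -> top D P e x -> top D P e y -> uniq e.2 -> x = y.
Proof.
move=> el [xl xP tx] [yl yP ty] ul; apply/eqP; apply: contraT => nxy.
pose d z u := 2 * index u e.2 + (u == z).
have dm z : mono (d z) e.2.
  by move=> i j ij jl; rewrite /d !index_uniq //; [lia|exact: ltn_trans jl].
have ag z z' : z \notin P -> z' \notin P -> {in P, d z =1 d z'}.
  have ne w u : w \notin P -> u \in P -> (u == w) = false.
    by move=> wP uP; apply/negbTE; apply: contraNneq wP => <-.
  by move=> zP zP' u uP; rewrite /d !ne.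
case: (ble_total el el (dm x) (dm y)).
  case/(tx _ _ (dm y) (dm x)) => //; first exact: ag.
  by rewrite /d eqxx (negbTE nxy); lia.
case/(ty _ _ (dm x) (dm y)) => //; first exact: ag.
by rewrite /d eqxx eq_sym (negbTE nxy); lia.
Qed.

Section Settling.

Variables (D : predilator) (pk : seq nat * nat -> nat).
Hypothesis pk_inj : injective pk.

(** The numbers [f] and [g] code finite parts of [F] and [X]. They identify the terms up to stage
    [t] by positive information only, and by [top_unique] the recorded coordinates are then the
    actual ones. *)
Definition change_witness (P : seq nat) (s n y f g : nat) : Prop :=
  exists (t : nat) (E : nat -> nat * seq nat) (b x : nat -> nat), [/\ s <= t,
    forall u, s <= u <= t -> [/\ bit (pair_code u (pair_code (E u).1 (b u))) f, lists (E u).2 (b u),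
      uniq (E u).2, forall i j, i < j -> j < size (E u).2 ->
        bit (pair_code (nth 0 (E u).2 i) (nth 0 (E u).2 j)) g & top D P (E u) (x u)],
    n = changes x s t & y = x t].

Definition enumerates_graph (k m a : nat) : Prop := exists P s n y f g,
  [/\ k = pk (P, s), m = pair_code n y, a = pair_code f g & change_witness P s n y f g].

(** The set to be computed is the graph of a total function, so a wrong value is refuted by the
    right one. A number that is no pair requires no evidence, hence the witness with two empty
    sets. *)
Definition enumerates_complement (k m a : nat) : Prop :=
  (forall n y, m <> pair_code n y) /\ a = pair_code 0 0 \/
  exists P s n y y' f g, [/\ k = pk (P, s), m = pair_code n y', a = pair_code f g, y <> y' &
    change_witness P s n y f g].

Inductive table : nat -> Prop :=
| table_graph k m a : enumerates_graph k m a ->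
    table (pair_code 0 (pair_code (pair_code k m) a))
| table_left i f g : bit i f -> table (pair_code 1 (pair_code i (pair_code f g)))
| table_right i f g : bit i g -> table (pair_code (1 + 1) (pair_code i (pair_code f g)))
| table_complement k m a : enumerates_complement k m a ->
    table (pair_code 3 (pair_code (pair_code k m) a))
| table_code u : code D u -> table (pair_code 4 u).

Lemma table_graphE k m a : table (pair_code 0 (pair_code (pair_code k m) a)) <-> enumerates_graph k m a.
Proof.
split; last exact: table_graph.
move eqc : (pair_code 0 _) => c h; case: h eqc => {c} [k' m' a' h|i f g h|i f g h|k' m' a' h|u h] /pair_code_inj [] //.
by move=> _ /pair_code_inj [/pair_code_inj [-> ->] ->].
Qed.

Lemma table_complementE k m a :
  table (pair_code 3 (pair_code (pair_code k m) a)) <-> enumerates_complement k m a.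
Proof.
split; last exact: table_complement.
move eqc : (pair_code 3 _) => c h; case: h eqc => {c} [k' m' a' h|i f g h|i f g h|k' m' a' h|u h] /pair_code_inj [] //.
by move=> _ /pair_code_inj [/pair_code_inj [-> ->] ->].
Qed.

Lemma table_codeE u : table (pair_code 4 u) <-> code D u.
Proof.
split; last exact: table_code.
move eqc : (pair_code 4 _) => c h; case: h eqc => {c} [k' m' a' h|i f g h|i f g h|k' m' a' h|v h] /pair_code_inj [] //.
by move=> _ ->.
Qed.

Lemma requiresE F X f g : requires table F X (pair_code f g) <->
  (forall i, bit i f -> F i) /\ (forall i, bit i g -> X i).
Proof.
have pg : f <= pair_code f g /\ g <= pair_code f g by rewrite /pair_code; nia.
split=> [h|[hf hg] i ia].
  split=> i bi; have ii := bit_bound bi; have [h1 h2] := h i ltac:(lia).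
    exact/h1/table_left.
  exact/h2/table_right.
split.
  move eqc : (pair_code 1 _) => c h; case: h eqc => {c} [k' m' a' h|i' f' g' h|i' f' g' h|k' m' a' h|v h] /pair_code_inj [] //.
  by move=> _ /pair_code_inj [-> /pair_code_inj [ef _]]; apply: hf; rewrite ef.
move eqc : (pair_code (1 + 1) _) => c h; case: h eqc => {c} [k' m' a' h|i' f' g' h|i' f' g' h|k' m' a' h|v h] /pair_code_inj [] //.
by move=> _ /pair_code_inj [-> /pair_code_inj [_ eg]]; apply: hg; rewrite eg.
Qed.

Variables (M : set_of_nat -> Prop) (F X : set_of_nat) (c : nat -> nat) (e : nat -> nat * seq nat).
Hypothesis M_RCA0 : models_theory M RCA0.
Hypothesis M_table : M table.
Hypothesis MF : M F.
Hypothesis MX : M X.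
Hypothesis X_linear : s_linear (s_le X).
Hypothesis X_wf : s_wf_rel M (s_le X).
Hypothesis F_graph : forall n y, F (pair_code n y) <-> y = c n.
Hypothesis e_codes : forall n, codes_element D X (e n) (c n).

Lemma witness_sound P s n y f g x : (forall t, s <= t -> top D P (e t) (x t)) ->
  (forall i, bit i f -> F i) -> (forall i, bit i g -> X i) -> change_witness P s n y f g ->
  exists t, [/\ s <= t, n = changes x s t & y = x t].
Proof.
move=> xt hf hg [t [E [b [x' [st hE -> ->]]]]].
have eq u : s <= u <= t -> x' u = x u.
  move=> su; have [bf lE uE cE tE] := hE u su.
  have [el ce _ [a la ea]] := e_codes u.
  have /F_graph := hf _ bf; rewrite ea => /pair_code_inj [e1 eb]; rewrite eb in lE.
  have cEu : chain X (E u).2.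
    move=> i j ij jl; split; first exact/hg/cE.
    by apply/eqP; rewrite nth_uniq //; [lia|exact: ltn_trans jl].
  have e2 : (E u).2 = (e u).2.
    by apply: (chain_unique X_linear) => // z; apply/idP/idP => [/lE/la|/la/lE].
  have eE : E u = e u by rewrite (surjective_pairing (E u)) e1 e2 -surjective_pairing.
  rewrite eE in tE uE; apply: top_unique el tE _ uE; apply: xt; lia.
exists t; split=> //; last by apply: eq; rewrite st leqnn.
apply: eq_in_count => u; rewrite mem_iota => su; rewrite !eq //; lia.
Qed.

Lemma witness_complete P s x t : (forall t, s <= t -> top D P (e t) (x t)) -> s <= t ->
  exists f g, [/\ forall i, bit i f -> F i, forall i, bit i g -> X i
    & change_witness P s (changes x s t) (x t) f g].
Proof.
move=> xt st.
have exb n : exists b, lists (e n).2 b /\ c n = pair_code (e n).1 b.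
  by have [_ _ _ [b lb eb]] := e_codes n; exists b.
have [b hb] := choice exb.
pose nz u := [seq pair_code (nth 0 (e u).2 ij.1) (nth 0 (e u).2 ij.2) |
  ij <- [seq ij <- [seq (i, j) | i <- iota 0 (size (e u).2), j <- iota 0 (size (e u).2)] | ij.1 < ij.2]].
exists (finite_code [seq pair_code u (c u) | u <- iota 0 t.+1]).
exists (finite_code (flatten [seq nz u | u <- iota 0 t.+1])); split.
- by move=> i; rewrite bit_finite_code => /mapP [u _ ->]; apply/F_graph.
- move=> i; rewrite bit_finite_code => /flatten_mapP [u _ /mapP [[i1 j1]]].
  rewrite mem_filter => /= /andP [ij /allpairsP [[i2 j2] /= []]].
  rewrite !mem_iota !add0n => /= _ jl [_ ej] ->; rewrite -ej in jl.
  by have [_ ce _ _] := e_codes u; have [] := ce _ _ ij jl.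
- exists t, e, b, x; split=> // u su; have [lb eb] := hb u; have [el ce _ _] := e_codes u.
  have ut : u \in iota 0 t.+1 by rewrite mem_iota; lia.
  split=> //.
  + by rewrite bit_finite_code -eb; apply: (map_f (fun u => pair_code u (c u))).
  + exact: (chain_uniq X_linear).
  + move=> i j ij jl; rewrite bit_finite_code; apply/flatten_mapP; exists u => //.
    apply/mapP; exists (i, j) => //; rewrite mem_filter ij /=; apply/allpairsP; exists (i, j).
    by rewrite !mem_iota /=; split=> //; lia.
  + by apply: xt; lia.
Qed.

(** If [x] never settled, the function mapping [n] to the value after [n] changes would be a
    descending sequence in [X], and the table puts its graph into [M]. *)
Lemma settles_in_model P s x : (forall t, s <= t -> top D P (e t) (x t)) ->
  (forall t t', s <= t -> t < t' -> ~ s_lt_ord X (x t) (x t')) ->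
  exists2 s', s <= s' & forall t, s' <= t -> x t = x s'.
Proof.
move=> xt dec; apply: contrapT => none.
have ch t : s <= t -> exists2 t', t <= t' & x t' <> x t.
  move=> st; apply: contrapT => nt; apply: none; exists t => // t' tt'.
  by apply: contrapT => ne; apply: nt; exists t'.
have domx t : s <= t -> s_le X (x t) (x t).
  by move=> st; have [xl _ _] := xt t st; have [_ _ de _] := e_codes t; apply: de.
have le t t' : s <= t -> t <= t' -> s_le X (x t') (x t).
  move=> st; rewrite leq_eqVlt => /orP [/eqP <-|tt']; first exact: domx.
  have st' : s <= t' by lia.
  have [->|/eqP ne] := eqVneq (x t') (x t); first exact: domx.
  have [[]//|lt] := s_lt_total X_linear (domx t' st') (domx t st) ne.
  by case: (dec t t').
pose W m := exists2 t, s <= t & m = pair_code (changes x s t) (x t).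
have Wfun n y y' : W (pair_code n y) -> W (pair_code n y') -> y = y'.
  move=> [t st /pair_code_inj [nt ->]] [t' st' /pair_code_inj [nt' ->]].
  by case: (leqP t t') => [tt|/ltnW tt]; [|symmetry]; apply: (changes_same (s := s)) => //; lia.
have MW : M W.
  apply: (model_enumerated (e := pk (P, s)) M_RCA0 M_table MF MX) => m.
    split=> [[t st ->]|[a [/table_graphE [P' [s' [n [y [f [g [/pk_inj [eP es] -> -> w]]]]]]] /requiresE [hf hg]]]].
      have [f [g [hf hg w]]] := witness_complete xt st.
      exists (pair_code f g); split; last exact/requiresE.
      by apply/table_graphE; exists P, s, (changes x s t), (x t), f, g.
    rewrite -eP -es in w.
    by have [t [st -> ->]] := witness_sound xt hf hg w; exists t.
  split=> [nW|[a [/table_complementE]]].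
    have [[n [y em]]|np] := pselect (exists n y, m = pair_code n y); last first.
      exists (pair_code 0 0); split; last by apply/requiresE; split=> i /bit_bound.
      by apply/table_complementE; left; split=> // n y em; apply: np; exists n, y.
    have [t st tn] := changes_surjective n ch.
    have [f [g [hf hg w]]] := witness_complete xt st.
    exists (pair_code f g); split; last exact/requiresE.
    apply/table_complementE; right; exists P, s, n, (x t), y, f, g; split=> //; last by rewrite -tn.
    by move=> ey; apply: nW; exists t; rewrite // tn em ey.
  case=> [[np _] _ [t _ em]|]; first exact: np em.
  move=> [P' [s' [n [y [y' [f [g [/pk_inj [eP es] em -> ne w]]]]]]]] /requiresE [hf hg].
  rewrite -eP -es in w; have [t [st en ey]] := witness_sound xt hf hg w.
  by rewrite em => Wm; apply: ne; apply: Wfun Wm; exists t; rewrite // en ey.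
apply: X_wf; exists W => //; split=> [n|n y y'].
  have [t st tn] := changes_surjective n ch.
  have Wt : W (pair_code n (x t)) by exists t; rewrite ?tn.
  by exists (x t); split=> // y Wy; apply: Wfun Wy Wt.
move=> [t st /pair_code_inj [nt ->]] [t' st' /pair_code_inj [nt' ->]].
have tt' : t < t'.
  by rewrite ltnNge; apply/negP => tt; have := changes_mono x st' tt; lia.
split; first by apply: le => //; apply: ltnW.
move=> le'; have [_ [an _]] := X_linear (x t) (x t').
have eq u : t <= u -> u <= t' -> x u = x t.
  move=> tu ut'; have [_ [an' _]] := X_linear (x u) (x t); apply: an'; first exact: le.
  have [_ [_ [tr _]]] := X_linear (x t) (x t'); apply: tr le' (le _ _ _ ut'); lia.
have : changes x s t' = changes x s t; last by lia.
have: forall k, t + k <= t' -> changes x s (t + k) = changes x s t.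
  elim=> [|k IH] kt; first by rewrite addn0.
  by rewrite addnS changesS; [rewrite IH ?(eq (t + k).+1) ?(eq (t + k)) ?eqxx ?addn0 //; lia|lia].
by move/(_ (t' - t)); rewrite subnKC ?leqnn; [apply|apply: ltnW].
Qed.

End Settling.

(** * The orders coded by functions *)

(** The stage at which the copy of the [k]-th point in use at stage [t] was made. *)
Definition last_low (r : nat -> nat) (k t : nat) : nat := \max_(s < t.+1 | r s <= k) s.

Section LastLow.

Variable r : nat -> nat.
Hypothesis r_small : forall t, r t <= t.

Lemma last_low_le k t : last_low r k t <= t.
Proof. by apply/bigmax_leqP => s _; have := ltn_ord s; lia. Qed.

Lemma last_low_max k t s : s <= t -> r s <= k -> s <= last_low r k t.
Proof.
move=> st rs; have h : s < t.+1 by lia.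
exact: (leq_bigmax_cond (Ordinal h) (F := fun s : 'I_t.+1 => s : nat)).
Qed.

Lemma last_low_low k t : r (last_low r k t) <= k.
Proof.
have : 0 < #|[pred s : 'I_t.+1 | r s <= k]|.
  by apply/card_gt0P; exists ord0; rewrite inE /=; have := r_small 0; lia.
by case/(eq_bigmax_cond (fun s : 'I_t.+1 => s : nat)) => s; rewrite inE /last_low => rs ->.
Qed.

Lemma last_low_id k t : r t <= k -> last_low r k t = t.
Proof. by move=> rt; have := last_low_le k t; have := last_low_max (leqnn t) rt; lia. Qed.

(** Between [last_low r i t] and [t] no later stage is low for [i], hence none is low for a smaller
    [k]. *)
Lemma last_low_last_low k i t : k <= i -> last_low r k (last_low r i t) = last_low r k t.
Proof.
move=> ki; have h1 := last_low_low k t; have h2 := last_low_le k t.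
have h3 : last_low r k t <= last_low r i t by apply: last_low_max; lia.
have h4 := last_low_max h3 h1; have h5 := last_low_low k (last_low r i t).
have h6 := last_low_le k (last_low r i t); have h7 := last_low_le i t.
have := @last_low_max k t (last_low r k (last_low r i t)); lia.
Qed.

Lemma last_low_step k t : k < r t.+1 -> last_low r k t.+1 = last_low r k t.
Proof.
move=> kr; have h1 := last_low_low k t.+1; have h2 := last_low_le k t.+1.
have h3 : last_low r k t.+1 <= t.
  by move: h2; rewrite leq_eqVlt => /orP [/eqP e|//]; rewrite e in h1; lia.
have h4 := last_low_max h3 h1.
by have := last_low_max (leqW (last_low_le k t)) (last_low_low k t); lia.
Qed.

End LastLow.

Lemma last_low_ext r r' k t : (forall s, s <= t -> r s = r' s) -> last_low r k t = last_low r' k t.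
Proof. by move=> h; apply: eq_bigl => s; rewrite h //; have := ltn_ord s; lia. Qed.

Section CodedOrders.

Variables (D : predilator) (X : set_of_nat) (p : nat -> nat) (e : nat -> nat * seq nat).
Hypothesis X_linear : s_linear (s_le X).
Hypothesis e_element : forall n, element D (e n).
Hypothesis e_chain : forall n i j, i < j -> j < size (e n).2 ->
  s_lt_ord X (nth 0 (e n).2 i) (nth 0 (e n).2 j).
Hypothesis e_dom : forall n (x : nat), x \in (e n).2 -> s_le X x x.
Hypothesis p_inj : injective p.
Hypothesis p_mem : forall t i, i <= t.+1 -> p i \in (e t).2.
Hypothesis p_rule : forall t j h h', j <= t.+1 -> mono h (e t).2 -> mono h' (e t.+1).2 ->
  (forall i, i < j -> h (p i) = h' (p i)) -> h' (p j) < h (p j) -> ~ ble D (e t) h (e t.+1) h'.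

Section Level.

Variable rho : nat -> nat.

Definition level (t : nat) : nat := minn (rho t) t.

Definition side (q a : nat) : nat := if q == a then 1 else if `[< s_lt_ord X q a >] then 0 else 2.

Definition key (x : nat * nat) (k : nat) : nat * nat := (side x.2 (p k), last_low level k x.1).

(* Points are compared by their keys, lexicographically in [k]. Later copies of
   [p k] are smaller, whereas a drop of the level to [k] moves all other points
   upwards, within their side of [p k]. *)
Definition key_lt (a b : nat * nat) : bool :=
  (a.1 < b.1) || (a.1 == b.1) && (if a.1 == 1 then b.2 < a.2 else a.2 < b.2).

(** At stage [t] the points [p i] with [i < level t] keep their old copies, so no new copies of them
    exist. *)
Definition point (x : nat * nat) : Prop :=
  x.2 \in (e x.1).2 /\ forall i, i < level x.1 -> x.2 <> p i.

Definition point_lt (x y : nat * nat) : Prop :=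
  (exists2 i, forall k, k < i -> key x k = key y k & key_lt (key x i) (key y i))
  \/ (forall k, key x k = key y k) /\ s_lt_ord X x.2 y.2.

Definition order_of : set_of_nat := fun z => exists x y,
  [/\ z = pair_code (pair_code x.1 x.2) (pair_code y.1 y.2), point x, point y & x = y \/ point_lt x y].

Lemma key_lt_trans a b c : key_lt a b -> key_lt b c -> key_lt a c.
Proof.
rewrite /key_lt; case: a b c => [a1 a2] [b1 b2] [c1 c2] /=.
move=> /orP [ab|/andP [/eqP ab h]] /orP [bc|/andP [/eqP bc h']]; apply/orP; try (by left; lia).
by right; move: h h'; rewrite ab bc eqxx; case: ifP; lia.
Qed.

Lemma key_lt_irr a : key_lt a a = false.
Proof. by rewrite /key_lt ltnn eqxx /=; case: ifP; rewrite ltnn. Qed.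

Lemma key_lt_total a b : a <> b -> key_lt a b \/ key_lt b a.
Proof.
rewrite /key_lt; case: a b => [a1 a2] [b1 b2] /= ne.
case: (ltngtP a1 b1) => [ab|ab|ab] /=; [by left|by right|]; subst b1.
by case: (ltngtP a2 b2) => [|| ab]; case: ifP; try (by left); try (by right); subst.
Qed.

Lemma point_lt_trans x y z : point_lt x y -> point_lt y z -> point_lt x z.
Proof.
move=> [[i ei li]|[exy xy]] [[j ej lj]|[eyz yz]].
- left; exists (minn i j) => [k kij|]; first by rewrite ei ?ej //; lia.
  case: (ltngtP i j) => ij.
  + by rewrite -ej.
  + by rewrite ei.
  + by subst j; apply: key_lt_trans li lj.
- by left; exists i => [k ki|]; rewrite -?eyz //; apply: ei.
- by left; exists j => [k kj|]; rewrite exy //; apply: ej.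
- by right; split; [move=> k; rewrite exy|apply: s_lt_trans X_linear _ _ _ xy yz].
Qed.

Lemma point_lt_irr x : ~ point_lt x x.
Proof. by move=> [[i _]|[_ []//]]; rewrite key_lt_irr. Qed.

(** At an index beyond both stages every stage counts as low, so the key contains the stage
    itself. *)
Lemma key_same_stage x y : (forall k, key x k = key y k) -> x.1 = y.1.
Proof.
move=> h; have [_] := h (x.1 + y.1); rewrite !last_low_id //; rewrite /level; lia.
Qed.

Lemma point_lt_total x y : point x -> point y -> x <> y -> point_lt x y \/ point_lt y x.
Proof.
move=> px py nxy; have [same|diff] := pselect (forall k, key x k = key y k).
  have est := key_same_stage same.
  have ne : x.2 <> y.2 by move=> eq2; apply: nxy; case: x y est eq2 {px py same} => ? ? [? ?] /= -> ->.
  case: (s_lt_total X_linear (e_dom (proj1 px)) (e_dom (proj1 py)) ne) => h; [left|right]; right => //.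
  by split=> // k; rewrite same.
have ex : exists k, key x k != key y k.
  by move/existsNP: diff => [k nk]; exists k; apply/eqP.
case: (ex_minnP ex) => i /eqP ni mini.
have ei k : k < i -> key x k = key y k.
  by move=> ki; apply/eqP; apply: contraTT ki => /mini; rewrite -leqNgt.
by case: (key_lt_total ni) => li; [left|right]; left; exists i => // k /ei.
Qed.

Lemma order_ofE x y : s_le order_of (pair_code x.1 x.2) (pair_code y.1 y.2) <->
  [/\ point x, point y & x = y \/ point_lt x y].
Proof.
split=> [[x' [y' [/pair_code_inj [/pair_code_inj [e1 e2] /pair_code_inj [e3 e4]] px py h]]]|[px py h]].
  have -> : x = x' by case: x x' e1 e2 {px h} => ? ? [? ?] /= -> ->.
  by have -> : y = y' by case: y y' e3 e4 {py h} => ? ? [? ?] /= -> ->.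
by exists x, y.
Qed.

Lemma order_of_points z z' : s_le order_of z z' ->
  exists x y, z = pair_code x.1 x.2 /\ z' = pair_code y.1 y.2.
Proof. by move=> [x [y [/pair_code_inj [-> ->] _ _ _]]]; exists x, y. Qed.

Lemma order_of_linear : s_linear (s_le order_of).
Proof.
move=> z z'; split.
  move=> h; have [x [y [ex ey]]] := order_of_points h; move: h; rewrite ex ey => /order_ofE [px py _].
  by split; apply/order_ofE; split=> //; left.
split.
  move=> h; have [x [y [ex ey]]] := order_of_points h; move: h; rewrite ex ey => /order_ofE [_ _ h].
  move=> /order_ofE [_ _ h']; case: h => [-> //|h]; case: h' => [-> //|h'].
  by case: (point_lt_irr (point_lt_trans h h')).
split.
  move=> z'' h h'; have [x [y [ex ey]]] := order_of_points h; have [_ [w [_ ew]]] := order_of_points h'.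
  move: h h'; rewrite ex ey ew => /order_ofE [px py h] /order_ofE [_ pw h']; apply/order_ofE; split=> //.
  case: h => [-> //|h]; case: h' => [<-|h']; first by right.
  by right; apply: point_lt_trans h h'.
move=> h h'; have [x [_ [ex _]]] := order_of_points h; have [y [_ [ey _]]] := order_of_points h'.
move: h h'; rewrite ex ey => /order_ofE [px _ _] /order_ofE [py _ _].
have [->|ne] := pselect (x = y); first by left; apply/order_ofE; split=> //; left.
by case: (point_lt_total px py ne) => h; [left|right]; apply/order_ofE; split=> //; right.
Qed.

Lemma order_of_lt x y : point x -> point y -> point_lt x y ->
  s_lt_ord order_of (pair_code x.1 x.2) (pair_code y.1 y.2).
Proof.
move=> px py xy; split; first by apply/order_ofE; split=> //; right.
move=> /pair_code_inj [e1 e2]; apply: (@point_lt_irr x).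
by have {2}-> : x = y by case: x y e1 e2 {px py xy} => ? ? [? ?] /= -> ->.
Qed.

(** The stage of the copy of [q] in use at [t]; points other than the [p i] are renewed at every
    stage. *)
Definition stage_of (t q : nat) : nat :=
  if pselect (exists i, q = p i) is left h then last_low level (sval (cid h)) t else t.

Lemma stage_of_p t i : stage_of t (p i) = last_low level i t.
Proof.
rewrite /stage_of; case: pselect => [h|[]]; last by exists i.
by rewrite -(p_inj (svalP (cid h))).
Qed.

Lemma stage_of_other t q : (forall i, q <> p i) -> stage_of t q = t.
Proof. by move=> h; rewrite /stage_of; case: pselect => // ex; exfalso; case: ex => i /h. Qed.

Definition place (t q : nat) : nat * nat := (stage_of t q, q).

Lemma level_small t : level t <= t. Proof. exact: geq_minr. Qed.

Lemma place_point t q : q \in (e t).2 -> point (place t q).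
Proof.
move=> qe; rewrite /point /=; have [[i eq]|nq] := pselect (exists i, q = p i); last first.
  by rewrite stage_of_other => [|i ei]; [split=> // i _ ei|]; apply: nq; exists i.
subst q; rewrite stage_of_p; split.
  have [ti|it] := leqP t i; first by rewrite last_low_id //; have := level_small t; lia.
  apply: p_mem; have := @last_low_max level i t i ltac:(lia) (level_small i); lia.
by move=> k kl /p_inj ek; have := last_low_low level_small i t; lia.
Qed.

Lemma key_place t q k : (forall i, q = p i -> k <= i) ->
  key (place t q) k = (side q (p k), last_low level k t).
Proof.
move=> h; rewrite /key /=; congr pair; have [[i eq]|nq] := pselect (exists i, q = p i); last first.
  by rewrite stage_of_other // => i ei; apply: nq; exists i.
by rewrite eq stage_of_p last_low_last_low //; [exact: level_small|exact: h].
Qed.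

(** For two copies in use at the same stage, the stage components of the keys agree up to the first
    index at which the sides differ, and the sides follow the order of [X]. *)
Lemma place_lt t q q' : q \in (e t).2 -> q' \in (e t).2 -> s_lt_ord X q q' ->
  point_lt (place t q) (place t q').
Proof.
move=> qe qe' qq; have irr := @s_lt_irr X.
have trans := @s_lt_trans X X_linear.
have diff i : q = p i \/ q' = p i -> side q (p i) != side q' (p i).
  have ne : q != q' by apply/eqP => eq; rewrite eq in qq; case: (irr _ qq).
  by move=> [<-|<-]; rewrite /side eqxx 1?[q' == q]eq_sym (negbTE ne); case: ifP.
have [ex|none] := pselect (exists i, side q (p i) != side q' (p i)); last first.
  have n1 i : q <> p i by move=> eq; apply: none; exists i; apply: diff; left.
  have n2 i : q' <> p i by move=> eq; apply: none; exists i; apply: diff; right.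
  right; split=> // k; rewrite !key_place; try by move=> i; [move/n1|move/n2].
  - by congr pair; apply/eqP; apply: contraT => nk; case: none; exists k.
  - by move=> i /n2.
  - by move=> i /n1.
case: (ex_minnP ex) => i ni mini.
have ki j : q = p j -> i <= j by move=> eq; apply/mini/diff; left.
have ki' j : q' = p j -> i <= j by move=> eq; apply/mini/diff; right.
left; exists i => [k kl|].
  rewrite !key_place; try by move=> j; [move/ki; lia|move/ki'; lia].
  - by congr pair; apply/eqP; apply: contraTT kl => /mini; rewrite -leqNgt.
  - by move=> j /ki'; lia.
  - by move=> j /ki; lia.
rewrite !key_place // /key_lt /=; suff -> : side q (p i) < side q' (p i) by [].
rewrite ltn_neqAle ni /= /side; case: eqP => [eq|ne].
  case: eqP => // ne; case: asboolP => //; rewrite -eq => h; case: (irr _ (trans _ _ _ qq h)).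
case: asboolP => // nlt; case: eqP => [eq|ne']; first by rewrite -eq in nlt.
case: asboolP => // h; by case: nlt; apply: trans qq h.
Qed.

Definition descent : set_of_nat := fun z => exists t a,
  z = pair_code t (pair_code (e t).1 a) /\ lists [seq pair_code (stage_of t q) q | q <- (e t).2] a.

(** Passing from [t] to [t.+1] keeps the copies of [p i] for [i < level t.+1] and makes a smaller
    copy at the index [level t.+1]: this is exactly the situation of [p_rule]. *)
Lemma descent_descends c : (forall t, exists2 a, lists [seq pair_code (stage_of t q) q | q <- (e t).2] a
    & c t = pair_code (e t).1 a) -> bar_descends D order_of c.
Proof.
apply: (@bar_descends_relabel D order_of e (fun t q => pair_code (stage_of t q) q)) => //.
- exact: order_of_linear.
- move=> t i j ij jt; have it := ltn_trans ij jt.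
  apply: (@order_of_lt (place t _) (place t _)); try by apply/place_point/mem_nth.
  by apply: place_lt; [exact: mem_nth..|exact: e_chain].
- move=> t q qe; apply/(order_ofE (place t q) (place t q)); split; try exact: place_point.
  by left.
move=> t h m1 m2 hm; apply: (p_rule (j := level t.+1)) => //; first exact: level_small.
  by move=> i il /=; rewrite !stage_of_p (last_low_step level_small il).
have pt : p (level t.+1) \in (e t).2 by apply: p_mem; apply: level_small.
have pt' : p (level t.+1) \in (e t.+1).2 by apply: p_mem; have := level_small t.+1; lia.
apply: hm.
- by rewrite mem_cat; apply/orP; right; apply: (map_f (fun q => pair_code (stage_of t.+1 q) q)).
- by rewrite mem_cat; apply/orP; left; apply: (map_f (fun q => pair_code (stage_of t q) q)).
apply: (@order_of_lt (place t.+1 _) (place t _)); try exact: place_point.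
left; exists (level t.+1) => [k kl|].
  rewrite !key_place; try by move=> i /p_inj <-; apply: ltnW.
  by rewrite (last_low_step level_small kl).
rewrite /key /place /= !stage_of_p /key_lt /= ltnn eqxx /= {1}/side eqxx /=.
rewrite !(last_low_last_low level_small) // (@last_low_id level _ t.+1) //.
by rewrite ltnS last_low_le.
Qed.

(** * Descending sequences of the coded orders *)

Section Descending.

Variable u : nat -> nat * nat.
Hypothesis u_point : forall n, point (u n).
Hypothesis u_lt : forall n, point_lt (u n.+1) (u n).

Lemma u_lt_trans m n : m < n -> point_lt (u n) (u m).
Proof.
elim: n => // n IH; rewrite ltnS leq_eqVlt => /orP [/eqP -> //|/IH].
exact/point_lt_trans/u_lt.
Qed.

Lemma unbounded_stages m B : ~ forall n, m <= n -> (u n).1 <= B.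
Proof.
move=> hB; pose L := flatten [seq [seq (t, q) | q <- (e t).2] | t <- iota 0 B.+1].
have uL n : m <= n -> u n \in L.
  move=> mn; apply/flatten_mapP; exists (u n).1; first by rewrite mem_iota; have := hB n mn; lia.
  by apply/mapP; exists (u n).2; [case: (u_point n)|case: (u n)].
have /uniq_leq_size : uniq [seq u n | n <- iota m (size L).+1].
  rewrite map_inj_uniq ?iota_uniq // => i j eij; apply/eqP; apply: contraT; rewrite neq_ltn.
  by move=> /orP [] /u_lt_trans; rewrite eij => /point_lt_irr.
move/(_ L); rewrite size_map size_iota => h; suff : (size L).+1 <= size L by lia.
by apply: h => x /mapP [n]; rewrite mem_iota => /andP [mn _] ->; apply: uL.
Qed.

Lemma key_step n j : (forall k, k < j -> key (u n.+1) k = key (u n) k) ->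
  key (u n.+1) j = key (u n) j \/ key_lt (key (u n.+1) j) (key (u n) j).
Proof.
move=> hk; have [[i ei li]|[same _]] := u_lt n; last by left.
case: (ltngtP i j) => [ij|ji|<-]; [|by left; apply: ei|by right].
by rewrite hk // key_lt_irr in li.
Qed.

Lemma eventually_constant (f : nat -> nat) m : (forall n, m <= n -> f n.+1 <= f n) ->
  exists2 m', m <= m' & forall n, m' <= n -> f n = f m'.
Proof.
move=> fd; have mono n n' : m <= n -> n <= n' -> f n' <= f n.
  move=> mn; elim: n' => [|n' IH]; first by rewrite leqn0 => /eqP ->.
  rewrite leq_eqVlt => /orP [/eqP -> //|]; rewrite ltnS => nn'.
  by apply: leq_trans (IH nn'); apply: fd; lia.
have ex : exists v, `[< exists2 n, m <= n & f n = v >] by exists (f m); apply/asboolP; exists m.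
case: (ex_minnP ex) => v /asboolP [m' mm' fm'] minv; exists m' => // n mn.
apply/eqP; rewrite eqn_leq mono //= fm'; apply: minv; apply/asboolP; exists n => //; lia.
Qed.

Lemma bounded_key_constant j m B : (forall t, last_low level j t <= B) ->
  (forall n, m <= n -> forall k, k < j -> key (u n) k = key (u m) k) ->
  exists2 m', m <= m' & forall n, m' <= n -> key (u n) j = key (u m') j.
Proof.
(* [rk] is a rank for the finitely many possible keys; on the side 1 the stage counts backwards, as
   in [key_lt]. *)
move=> lB hk; pose rk (a : nat * nat) := a.1 * B.+1 + (if a.1 == 1 then B - a.2 else a.2).
have rk_lt (a b : nat * nat) : a.2 <= B -> b.2 <= B -> key_lt a b -> rk a < rk b.
  rewrite /rk /key_lt; case: a b => [a1 a2] [b1 b2] /= aB bB /orP [ab|/andP [/eqP -> h]].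
    have : a1.+1 * B.+1 <= b1 * B.+1 by rewrite leq_mul2r ab orbT.
    by rewrite mulSn; case: ifP; case: ifP; lia.
  by move: h; case: ifP; lia.
have step n : m <= n -> key (u n.+1) j = key (u n) j \/ rk (key (u n.+1) j) < rk (key (u n) j).
  move=> mn; have [|->|lt] := @key_step n j; [|by left|by right; apply: rk_lt lt; apply: lB].
  by move=> k kj; rewrite !hk //; lia.
have [|m' mm' cst] := @eventually_constant (fun n => rk (key (u n) j)) m.
  by move=> n /step [->|/ltnW].
exists m' => // n; elim: n => [|n IH]; first by rewrite leqn0 => /eqP ->.
rewrite leq_eqVlt => /orP [/eqP <- //|]; rewrite ltnS => mn.
by rewrite -IH //; case: (step n ltac:(lia)) => //; rewrite !cst //; lia.
Qed.

(** Let [i] be least such that the level is at most [i] infinitely often. The keys below [i] have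
    bounded stages, so they settle. At [i] the side settles too, and by hypothesis not at equality.
    From then on the stage component cannot increase, although each later drop of the level to [i]
    raises it for all newer points; so the stages would be bounded. *)
Lemma descending_tends : (forall i m, exists2 n, m <= n & (u n).2 <> p i) -> tends_to_infinity rho.
Proof.
move=> hQ; apply: contrapT => /existsNP [i0 /forallNP ni0].
pose P i := forall s, exists2 t, s <= t & level t <= i.
have Pi0 : P i0.
  move=> s; have /existsNP [t /not_implyP [st /negP nt]] := ni0 s; exists t => //; rewrite /level; lia.
have ex : exists i, `[< P i >] by exists i0; apply/asboolP.
case: (ex_minnP ex) => i /asboolP Pi mini.
have low k : k < i -> exists B, forall t, last_low level k t <= B.
  move=> ki; have /existsNP [s hs] : ~ P k.
    by move/asboolP/mini; lia.
  exists s => t; rewrite leqNgt; apply/negP => lt; apply: hs; exists (last_low level k t).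
    exact: ltnW.
  exact/last_low_low/level_small.
have cst : exists m, forall n, m <= n -> forall k, k < i -> key (u n) k = key (u m) k.
  have main j : j <= i -> exists m, forall n, m <= n -> forall k, k < j -> key (u n) k = key (u m) k.
    elim: j => [|j IH] ji; first by exists 0.
    have [m hm] := IH (ltnW ji); have [B hB] := low j ji.
    have [m' mm' hm'] := bounded_key_constant hB hm; exists m' => n mn k.
    rewrite ltnS leq_eqVlt => /orP [/eqP ->|kj]; first exact: hm'.
    by rewrite hm ?[in RHS]hm //; lia.
  exact: main (leqnn i).
have [m hm] := cst.
have step n : m <= n -> key (u n.+1) i = key (u n) i \/ key_lt (key (u n.+1) i) (key (u n) i).
  by move=> mn; apply: key_step => k ki; rewrite !hm //; lia.
have [|m1 mm1 h1] := @eventually_constant (fun n => (key (u n) i).1) m.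
  by move=> n /step [->|/orP [/ltnW|/andP [/eqP -> _]]].
have n1 : (key (u m1) i).1 != 1.
  have [n mn /eqP nq] := hQ i m1.
  by rewrite -(h1 n mn) /= /side (negbTE nq); case: ifP.
have [|m2 mm2 h2] := @eventually_constant (fun n => (key (u n) i).2) m1.
  move=> n mn; have [->|/orP [lt|/andP [_]]] := step n ltac:(lia); [exact: leqnn| |].
    by move: lt; rewrite !h1 ?ltnn //; lia.
  by rewrite h1 ?(negbTE n1); [exact: ltnW|lia].
have [t0 /= lt0 lev] := Pi (key (u m2) i).2.+1.
apply: (@unbounded_stages m2 t0) => n mn; rewrite leqNgt; apply/negP => tn.
have := last_low_max (ltnW tn) lev; have := h2 n mn; rewrite /= => ->; lia.
Qed.

(** Copies of [p i] are made only at stages of level at most [i]. If [rho] tends to infinity, there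
    are finitely many of these. *)
Lemma tends_descending : tends_to_infinity rho -> forall i m, exists2 n, m <= n & (u n).2 <> p i.
Proof.
move=> tot i m; apply: contrapT => none.
have eqp n : m <= n -> (u n).2 = p i by move=> mn; apply: contrapT => ne; apply: none; exists n.
have [s hs] := tot i.+1; apply: (@unbounded_stages m (maxn s i)) => n mn.
rewrite leqNgt; apply/negP => lt; have [_ h] := u_point n.
by apply: (h i _ (eqp n mn)); rewrite /level; have := hs (u n).1 ltac:(lia); lia.
Qed.

End Descending.

Definition coded_descent (O A : set_of_nat) : Prop :=
  [/\ forall n, exists x, A (pair_code n x),
    forall n x y, A (pair_code n x) -> A (pair_code n y) -> x = y
  & forall n x y, A (pair_code n x) -> A (pair_code n.+1 y) -> s_lt_ord O y x].

Lemma coded_descent_points A : coded_descent order_of A -> exists u : nat -> nat * nat,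
  [/\ forall n, A (pair_code n (pair_code (u n).1 (u n).2)), forall n, point (u n)
    & forall n, point_lt (u n.+1) (u n)].
Proof.
move=> [tot _ desc]; have [x hx] := choice tot.
have ex n : exists v : nat * nat, x n = pair_code v.1 v.2.
  have [h _] := desc n _ _ (hx n) (hx n.+1); have [_ [v [_ ev]]] := order_of_points h.
  by exists v.
have [u hu] := choice ex.
have lt n : [/\ point (u n.+1), point (u n) & point_lt (u n.+1) (u n)].
  have [h ne] := desc n _ _ (hx n) (hx n.+1); move: h ne; rewrite !hu => h ne.
  have [p1 p2 [e12|//]] := proj1 (order_ofE _ _) h; by rewrite e12 in ne.
by exists u; split=> n; [rewrite -hu|case: (lt n)|case: (lt n)].
Qed.

(** Every part survives limits: totality and the avoidance of each [p i] are conjunctions of facts,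
    and the other clauses can be refuted by finitely many bits. *)
Definition good (A : set_of_nat) : Prop := coded_descent order_of A /\
  forall i m, exists n t q, [/\ m <= n, A (pair_code n (pair_code t q)) & q <> p i].

Lemma good_tends A : good A -> tends_to_infinity rho.
Proof.
move=> [cd hQ]; have [u [uA up ul]] := coded_descent_points cd; have [_ single _] := cd.
apply: (descending_tends up ul) => i m; have [n [t [q [mn An nq]]]] := hQ i m.
exists n => //; have /pair_code_inj [_ ->] := single _ _ _ (uA n) An; exact: nq.
Qed.

Lemma tends_good A : tends_to_infinity rho -> coded_descent order_of A -> good A.
Proof.
move=> tot cd; split=> // i m; have [u [uA up ul]] := coded_descent_points cd.
by have [n mn nq] := tends_descending up ul tot i m; exists n, (u n).1, (u n).2.
Qed.

End Level.

(** A pair code bounds its components, so numbers below [n] mention only stages below [n]. *)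
Lemma order_of_local rho rho' n : (forall s, s < n -> rho s = rho' s) ->
  forall z, z < n -> order_of rho z -> order_of rho' z.
Proof.
move=> h z zn [x [y [ez [xe xp] [ye yp] xy]]]; exists x, y.
have [xn yn] : x.1 < n /\ y.1 < n by move: zn; rewrite ez /pair_code; nia.
have lev s : s < n -> level rho s = level rho' s by move=> sn; rewrite /level h.
have ll k t : t < n -> last_low (level rho) k t = last_low (level rho') k t.
  by move=> tn; apply: last_low_ext => s st; apply: lev; lia.
have kx k : key rho' x k = key rho x k by rewrite /key ll.
have ky k : key rho' y k = key rho y k by rewrite /key ll.
split=> //; [by split=> // i; rewrite -lev //; apply: xp|by split=> // i; rewrite -lev //; apply: yp|].
case: xy => [|[[i ei li]|[e' lt]]]; first by left.
  by right; left; exists i => [k ki|]; rewrite kx ky //; apply: ei.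
by right; right; split=> // k; rewrite kx ky.
Qed.

Lemma descent_local rho rho' n : (forall s, s < n -> rho s = rho' s) ->
  forall z, z < n -> descent rho z -> descent rho' z.
Proof.
move=> h z zn [t [a [ez la]]]; exists t, a; split=> //.
have tn : t < n by move: zn; rewrite ez /pair_code; nia.
suff -> : [seq pair_code (stage_of rho' t q) q | q <- (e t).2] =
  [seq pair_code (stage_of rho t q) q | q <- (e t).2] by [].
apply: eq_map => q; congr pair_code; rewrite /stage_of; case: pselect => // i.
by apply: last_low_ext => s st; rewrite /level h //; lia.
Qed.

Variable C : set_of_nat.

Definition start (rho : nat -> nat) : real :=
  join (join (fun z => `[< order_of rho z >]) (fun z => `[< descent rho z >])) (fun z => `[< C z >]).

Lemma start_continuous rho m : exists n, forall rho',
  (forall i, i < n -> rho i = rho' i) -> agree m (start rho) (start rho').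
Proof.
exists m => rho' h i im; have h' s : s < m -> rho' s = rho s by move=> /h.
rewrite /start /join; case: (odd i) => //; case: (odd i./2).
  by apply: asbool_equiv_eq; split; apply: descent_local; try exact: h; try exact: h'; lia.
by apply: asbool_equiv_eq; split; apply: order_of_local; try exact: h; try exact: h'; lia.
Qed.

End CodedOrders.

(** * Formulas as natural numbers *)

Fixpoint term_tree (t : term) : GenTree.tree nat :=
  match t with
  | TVar i => GenTree.Leaf i
  | TZero => GenTree.Node 0 [::]
  | TOne => GenTree.Node 1 [::]
  | TAdd t u => GenTree.Node 2 [:: term_tree t; term_tree u]
  | TMul t u => GenTree.Node 3 [:: term_tree t; term_tree u]
  end.

Fixpoint tree_term (x : GenTree.tree nat) : term :=
  match x with
  | GenTree.Leaf i => TVar i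
  | GenTree.Node 0 _ => TZero
  | GenTree.Node 2 [:: t; u] => TAdd (tree_term t) (tree_term u)
  | GenTree.Node 3 [:: t; u] => TMul (tree_term t) (tree_term u)
  | _ => TOne
  end.

Lemma term_treeK : cancel term_tree tree_term.
Proof. by elim=> //= t -> u ->. Qed.

Fixpoint formula_tree (A : formula) : GenTree.tree nat :=
  match A with
  | FEq t u => GenTree.Node 0 [:: term_tree t; term_tree u]
  | FLt t u => GenTree.Node 1 [:: term_tree t; term_tree u]
  | FIn t X => GenTree.Node 2 [:: term_tree t; GenTree.Leaf X]
  | FBot => GenTree.Node 3 [::]
  | FImp A B => GenTree.Node 4 [:: formula_tree A; formula_tree B]
  | FAnd A B => GenTree.Node 5 [:: formula_tree A; formula_tree B]
  | FOr A B => GenTree.Node 6 [:: formula_tree A; formula_tree B]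
  | FAll A => GenTree.Node 7 [:: formula_tree A]
  | FEx A => GenTree.Node 8 [:: formula_tree A]
  | FAll2 A => GenTree.Node 9 [:: formula_tree A]
  | FEx2 A => GenTree.Node 10 [:: formula_tree A]
  end.

Fixpoint tree_formula (x : GenTree.tree nat) : formula :=
  match x with
  | GenTree.Node 0 [:: t; u] => FEq (tree_term t) (tree_term u)
  | GenTree.Node 1 [:: t; u] => FLt (tree_term t) (tree_term u)
  | GenTree.Node 2 [:: t; GenTree.Leaf X] => FIn (tree_term t) X
  | GenTree.Node 4 [:: A; B] => FImp (tree_formula A) (tree_formula B)
  | GenTree.Node 5 [:: A; B] => FAnd (tree_formula A) (tree_formula B)
  | GenTree.Node 6 [:: A; B] => FOr (tree_formula A) (tree_formula B)
  | GenTree.Node 7 [:: A] => FAll (tree_formula A)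
  | GenTree.Node 8 [:: A] => FEx (tree_formula A)
  | GenTree.Node 9 [:: A] => FAll2 (tree_formula A)
  | GenTree.Node 10 [:: A] => FEx2 (tree_formula A)
  | _ => FBot
  end.

Lemma formula_treeK : cancel formula_tree tree_formula.
Proof. by elim=> [t u|t u|t X||A IHA B IHB|A IHA B IHB|A IHA B IHB|A IH|A IH|A IH|A IH] //=;
  rewrite ?term_treeK ?IHA ?IHB ?IH. Qed.

(** * Facts about reals that express closure conditions *)

Definition local (Q : real -> Prop) : Prop :=
  forall Z, exists n, forall Z', agree n Z Z' -> (Q Z <-> Q Z').

Lemma delta00_local M A (f : real -> nat -> nat -> Prop) : delta00 A ->
  (forall i n, local (fun Z => f Z i n)) -> forall v, local (fun Z => sat M v (f Z) A).
Proof.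
move=> dA lf; have lbin (op : Prop -> Prop -> Prop) Q Q' :
    (forall P P' R R', (P <-> P') -> (R <-> R') -> (op P R <-> op P' R')) ->
    local Q -> local Q' -> local (fun Z => op (Q Z) (Q' Z)).
  move=> hop lQ lQ' Z; have [n hn] := lQ Z; have [m hm] := lQ' Z.
  exists (maxn n m) => Z' ag; apply: hop; [apply: hn|apply: hm]; apply: agreeW ag; lia.
have lall (b : nat) (Q : nat -> real -> Prop) : (forall x, local (Q x)) ->
    forall Z, exists n, forall Z', agree n Z Z' -> forall x, x < b -> (Q x Z <-> Q x Z').
  move=> lQ Z; have ex x : exists n, forall Z', agree n Z Z' -> (Q x Z <-> Q x Z') by apply: lQ.
  have [u hu] := choice ex; exists (\max_(x < b) u x) => Z' ag x xb; apply: hu; apply: agreeW ag.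
  exact: (leq_bigmax (Ordinal xb) (F := fun x : 'I_b => u x)).
elim: dA => [t u|t u|t X||B C _ IHB _ IHC|B C _ IHB _ IHC|B C _ IHB _ IHC|t B _ IH|t B _ IH] v /=.
- by move=> Z; exists 0.
- by move=> Z; exists 0.
- exact: lf.
- by move=> Z; exists 0.
- by apply: (lbin (fun P R => P -> R)) (IHB v) (IHC v); tauto.
- by apply: (lbin and) (IHB v) (IHC v); tauto.
- by apply: (lbin or) (IHB v) (IHC v); tauto.
- move=> Z; have [n hn] := lall (teval v t) _ (fun x => IH (scons x v)) Z; exists n => Z' ag.
  by split=> h x; rewrite teval_shift => xt; apply/(hn Z' ag x xt)/h; rewrite teval_shift.
- move=> Z; have [n hn] := lall (teval v t) _ (fun x => IH (scons x v)) Z; exists n => Z' ag.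
  by split=> -[x []]; rewrite teval_shift => xt /(hn Z' ag x xt) hx; exists x; rewrite teval_shift.
Qed.

Lemma local_open Q : local Q -> openp Q /\ openp (fun Z => ~ Q Z).
Proof.
by move=> lQ; split=> Z qZ; have [n hn] := lQ Z; exists n => Z' /hn; tauto.
Qed.

Definition no_model : (nat -> Prop) -> Prop := fun=> False.

Definition oracle_sets (ps : seq (seq bool)) (Z : real) (i n : nat) : Prop :=
  proj (nth [::] ps i) Z n.

(* The right half of the oracle differs from the set defined by [FEx A]
   and [FAll B]. *)
Definition differs (A B : formula) (s : seq nat) (ps : seq (seq bool)) (W : real) : Prop :=
  exists m n, ~ sat no_model (scons n (scons m (nth 0 s))) (oracle_sets ps (lh W)) B /\ rh W m \/
    sat no_model (scons n (scons m (nth 0 s))) (oracle_sets ps (lh W)) A /\ ~ rh W m.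

Definition leaves (p : seq bool) (W : real) : Prop :=
  exists n a, [/\ s_string n a, forall i, i < n -> (s_mem i a <-> rh W i)
    & ~ proj p (lh W) (pair_code n a)].

Definition entry (p : seq bool) (n : nat) (Z : real) : Prop := exists x, proj p Z (pair_code n x).

Definition entry_avoiding (pt : nat -> nat) (p : seq bool) (i m : nat) (Z : real) : Prop :=
  exists n t q, [/\ m <= n, proj p Z (pair_code n (pair_code t q)) & q <> pt i].

Lemma openp_or O O' : openp O -> openp O' -> openp (fun Z => O Z \/ O' Z).
Proof.
by move=> h h' A [/h|/h'] [n hn]; exists n => B /hn; [left|right].
Qed.

Lemma differs_open A B s ps : delta00 A -> delta00 B -> openp (differs A B s ps).
Proof.
have lset i n : local (fun W => oracle_sets ps (lh W) i n).
  move=> W; exists (pidx (nth [::] ps i) n).*2.+1 => W' ag.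
  by rewrite /oracle_sets !projE /lh ag.
have bit (m : nat) : openp (fun W => rh W m) /\ openp (fun W => ~ rh W m).
  by apply: local_open => W; exists m.*2.+2 => W' ag; rewrite /rh ag.
move=> dA dB; apply: openp_ex => m; apply: openp_ex => n.
have [oA _] := local_open (delta00_local no_model dA lset (scons n (scons m (nth 0 s)))).
have [_ oB] := local_open (delta00_local no_model dB lset (scons n (scons m (nth 0 s)))).
by apply: openp_or; apply: openp_and => //; apply bit.
Qed.

Lemma leaves_open p : openp (leaves p).
Proof.
move=> W [n [a [sa ha na]]]; exists (maxn n.*2 (pidx p (pair_code n a)).*2.+1) => W' ag.
exists n, a; split=> // [i i_n|]; first by rewrite ha // /rh ag //; lia.
by move: na; rewrite !projE /lh ag //; lia.
Qed.

Lemma entry_open p n : openp (entry p n).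
Proof.
apply: openp_ex => x; apply: (openp_equiv (O := fun Z => Z (pidx p (pair_code n x)) = true)).
  by move=> Z; rewrite projE.
exact: openp_bit.
Qed.

Lemma entry_avoiding_open pt p i m : openp (entry_avoiding pt p i m).
Proof.
apply: openp_ex => n; apply: openp_ex => t; apply: openp_ex => q Z [mn hp hq]; rewrite projE in hp.
by exists (pidx p (pair_code n (pair_code t q))).+1 => Z' ag; split; rewrite ?projE -?ag.
Qed.

Definition fact_index : Type := ((GenTree.tree nat * GenTree.tree nat) * (seq nat * seq (seq bool)) +
  (seq bool + (seq bool * nat + seq bool * (nat * nat))))%type.

(** The guard on the two formulas makes the predicate open for every index. *)
Definition fact_of (pt : nat -> nat) (x : fact_index) : real -> Prop :=
  match x with
  | inl ((a, b), (s, ps)) => fun W =>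
      (delta00 (tree_formula a) /\ delta00 (tree_formula b)) /\
      differs (tree_formula a) (tree_formula b) s ps W
  | inr (inl p) => leaves p
  | inr (inr (inl (p, n))) => entry p n
  | inr (inr (inr (p, (i, m)))) => entry_avoiding pt p i m
  end.

Lemma fact_of_open pt x : openp (fact_of pt x).
Proof.
case: x => [[[a b] [s ps]]|[p|[[p n]|[p [i m]]]]] /=.
- by move=> W [[da db]] /(differs_open da db) [n hn]; exists n => W' /hn.
- exact: leaves_open.
- exact: entry_open.
- exact: entry_avoiding_open.
Qed.

Record rich (fam : nat -> real -> Prop) (pt : nat -> nat) : Prop := Rich {
  rich_differs : forall A B s ps, delta00 A -> delta00 B ->
    exists e, forall W, fam e W <-> differs A B s ps W;
  rich_leaves : forall p, exists e, forall W, fam e W <-> leaves p W;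
  rich_entry : forall p n, exists e, forall Z, fam e Z <-> entry p n Z;
  rich_avoiding : forall p i m, exists e, forall Z, fam e Z <-> entry_avoiding pt p i m Z }.

Lemma rich_family_exists pt : exists fam bitf grf cf subf qf,
  closed_family fam bitf grf cf subf qf /\ rich fam pt.
Proof.
pose base n := if @choice.unpickle fact_index n is Some x then fact_of pt x else fun=> False.
have obase n : openp (base n).
  by rewrite /base; case: choice.unpickle => [x|]; [exact: fact_of_open|exact: openp_const].
have [fam [bitf [grf [cf [subf [qf [clf hb]]]]]]] := closed_family_exists obase.
have fact x : exists e, fam e = fact_of pt x.
  by have [e he] := hb (choice.pickle x); exists e; rewrite he /base choice.pickleK.
exists fam, bitf, grf, cf, subf, qf; split=> //; split.
- move=> A B s ps dA dB; have [e he] := fact (inl ((formula_tree A, formula_tree B), (s, ps))).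
  by exists e => W; rewrite he /= !formula_treeK; split=> [[]|].
- by move=> p; have [e he] := fact (inr (inl p)); exists e => W; rewrite he.
- by move=> p n; have [e he] := fact (inr (inr (inl (p, n)))); exists e => W; rewrite he.
- by move=> p i m; have [e he] := fact (inr (inr (inr (p, (i, m))))); exists e => W; rewrite he.
Qed.

(** * Omega-models from ideals of reals *)

Lemma fclosed_bound A : exists n, forall d e, n <= d -> n <= e -> fclosed d e A.
Proof.
have tb t : exists n, forall d, n <= d -> tclosed d t.
  elim: t => [i|||t [n hn] u [m hm]|t [n hn] u [m hm]]; try by exists 0.
  - by exists i.+1.
  - by exists (maxn n m) => d h; rewrite /= hn ?hm //; lia.
  - by exists (maxn n m) => d h; rewrite /= hn ?hm //; lia.
elim: A => [t u|t u|t X||A [n hn] B [m hm]|A [n hn] B [m hm]|A [n hn] B [m hm]|A [n hn]|A [n hn]|A [n hn]|A [n hn]].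
- by have [[n hn] [m hm]] := (tb t, tb u); exists (maxn n m) => d e h h'; rewrite /= hn ?hm //; lia.
- by have [[n hn] [m hm]] := (tb t, tb u); exists (maxn n m) => d e h h'; rewrite /= hn ?hm //; lia.
- by have [n hn] := tb t; exists (maxn n X.+1) => d e h h'; rewrite /= hn //; lia.
- by exists 0.
- by exists (maxn n m) => d e h h'; rewrite /= hn ?hm //; lia.
- by exists (maxn n m) => d e h h'; rewrite /= hn ?hm //; lia.
- by exists (maxn n m) => d e h h'; rewrite /= hn ?hm //; lia.
- by exists n => d e h h'; apply: hn; lia.
- by exists n => d e h h'; apply: hn; lia.
- by exists n => d e h h'; apply: hn; lia.
- by exists n => d e h h'; apply: hn; lia.
Qed.

Lemma delta00_model M M' A v V : delta00 A -> (sat M v V A <-> sat M' v V A).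
Proof.
move=> dA; elim: dA v => [t u|t u|t X||B C _ IHB _ IHC|B C _ IHB _ IHC|B C _ IHB _ IHC|t B _ IH|t B _ IH] v //=.
- by rewrite IHB IHC.
- by rewrite IHB IHC.
- by rewrite IHB IHC.
- by split=> h x hx; apply/IH/h.
- by split=> -[x [hx /IH h]]; exists x.
Qed.

Lemma string_bound n a : s_string n a -> a < 2 ^ n.
Proof.
move=> sa; rewrite ltnNge; apply/negP => h.
have [j bj] : exists j, bit j (a %/ 2 ^ n).
  apply: contrapT => none; have : a %/ 2 ^ n = 0.
    apply: bit_inj => i; rewrite {2}/bit div0n /=; apply/negbTE/negP => bi.
    by apply: none; exists i.
  have : 0 < a %/ 2 ^ n by rewrite divn_gt0 ?expn_gt0.
  by lia.
have : s_mem (n + j) a by apply/s_memE; move: bj; rewrite /bit -divnMA -expnD.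
by move/sa; lia.
Qed.

(** If every real left the tree, all would do so within one length [b]. Strings of length at most
    [b] have bounded codes, so the infinite tree contains a longer one, and the real given by its
    digits does not leave within [b]. *)
Lemma binary_tree_path (T : real) : s_binary_tree (fun n => T n) -> s_infinite (fun n => T n) ->
  exists P, ~ leaves [::] (join T P).
Proof.
move=> [Tcode Tdown] Tinf; apply: contrapT => /forallNP none.
pose Q b (P : real) := exists m a, [/\ m <= b, s_string m a,
  forall i, i < m -> (s_mem i a <-> P i) & ~ T (pair_code m a)].
have [b hb] : exists b, forall B, exists2 n, n <= b & Q n B.
  apply: fan => B; have [n [a [sa ha na]]] : leaves [::] (join T B) by apply: contrapT; apply: none.
  rewrite rh_join in ha; rewrite lh_join in na.
  by exists n => B' ag; exists n, a; split=> // i i_n; rewrite ha // ag.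
have [c [cbig Tc]] := Tinf (\max_(n < b.+1) pair_code n (2 ^ b)).
have [n [a [ec sa]]] := Tcode c Tc; subst c.
have bn : b < n.
  rewrite ltnNge; apply/negP => nb; have nb' : n < b.+1 by [].
  have := leq_bigmax (Ordinal nb') (F := fun n : 'I_b.+1 => pair_code n (2 ^ b)).
  have := string_bound sa; have : 2 ^ n <= 2 ^ b by rewrite leq_exp2l.
  by move: cbig; rewrite /= /pair_code; nia.
have [n' nb' [m [a' [mn' sa' ha' na']]]] := hb (fun i => bit i a).
apply: na'; apply: (Tdown n a) => //; first by left; lia.
by move=> i im; rewrite ha' // s_memE.
Qed.

Section Ideal.

Variable fam : nat -> real -> Prop.
Variables (bitf grf : nat -> nat) (cf : seq nat -> nat).
Variables (subf : trans -> nat -> nat).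
Variable (qf : seq bool -> seq nat * seq nat -> nat * nat -> nat).
Variable pt : nat -> nat.
Hypothesis clf : closed_family fam bitf grf cf subf qf.
Hypothesis fam_rich : rich fam pt.

Variable Z : nat -> real.
Hypothesis Z_lh : forall k, lh (Z k.+1) = Z k.
Hypothesis Z_basis : forall k e, ~ fam (cf [:: e]) (Z k) ->
  exists2 k', k <= k' & ~ fam e (join (Z k) (rh (Z k'.+1))).
Hypothesis Z_ramsey : forall k p, exists k' i, [/\ k <= k', unbounded (rh (Z k'.+1))
  & forall x y, rh (Z k'.+1) x -> rh (Z k'.+1) y -> x < y -> col p (Z k) x y = i].

Definition ideal (X : nat -> Prop) : Prop := exists k p, forall n, X n <-> proj p (Z k) n.

Lemma proj_up p k k' : k <= k' -> proj (nseq (k' - k) false ++ p) (Z k') = proj p (Z k).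
Proof.
move=> kk; rewrite -{2}(subnKC kk); move: (k' - k) => d.
by elim: d => [|d IH]; [rewrite addn0|rewrite addnS /= Z_lh].
Qed.

Lemma ideal_eq X : ideal X <-> exists k p, X = fun n => proj p (Z k) n.
Proof.
split=> -[k [p h]]; exists k, p; last by rewrite h.
by apply: funext => n; apply: propext.
Qed.

Lemma ideal_proj p k : ideal (fun n => proj p (Z k) n).
Proof. by exists k, p. Qed.

Lemma ideal_rh k : ideal (fun n => rh (Z k) n).
Proof. exact: (ideal_proj [:: true] k). Qed.

(** Recursive comprehension and weak Koenig's lemma both ask for a real that avoids an open fact. It
    suffices to find one outside of the ideal. *)
Lemma separation k e : (exists P, ~ fam e (join (Z k) P)) ->
  exists2 X : real, ideal (fun n => X n) & ~ fam e (join (Z k) X).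
Proof.
move=> [P nP]; have [|k' _ h] := @Z_basis k e.
  by move/(fam_all clf) => /(_ P) [e']; rewrite inE => /eqP ->.
by exists (rh (Z k'.+1)) => //; apply: ideal_rh.
Qed.

Lemma ideal_join_all n (V : nat -> nat -> Prop) : (forall i, ideal (V i)) ->
  exists k ps, forall i, i < n -> oracle_sets ps (Z k) i = V i.
Proof.
move=> hV; have [k hk] := choice hV; have [p hp] := choice hk.
pose K := \max_(i < n) k i.
exists K, (mkseq (fun i => nseq (K - k i) false ++ p i) n) => i i_n.
apply: funext => m; apply: propext; rewrite /oracle_sets nth_mkseq // proj_up -?hp //.
exact: (leq_bigmax (Ordinal i_n) (F := fun i : 'I_n => k i)).
Qed.

Lemma ideal_comprehension A B : sigma01 A -> pi01 B -> models ideal (comprehension_axiom A B).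
Proof.
move=> [A0 dA ->] [B0 dB ->] v V hV /= AB.
have [nA hA] := fclosed_bound A0; have [nB hB] := fclosed_bound B0.
pose n := maxn nA nB; have [k [ps hps]] := ideal_join_all n hV.
have eqA a m : sat ideal (scons a (scons m v)) V A0 <->
    sat no_model (scons a (scons m (nth 0 (mkseq v n)))) (oracle_sets ps (Z k)) A0.
  rewrite (delta00_model no_model ideal) //.
  apply: (@sat_closed _ _ n.+2 n); [by apply: hA; rewrite /n; lia| |by move=> i /hps].
  by move=> [|[|i]] //= i_n; rewrite nth_mkseq.
have eqB a m : sat ideal (scons a (scons m v)) V B0 <->
    sat no_model (scons a (scons m (nth 0 (mkseq v n)))) (oracle_sets ps (Z k)) B0.
  rewrite (delta00_model no_model ideal) //.
  apply: (@sat_closed _ _ n.+2 n); [by apply: hB; rewrite /n; lia| |by move=> i /hps].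
  by move=> [|[|i]] //= i_n; rewrite nth_mkseq.
have [e he] := rich_differs fam_rich (mkseq v n) ps dA dB.
have [|X IX nX] := @separation k e.
  exists (fun m => `[< exists a, sat ideal (scons a (scons m v)) V A0 >]).
  move/he; rewrite /differs rh_join lh_join => -[m [a [[nBa /asboolP h]|[Aa nh]]]].
    by apply: nBa; apply/eqB; apply: (proj1 (AB m)).
  by apply: nh; apply/asboolP; exists a; apply/eqA.
exists (fun m => X m) => // m.
have E := sat_shift2 ideal (fun m => X m) (scons m v) V (FEx A0).
split=> [Xm|/E [a ha]].
  apply/E/(proj2 (AB m)) => a; apply/eqB; apply: contrapT => nBa.
  by apply/nX/he; exists m, a; left; rewrite lh_join rh_join.
apply: contrapT => nXm; apply/nX/he; exists m, a; right; rewrite lh_join rh_join; split=> //.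
exact/eqA.
Qed.

Lemma ideal_RCA0 : models_theory ideal RCA0.
Proof. exact: models_RCA0 ideal_comprehension. Qed.

Lemma ideal_weak_konig : models_theory ideal (eq weak_konig).
Proof.
move=> _ <- v V _; apply/sat_weak_konig => T /ideal_eq [k [p ->]] tr iT.
have [P nP] := binary_tree_path tr iT; have [e he] := rich_leaves fam_rich p.
have [|X IX nX] := @separation k e.
  exists P => /he [n [a [sa ha na]]]; apply: nP; rewrite lh_join rh_join in ha na.
  by exists n, a; rewrite lh_join rh_join.
exists (fun n => X n) => // n.
pose a := finite_code [seq i <- iota 0 n | X i].
have ba i : s_mem i a <-> i < n /\ X i.
  by rewrite s_memE bit_finite_code mem_filter mem_iota /= andbC; split=> /andP.
exists a; split; first by move=> i /ba [].
split; first by move=> i i_n; rewrite ba; tauto.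
apply: contrapT => nT; apply/nX/he; exists n, a; rewrite lh_join rh_join; split=> //.
  by move=> i /ba [].
by move=> i i_n; rewrite ba; tauto.
Qed.

Lemma ideal_ramsey : models_theory ideal RT22.
Proof.
move=> _ <- v V _; apply/sat_ramsey22 => C /ideal_eq [k [p ->]] hC.
have [k' [i [_ unb hom]]] := Z_ramsey k p.
exists (fun n => rh (Z k'.+1) n); first exact: ideal_rh.
split; first by move=> n; have [x nx hx] := unb n.+1; exists x.
exists i => x y hx hy xy; have [j [j1 [Cj uj]]] := hC x y xy.
have := hom x y hx hy xy; rewrite /col; case: i {hom} => /= hi; first by rewrite hi.
have [ej|ej] : j = 0 \/ j = 1 by lia.
  by rewrite -ej.
by rewrite ej hi in Cj.
Qed.

Lemma ideal_theory : models_theory ideal (tplus (tplus WKL0 RT22) PA).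
Proof.
apply: models_tplus; last exact: models_PA.
apply: models_tplus; last exact: ideal_ramsey.
by apply: models_tplus; [exact: ideal_RCA0|exact: ideal_weak_konig].
Qed.

End Ideal.

(** * The contradiction *)

Lemma peval_unique p : forall xs y y', peval p xs y -> peval p xs y' -> y = y'.
Proof.
elim: p => [i||p IHp|p IHp q IHq|p IHp b IHb s IHs|p IHp] xs y y' /=.
- by move=> -> ->.
- by move=> -> ->.
- by move=> [z hz ->] [z' hz' ->]; rewrite (IHp _ _ _ hz hz').
- by move=> [z hz hq] [z' hz' hq']; apply: IHq hq _; rewrite (IHp _ _ _ hz hz').
- move=> [n [hn [h [h0 hS hy]]]] [n' [hn' [h' [h0' hS' hy']]]].
  have en := IHp _ _ _ hn hn'; subst n'.
  have eh k : k <= n -> h k = h' k.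
    elim: k => [|k IH] kn; first exact: IHb h0 h0'.
    apply: IHs (hS k kn) _; rewrite IH; [exact: hS'|exact: ltnW].
  by rewrite -hy -hy' eh.
- move=> [h0 h] [h0' h']; case: (ltngtP y y') => // lt.
    by have [z hz] := h' y lt; have := IHp _ _ _ h0 hz.
  by have [z hz] := h y' lt; have := IHp _ _ _ h0' hz.
Qed.

Lemma computes_unique p C C' : computes p C -> computes p C' -> C = C'.
Proof.
move=> h h'; apply: funext => x; apply: propext.
case: (h x) (h' x) => -[Cx px] [] [C'x px'] //; split=> //.
  by have := peval_unique px px'.
by have := peval_unique px px'.
Qed.

Lemma conv_fact fam (S : nat -> Prop) Zn Z e : inf S -> conv fam S Zn Z ->
  (forall n, S n -> fam e (Zn n)) -> fam e Z.
Proof. by move=> iS cZ h; have [n [Sn hn]] := inf_ev iS (cZ e); apply/hn/h. Qed.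

Section Main.

Variables (phi : formula) (D : predilator) (p : prog).
Hypothesis phi_provable : proves (tplus (tplus WKL0 RT22) PA) phi.
Hypothesis p_computes_D : computes p (code D).
Hypothesis equivalent : proves (tplus RCA0 PA) (FIff phi (dilator_sentence p)).

Lemma theory_dilator N C : models_theory N (tplus (tplus WKL0 RT22) PA) -> N C ->
  s_dilator N (code D).
Proof.
move=> hN NC; have NR : models_theory N (tplus RCA0 PA).
  by move=> A [RA|PA_]; apply: hN; [left; left; left|right].
pose v (_ : nat) := 0; pose V (_ : nat) := C.
have eqN : models N (FIff phi (dilator_sentence p)) := proves_models equivalent NR.
have phiN : models N phi := proves_models phi_provable hN.
have [h _] := eqN v V (fun _ => NC).
have /sat_dilator_sentence [D' _ [pD' dD']] := h (phiN v V (fun _ => NC)).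
by rewrite (computes_unique p_computes_D pD').
Qed.

(** With a constant start and no good sequences at all, the conditions on goodness are vacuous and
    the construction just adjoins solutions to [S]. *)
Lemma ideal_exists (S : real) : exists N, models_theory N (tplus (tplus WKL0 RT22) PA) /\
  forall q, N (fun n => proj q S n).
Proof.
have [fam [bitf [grf [cf [subf [qf [clf rch]]]]]]] := rich_family_exists (fun _ => 0).
have [||| rho [Z [[_ Z0 Zl _] [Zb Zr]]]] :=
    @sound_ideal fam bitf grf cf subf qf clf (fun _ => S) _ (fun _ _ => False).
- by move=> rho m; exists 0.
- by move=> T rhon rho Zn Z q iT _ _ h; have [n _ /h] := iT 0.
- by [].
exists (ideal Z); split; first exact: (ideal_theory clf rch Zl Zb Zr).
by move=> q; rewrite -Z0; apply: ideal_proj.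
Qed.

(** The clauses on predilators do not refer to the sets of the model, so they can be read off from
    any one model. *)
Lemma code_predilator : s_predilator (code D).
Proof.
have [N [hN NS]] := ideal_exists (fun _ => false).
by have [] := theory_dilator hN (NS [::]).
Qed.

Lemma function_choice (F : set_of_nat) : s_function F ->
  exists c, forall n y, F (pair_code n y) <-> y = c n.
Proof.
move=> hF; have [c hc] := choice hF; exists c => n y.
by have [Fc uc] := hc n; split=> [/uc|->].
Qed.

Lemma graph_function (F : set_of_nat) c : (forall n y, F (pair_code n y) <-> y = c n) -> s_function F.
Proof. by move=> hF n; exists (c n); split=> [|y]; [apply/hF|move/hF]. Qed.

(** Put [X] and a putative descending sequence into one model of the strong theory. Well-foundedness
    of [X] there follows from true well-foundedness, and the model knows that [D] is a dilator. *)
Lemma bar_wf X : s_linear (s_le X) -> (forall u, ~ descends X u) ->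
  forall c, ~ bar_descends D X c.
Proof.
move=> Xl Xwf c dc; pose G : set_of_nat := fun z => exists n, z = pair_code n (c n).
have GE n y : G (pair_code n y) <-> y = c n.
  by split=> [[m /pair_code_inj [-> ->]]|->]; [|exists n].
have [N [hN NS]] := ideal_exists (join (fun z => `[< X z >]) (fun z => `[< G z >])).
have NX : N X.
  rewrite (_ : X = fun n => proj [:: false] (join (fun z => `[< X z >]) (fun z => `[< G z >])) n) //.
  by apply: funext => z; apply: propext; rewrite /= lh_join; split=> [/asboolP|/asboolP].
have NG : N G.
  rewrite (_ : G = fun n => proj [:: true] (join (fun z => `[< X z >]) (fun z => `[< G z >])) n) //.
  by apply: funext => z; apply: propext; rewrite /= rh_join; split=> [/asboolP|/asboolP].
have [_ /(_ X NX)] := theory_dilator hN NX; case.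
  split=> // -[F _ [/function_choice [u hu] hd]]; apply: (Xwf u) => n.
  have [le nle] : s_le X (u n.+1) (u n) /\ ~ s_le X (u n) (u n.+1).
    by apply: (hd n); rewrite ?addn1 hu.
  by split=> // eu; rewrite eu in nle le.
by exists G => //; split=> [|n x y /GE -> ]; [exact: graph_function GE|rewrite addn1 => /GE ->; apply: dc].
Qed.

Hypothesis phi_not_omega : ~ omega_entails RCA0 phi.

Lemma ladder_exists : exists X (pt : nat -> nat) (e : nat -> nat * seq nat),
  [/\ s_linear (s_le X), forall n, element D (e n), forall n, chain X (e n).2
    & forall n (x : nat), x \in (e n).2 -> s_le X x x] /\
  [/\ injective pt, forall t i, i <= t.+1 -> pt i \in (e t).2
    & forall t j h h', j <= t.+1 -> mono h (e t).2 -> mono h' (e t.+1).2 ->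
      (forall i, i < j -> h (pt i) = h' (pt i)) -> h' (pt j) < h (pt j) ->
      ~ ble D (e t) h (e t.+1) h'].
Proof.
pose pk (x : seq nat * nat) := choice.pickle x.
have pk_inj : injective pk by apply: pcan_inj choice.pickleK.
(* The prescribed real is the table, whose last column is the code of [D]. *)
move/forallNP: phi_not_omega => /(_ (table D pk)) /existsNP [M /not_implyP [MR /not_implyP [MT nphi]]].
have /existsNP [v /existsNP [V /not_implyP [MV nsat]]] := nphi.
have MC : M (code D).
  rewrite (_ : code D = fun m => table D pk (pair_code (0 + 4) m)); first exact: (@model_column M MR (table D pk) 0 MT).
  by apply: funext => m; apply: propext; rewrite table_codeE.
have MRP : models_theory M (tplus RCA0 PA) by apply: models_tplus => //; apply: models_PA.
have eqM : models M (FIff phi (dilator_sentence p)) := proves_models equivalent MRP.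
have [_ h] := eqM v V MV.
have ndil : ~ s_dilator M (code D).
  by move=> dil; apply/nsat/h/sat_dilator_sentence; exists (code D).
have [X MX [Xl [Xwf [F MF [Ffun Fdesc]]]]] : exists2 X, M X &
    s_linear (s_le X) /\ s_wf_rel M (s_le X) /\ exists2 F, M F & s_function F /\
      forall n x y, F (pair_code n x) -> F (pair_code (n + 1) y) ->
        s_bar_le (code D) X y x /\ ~ s_bar_le (code D) X x y.
  apply: contrapT => none; apply: ndil; split; first exact: code_predilator.
  by move=> X MX [Xl Xwf] hF; apply: none; exists X.
have [c Fc] := function_choice Ffun.
have cd : bar_descends D X c by move=> n; apply: Fdesc; rewrite ?addn1 Fc.
have ex n : exists e, codes_element D X e (c n).
  by have [h1 _] := cd n; have [_] := bar_le_elements h1.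
have [e0 he0] := choice ex.
have el n : element D (e0 n) by case: (he0 n).
have ch n : chain X (e0 n).2 by case: (he0 n).
have dm n (x : nat) : x \in (e0 n).2 -> s_le X x x by case: (he0 n) => _ _ + _; apply.
have ds n k : monoX X k ((e0 n).2 ++ (e0 n.+1).2) -> ~ ble D (e0 n) k (e0 n.+1) k.
  by move=> km le1; have [_] := cd n; apply; apply/(bar_leE Xl (he0 n) (he0 n.+1)); exists k.
have st := @settles_in_model D pk pk_inj M F X c e0 MR MT MF MX Xl Xwf Fc he0.
have [pt [f [pinj pmem prule]]] := @ladder D bar_wf X Xl e0 el ch dm ds st.
exists X, pt, (fun t => e0 (f t)); split; last by split.
by split; [exact: Xl|move=> n; exact: el|move=> n; exact: ch|move=> n; exact: dm].
Qed.

Lemma not_equivalent : False.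
Proof.
have [X [pt [e [[Xl el ch dm] [pinj pmem prule]]]]] := ladder_exists.
have [fam [bitf [grf [cf [subf [qf [clf rch]]]]]]] := rich_family_exists pt.
pose st := start X pt e (code D).
pose gd rho (A : real) := good X pt e rho (fun n => A n).
have st_order rho z : st rho (4 * z) = `[< order_of X pt e rho z >].
  (* The order is the left half of the left half of the start. *)
  rewrite /st /start /join (_ : 4 * z = z.*2.*2); last lia.
  by rewrite odd_double /= doubleK odd_double doubleK.
have [||| rho [Z [[tot Z0 Zl nogood] [Zb Zr]]]] := @sound_ideal fam bitf grf cf subf qf clf st _ gd.
- by move=> rho m; apply: start_continuous.
- move=> S rhon rho Zn Z q iS cst cZ hgd.
  (* Finitely many bits of the column and of the order agree with those of some member of the
     sequence, where goodness is known. *)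
  have bits z m b : exists n, [/\ S n, proj q (Zn n) z = proj q Z z, proj q (Zn n) m = proj q Z m &
      forall w, w <= b -> order_of X pt e (rhon n) w <-> order_of X pt e rho w].
    have h1 := @conv_agree fam bitf grf cf subf qf clf S Zn Z (pidx q z + pidx q m).+1 cZ.
    have h2 := @conv_agree fam bitf grf cf subf qf clf S _ _ (4 * b).+1 cst.
    have [n [Sn [a1 a2]]] := inf_ev iS (ev_and h1 h2).
    exists n; split=> //; rewrite ?projE ?a1 //; try lia.
    move=> w wb; have := a2 (4 * w); rewrite !st_order => /(_ ltac:(lia)) E.
    by split=> h; apply/asboolP; [rewrite -E|rewrite E]; apply/asboolP.
  split; [split|].
  + move=> n; have [f hf] := rich_entry rch q n; apply/hf; apply: (conv_fact iS cZ) => k Sk.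
    by apply/hf; have [[h _ _] _] := hgd k Sk; have [x hx] := h n; exists x.
  + move=> n x y hx hy; have [k [Sk ex ey _]] := bits (pair_code n x) (pair_code n y) 0.
    by have [[_ h _] _] := hgd k Sk; apply: (h n); rewrite ?ex ?ey.
  + move=> n x y hx hy.
    have [k [Sk ex ey ew]] := bits (pair_code n x) (pair_code n.+1 y) (pair_code y x).
    have [[_ _ h] _] := hgd k Sk; have [h1 h2] : s_lt_ord (order_of X pt e (rhon k)) y x.
      by apply: (h n); rewrite ?ex ?ey.
    by split=> //; apply/ew.
  + move=> i m; have [f hf] := rich_avoiding rch q i m; apply/hf; apply: (conv_fact iS cZ) => k Sk.
    by apply/hf; have [_ h] := hgd k Sk.
- by move=> rho A; apply: good_tends.
have hN : models_theory (ideal Z) (tplus (tplus WKL0 RT22) PA) := ideal_theory clf rch Zl Zb Zr.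
have proj0 q (W : set_of_nat) : (forall n, proj q (st rho) n <-> W n) -> ideal Z W.
  by move=> h; exists 0, q => n; rewrite Z0 h.
have NX : ideal Z (order_of X pt e rho).
  by apply: (proj0 [:: false; false]) => n; rewrite /= /st /start !lh_join; split=> /asboolP.
have NF : ideal Z (descent pt e rho).
  by apply: (proj0 [:: false; true]) => n; rewrite /= /st /start lh_join rh_join; split=> /asboolP.
(* In the model the order is well-founded, since a descending sequence would be good as [rho] tends
   to infinity; yet [descent] is there and descends in the extension. *)
have [_ /(_ _ NX)] := theory_dilator hN NX; case.
  split; first exact: (order_of_linear pt Xl dm rho).
  move=> [F [k [q Fq]] [Ffun Fd]]; apply: (nogood k q).
  rewrite /gd; have -> : (fun n => is_true (proj q (Z k) n)) = F by apply: funext => n; apply: propext; rewrite Fq.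
  apply: (tends_good Xl tot); have [c Fc] := function_choice Ffun; split.
  - by move=> n; exists (c n); apply/Fc.
  - by move=> n x y /Fc -> /Fc ->.
  - move=> n x y hx hy; have [h1 h2] := Fd n x y hx ltac:(by rewrite addn1).
    by split=> // exy; rewrite exy in h1 h2.
have ex t : exists y, exists2 a, lists [seq pair_code (stage_of pt rho t q) q | q <- (e t).2] a &
    y = pair_code (e t).1 a.
  by have [a ha] := lists_exists [seq pair_code (stage_of pt rho t q) q | q <- (e t).2];
    exists (pair_code (e t).1 a), a.
have [c hc] := choice ex.
have dE n y : descent pt e rho (pair_code n y) <-> y = c n.
  have [a la ca] := hc n; split=> [[t [b [/pair_code_inj [<- ->] lb]]]|->]; last by exists n, a; rewrite ca.
  rewrite ca; congr pair_code; apply: bit_inj => i; apply/idP/idP => /s_memE.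
    by move/lb/la/s_memE.
  by move/la/lb/s_memE.
have dd : bar_descends D (order_of X pt e rho) c := descent_descends Xl el ch dm pinj pmem prule hc.
exists (descent pt e rho) => //; split; first exact: graph_function dE.
by move=> n x y /dE ->; rewrite addn1 => /dE ->; apply: dd.
Qed.

End Main.

Theorem theorem1p7 (phi : formula) (phi_sentence : sentence phi)
  (phi_provable : proves (tplus (tplus WKL0 RT22) PA) phi)
  (phi_not_omega : ~ omega_entails RCA0 phi)
  (D : predilator) (D_dilator : dilator D)
  (p : prog) (p_computes_D : computes p (code D)) :
  ~ proves (tplus RCA0 PA) (FIff phi (dilator_sentence p)).
Proof. move=> equivalent; exact: (not_equivalent phi_provable p_computes_D equivalent phi_not_omega). Qed.
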